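(* Let $p$ be a prime and let $\mathcal{T}$ be a transporter system associated to a saturated fusion system $\mathcal{F}$ over a discrete $p$-toral group $S$. Fix $P\in\mathrm{Ob}(\mathcal{T})$, and let $$\Phi\colon\mathcal{O}(\mathcal{T})^{\mathrm{op}}\longrightarrow\mathrm{Ab}$$ be a functor such that $\Phi(Q)=0$ for each $Q\in\mathrm{Ob}(\mathcal{T})$ with $Q\notin P^{\mathcal{F}}$. Then $$\varprojlim_{\mathcal{O}(\mathcal{T})}{}^{*}(\Phi)\;\cong\;\Lambda^*\bigl(\mathrm{Aut}_{\mathcal{O}(\mathcal{T})}(P);\Phi(P)\bigr).$$
   Context: Fix a prime $p$. $\mathrm{Ab}$ is the category of abelian groups. For a small category $\mathcal{C}$ and a functor $\Phi\colon\mathcal{C}^{\mathrm{op}}\to\mathrm{Ab}$, $\varprojlim_{\mathcal{C}}^{*}(\Phi)$ denotes the graded group of higher limits of $\Phi$: the right derived functors of the inverse limit functor on the category of functors $\mathcal{C}^{\mathrm{op}}\to\mathrm{Ab}$. The isomorphism in the claim is one of graded abelian groups. **Discrete $p$-toral groups.** A discrete $p$-toral group is a group $S$ with a normal subgroup $S_0\cong(\mathbb{Z}/p^\infty)^r$ for some $r\ge0$ such that $S/S_0$ is a finite $p$-group; $S_0$ (the identity component) is uniquely determined. Subgroups of discrete $p$-toral groups are discrete $p$-toral. The order is $|S|=(r,|S/S_0|)$, and orders are compared lexicographically. Write ${}^gx=gxg^{-1}$, $c_g(x)={}^gx$. **Fusion systems.** A fusion system $\mathcal{F}$ over $S$ is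 a category whose objects are all subgroups of $S$ and whose morphism sets $\mathrm{Hom}_{\mathcal{F}}(P,Q)$ are sets of injective homomorphisms (with composition of homomorphisms), which contain all $c_g\colon P\to Q$ for $g\in S$ with ${}^gP\le Q$, and such that every morphism is the composite of an isomorphism in $\mathcal{F}$ followed by an inclusion. Subgroups are $\mathcal{F}$-conjugate if they are isomorphic in $\mathcal{F}$; $P^{\mathcal{F}}$ is the $\mathcal{F}$-conjugacy class of $P$. Write $\mathrm{Aut}_{\mathcal{F}}(P)=\mathrm{Hom}_{\mathcal{F}}(P,P)$, $\mathrm{Out}_{\mathcal{F}}(P)=\mathrm{Aut}_{\mathcal{F}}(P)/\mathrm{Inn}(P)$, $\mathrm{Aut}_S(P)=\{c_g|_P : g\in N_S(P)\}$, $\mathrm{Out}_S(P)=\mathrm{Aut}_S(P)/\mathrm{Inn}(P)$. A subgroup $P\le S$ is fully centralized (fully normalized) in $\mathcal{F}$ if $|C_S(P)|\ge|C_S(Q)|$ (resp. $|N_S(P)|\ge|N_S(Q)|$) for all $Q\in P^{\mathcal{F}}$. $\mathcal{F}$ is saturated if: (I) for each fully normalized $P\le S$, $P$ is fully centralized, $\mathrm{Out}_{\mathcal{F}}(P)$ is finite, and $\mathrm{Out}_S(P)$ is a Sylow $p$-subgroup of $\mathrm{Out}_{\mathcal{F}}(P)$; (II) for each $P\le S$ and $\varphi\in\mathrm{Hom}_{\mathcal{F}}(P,S)$ with $\varphi(P)$ fully centralized, if $N_\varphi=\{g\in N_S(P) : \varphi c_g\varphi^{-1}\in\mathrm{Aut}_S(\varphi(P))\}$,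 then there is $\overline{\varphi}\in\mathrm{Hom}_{\mathcal{F}}(N_\varphi,S)$ with $\overline{\varphi}|_P=\varphi$; (III) if $P_1\le P_2\le\cdots$ are subgroups of $S$, $P_\infty=\bigcup_nP_n$, and $\varphi\in\mathrm{Hom}(P_\infty,S)$ satisfies $\varphi|_{P_n}\in\mathrm{Hom}_{\mathcal{F}}(P_n,S)$ for all $n$, then $\varphi\in\mathrm{Hom}_{\mathcal{F}}(P_\infty,S)$. **Transporter systems.** For a set $\mathcal{H}$ of subgroups of $S$, the transporter category $\mathcal{T}_{\mathcal{H}}(S)$ has object set $\mathcal{H}$ and morphism sets $N_S(P,Q)=\{g\in S : {}^gP\le Q\}$, with composition given by multiplication. A transporter system associated to $\mathcal{F}$ is a category $\mathcal{T}$ whose objects form a nonempty set of subgroups of $S$ closed under $\mathcal{F}$-conjugacy and overgroups, together with functors $\mathcal{T}_{\mathrm{Ob}(\mathcal{T})}(S)\xrightarrow{\varepsilon}\mathcal{T}\xrightarrow{\rho}\mathcal{F}$ such that (writing $\varepsilon_{P,Q}$, $\rho_{P,Q}$ for the maps on morphism sets, $\varepsilon_P=\varepsilon_{P,P}$, $\rho_P=\rho_{P,P}$): (A1) $\varepsilon$ is the identity on objects and $\rho$ is the inclusion on objects; (A2) for $P,Q\in\mathrm{Ob}(\mathcal{T})$, the group $E(P)=\mathrm{Ker}[\rho_P\colon\mathrm{Aut}_{\mathcal{T}}(P)\to\mathrm{Aut}_{\mathcal{F}}(P)]$ acts freely on $\mathrm{Mor}_{\mathcal{T}}(P,Q)$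 by right composition, and $\rho_{P,Q}\colon\mathrm{Mor}_{\mathcal{T}}(P,Q)\to\mathrm{Hom}_{\mathcal{F}}(P,Q)$ is (surjective and) the orbit map for this action; also $E(Q)$ acts freely on $\mathrm{Mor}_{\mathcal{T}}(P,Q)$ by left composition; (B) for $P,Q\in\mathrm{Ob}(\mathcal{T})$, $\varepsilon_{P,Q}\colon N_S(P,Q)\to\mathrm{Mor}_{\mathcal{T}}(P,Q)$ is injective, and $\rho_{P,Q}\circ\varepsilon_{P,Q}$ sends $g$ to $c_g\in\mathrm{Hom}_{\mathcal{F}}(P,Q)$; (C) for $\varphi\in\mathrm{Mor}_{\mathcal{T}}(P,Q)$ and $g\in P$, $\varphi\circ\varepsilon_P(g)=\varepsilon_Q(\rho(\varphi)(g))\circ\varphi$; (I) each $\mathcal{F}$-conjugacy class of subgroups in $\mathrm{Ob}(\mathcal{T})$ contains a subgroup $P$ such that the index of $\varepsilon_P(N_S(P))$ in $\mathrm{Aut}_{\mathcal{T}}(P)$ is finite and prime to $p$; (II) if $\varphi\in\mathrm{Iso}_{\mathcal{T}}(P,Q)$, $P\trianglelefteq\overline{P}\le S$ and $Q\trianglelefteq\overline{Q}\le S$ satisfy $\varphi\circ\varepsilon_P(\overline{P})\circ\varphi^{-1}\le\varepsilon_Q(\overline{Q})$, then there is $\overline{\varphi}\in\mathrm{Mor}_{\mathcal{T}}(\overline{P},\overline{Q})$ with $\overline{\varphi}\circ\varepsilon_{P,\overline{P}}(1)=\varepsilon_{Q,\overline{Q}}(1)\circ\varphi$; (III) if $P_1\le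 P_2\le\cdots$ are in $\mathrm{Ob}(\mathcal{T})$, $P=\bigcup_iP_i$, and $\varphi_i\in\mathrm{Mor}_{\mathcal{T}}(P_i,S)$ satisfy $\varphi_i=\varphi_{i+1}\circ\varepsilon_{P_i,P_{i+1}}(1)$ for all $i$, then there is $\varphi\in\mathrm{Mor}_{\mathcal{T}}(P,S)$ with $\varphi\circ\varepsilon_{P_i,P}(1)=\varphi_i$ for all $i$. **Orbit category of $\mathcal{T}$.** $\mathcal{O}(\mathcal{T})$ has the same objects as $\mathcal{T}$, and $\mathrm{Mor}_{\mathcal{O}(\mathcal{T})}(P,Q)=\varepsilon_Q(Q)\backslash\mathrm{Mor}_{\mathcal{T}}(P,Q)$ (orbits under left composition). In particular $\mathrm{Aut}_{\mathcal{O}(\mathcal{T})}(P)=\varepsilon_P(P)\backslash\mathrm{Aut}_{\mathcal{T}}(P)$. **The functors $\Lambda^*$.** For a group $G$, $\mathcal{O}_p(G)$ is the category whose objects are the $p$-subgroups of $G$ and with $\mathrm{Mor}_{\mathcal{O}_p(G)}(P,Q)=Q\backslash\{g\in G : {}^gP\le Q\}$, composition being induced by multiplication. For a locally finite group $G$ and a $\mathbb{Z}G$-module $M$, let $F_M\colon\mathcal{O}_p(G)^{\mathrm{op}}\to\mathrm{Ab}$ be the functor with $F_M(1)=M$ and $F_M(P)=0$ for each $p$-subgroup $P\ne1$, where $\mathrm{Aut}_{\mathcal{O}_p(G)}(1)\cong G$ has the given action on $M$. Set $\Lambda^*(G;M)=\varprojlim^{*}_{\mathcal{O}_p(G)}(F_M)$.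 In the claim, $\Phi(P)$ is regarded as a module over $\Gamma=\mathrm{Aut}_{\mathcal{O}(\mathcal{T})}(P)$ via $\Phi$, so that $\gamma\in\mathrm{Aut}_{\mathcal{O}_p(\Gamma)}(1)\cong\Gamma$ induces $F_{\Phi(P)}(\gamma)=\Phi(\gamma)$ on $\Phi(P)$. *)

(* Defs.v *)
From HB Require Import structures.
From mathcomp Require Import all_boot all_order all_algebra.
From mathcomp Require Import all_classical.

Set Implicit Arguments.
Unset Strict Implicit.
Unset Printing Implicit Defensive.

Import Order.TTheory GRing.Theory Num.Theory.
Local Open Scope classical_set_scope.
Local Open Scope card_scope.
Local Open Scope ring_scope.

Record add_subgroup (V : zmodType) := AddSubgroup {
  add_set :> V -> Prop;
  add_set0 : add_set 0;
  add_setB : forall x y, add_set x -> add_set y -> add_set (x - y) }.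

Definition add_pred (V : zmodType) (A : add_subgroup V) : {pred V} :=
  fun x => `[< add_set A x >].

Fact add_pred_closed (V : zmodType) (A : add_subgroup V) :
  zmod_closed (add_pred A).
Proof.
split; first exact/asboolP/add_set0.
by move=> x y /asboolP Ax /asboolP Ay; exact/asboolP/add_setB.
Qed.

HB.instance Definition _ (V : zmodType) (A : add_subgroup V) :=
  GRing.isZmodClosed.Build V (add_pred A) (add_pred_closed A).

Definition sub_zmod (V : zmodType) (A : add_subgroup V) : Type :=
  {x : V | add_pred A x}.
HB.instance Definition _ V A := SubChoice.on (@sub_zmod V A).
HB.instance Definition _ V A :=
  [SubChoice_isSubZmodule of @sub_zmod V A by <:].

Definition sub_mk (V : zmodType) (A : add_subgroup V) x (Ax : A x) :
  sub_zmod A := exist _ x (asboolT Ax).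

Lemma sub_zmodP (V : zmodType) (A : add_subgroup V) (x : sub_zmod A) :
  A (val x).
Proof. exact/asboolP/(valP x). Qed.

Definition quot_zmod (V : zmodType) (A : add_subgroup V) : zmodType :=
  Quotient.quot (add_pred A).

Definition quot_proj (V : zmodType) (A : add_subgroup V) :
  {additive V -> quot_zmod A} := \pi_(quot_zmod A)%qT.

Lemma quot_proj_eq0 (V : zmodType) (A : add_subgroup V) x :
  quot_proj A x = 0 <-> A x.
Proof.
rewrite -(raddf0 (quot_proj A)); split=> [/eqP|Ax].
  by rewrite /= -Quotient.idealrBE subr0 => /asboolP.
by apply/eqP; rewrite /= -Quotient.idealrBE subr0; apply/asboolP.
Qed.

Lemma quot_proj_surj (V : zmodType) (A : add_subgroup V) (y : quot_zmod A) :
  exists x, quot_proj A x = y.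
Proof. by exists (repr y); exact: reprK. Qed.

Definition integers : add_subgroup rat :=
  @AddSubgroup rat [set x | x \is a Num.int] (rpred0 _) (fun x y => @rpredB _ _ x y).

Definition QZ : zmodType := quot_zmod integers.

Lemma QZ_divisible (q : QZ) n : (0 < n)%N -> exists r : QZ, r *+ n = q.
Proof.
move=> n0; have [x <-] := quot_proj_surj q.
exists (quot_proj _ (x / n%:R)); rewrite -raddfMn; congr (quot_proj _ _).
by rewrite -[LHS]mulr_natr divfK // pnatr_eq0 -lt0n.
Qed.

Lemma QZ_torsion n : (1 < n)%N -> exists2 q : QZ, q <> 0 & q *+ n = 0.
Proof.
move=> n1; exists (quot_proj _ (n%:R^-1)).
  move/quot_proj_eq0 => /= /intrP [m hm].
  have n0 : n%:R != 0 :> rat by rewrite pnatr_eq0 -lt0n ltnW.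
  have : (m * n%:Z) = 1.
    by apply: (@intr_inj rat); rewrite intrM -hm pmulrn mulVf.
  move/eqP; rewrite intUnitRing.mulzn_eq1 // => /andP[_] /eqP.
  by move=> [nE]; rewrite nE in n1.
rewrite -raddfMn; apply/quot_proj_eq0 => /=.
suff -> : (n%:R^-1 *+ n) = 1 :> rat by exact: rpred1.
by rewrite -[LHS]mulr_natr mulVf // pnatr_eq0 -lt0n ltnW.
Qed.

Section Extension.
Variable B : zmodType.

Record partial_hom (G : set (B * QZ)) : Prop := PartialHom {
  ph0 : G (0, 0);
  phB : forall x y, G x -> G y -> G (x.1 - y.1, x.2 - y.2);
  ph_fun : forall q, G (0, q) -> q = 0 }.

Lemma ph_inj G b q q' : partial_hom G -> G (b, q) -> G (b, q') -> q = q'.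
Proof.
by move=> hG h h'; apply/subr0_eq/(ph_fun hG); have /= := phB hG h h'; rewrite subrr.
Qed.

Lemma phN G b q : partial_hom G -> G (b, q) -> G (- b, - q).
Proof. by move=> hG h; have /= := phB hG (ph0 hG) h; rewrite !sub0r. Qed.

Lemma phD G b q b' q' : partial_hom G -> G (b, q) -> G (b', q') ->
  G (b + b', q + q').
Proof.
by move=> hG h /(phN hG) h'; have /= := phB hG h h'; rewrite !opprK.
Qed.

Lemma phMz G b q (n : int) : partial_hom G -> G (b, q) -> G (b *~ n, q *~ n).
Proof.
move=> hG h; have hN (m : nat) : G (b *+ m, q *+ m).
  elim: m => [|m IH]; first by rewrite !mulr0n; exact: ph0.
  by rewrite !mulrS; exact: phD.
case: n => n; first by rewrite -!pmulrn.
by rewrite !NegzE !mulrNz -!pmulrn; exact: phN.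
Qed.

Lemma ph_extend G b : partial_hom G ->
  exists2 G', partial_hom G' & G `<=` G' /\ exists q, G' (b, q).
Proof.
move=> hG.
have [q hq] : exists q, forall (k : int) e, G (b *~ k, e) -> e = q *~ k.
  pose I (n : nat) := `[< exists e, G (b *+ n.+1, e) >].
  have [[n0 In0]|noI] := pselect (exists n, I n); last first.
    exists 0 => k e; case: k => [[|k]|k] h.
    - by rewrite mulr0z in h *; exact: ph_fun h.
    - by case: noI; exists k; apply/asboolP; exists e; rewrite pmulrn.
    - case: noI; exists k; apply/asboolP; exists (- e).
      by have := phN hG h; rewrite NegzE mulrNz opprK -pmulrn.
  have exI : exists n, I n by exists n0.
  case: (ex_minnP exI) => n /asboolP [e0 he0] nmin.
  have [q qe] := QZ_divisible e0 (ltn0Sn n).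
  exists q => k e hk.
  have km := divz_eq k n.+1%:Z.
  set a := (k %/ n.+1)%Z in km; set r := (k %% n.+1)%Z in km.
  have r0 : 0 <= r by exact: modz_ge0.
  have rn : r < n.+1 by exact: ltz_pmod.
  have hr : G (b *~ r, e - e0 *~ a).
    have h := phMz (- a) hG he0.
    have := phD hG hk h.
    rewrite {1}km mulrzDr addrC pmulrn -mulrzA addrA -mulrzDr.
    by rewrite mulrN [n.+1%:Z * a]mulrC addNr mulr0z add0r mulrNz.
  case: r r0 rn hr km => // [[|r]] _ rn hr km.
    move: hr; rewrite mulr0z => /(ph_fun hG) /subr0_eq ->.
    by rewrite km addr0 -qe pmulrn -mulrzA mulrC.
  have /nmin : I r by apply/asboolP; exists (e - e0 *~ a); rewrite pmulrn.
  by rewrite leqNgt -ltnS; move: rn; rewrite ltz_nat => ->.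
exists [set x | exists (y : B * QZ) k, G y /\ x = (y.1 + b *~ k, y.2 + q *~ k)].
  split.
  - by exists (0, 0), 0; split; [exact: ph0 | rewrite !mulr0z !addr0].
  - move=> _ _ [y [k [hy ->]]] [z [l [hz ->]]].
    exists (y.1 - z.1, y.2 - z.2), (k - l); split; first exact: phB.
    by rewrite /= !mulrzBr; congr pair; rewrite opprD addrACA.
  - move=> q' [[y1 y2] [k [hy [e1 e2]]]]; rewrite {}e2 /=.
    move: e1 => /= /esym/addr0_eq e1.
    have := phN hG hy; rewrite e1 => /hq h.
    by rewrite -h addrN.
split.
  by move=> [x1 x2] hx; exists (x1, x2), 0; split => //; rewrite !mulr0z !addr0.
exists q, (0, 0), 1; split; first exact: ph0.
by rewrite !mulr1z !add0r.
Qed.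

Lemma QZ_extension G : partial_hom G ->
  exists g : {additive B -> QZ}, forall b q, G (b, q) -> g b = q.
Proof.
move=> hG.
pose P := [set A : set (B * QZ) | partial_hom (A `|` G)].
have PU F : F `<=` P -> total_on F subset -> P (\bigcup_(X in F) X).
  move=> FP Ftot.
  have key x y : (\bigcup_(X in F) X `|` G) x -> (\bigcup_(X in F) X `|` G) y ->
      exists2 A, partial_hom A & A `<=` (\bigcup_(X in F) X `|` G) /\ A x /\ A y.
    have sub X : F X -> X `|` G `<=` (\bigcup_(X in F) X `|` G).
      by move=> FX z [Xz|Gz]; [left; exists X|right].
    move=> [[X FX Xx]|Gx] [[Y FY Yy]|Gy].
    - have [XY|YX] := Ftot _ _ FX FY.
        exists (Y `|` G); [exact: FP|split; [exact: sub|]].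
        by split; left => //; exact: XY.
      exists (X `|` G); [exact: FP|split; [exact: sub|]].
      by split; left => //; exact: YX.
    - exists (X `|` G); [exact: FP|split; [exact: sub|]].
      by split; [left|right].
    - exists (Y `|` G); [exact: FP|split; [exact: sub|]].
      by split; [right|left].
    - by exists G => //; split => // z Gz; right.
  split.
  - by right; exact: ph0.
  - move=> x y hx hy; have [A hA [AU [Ax Ay]]] := key _ _ hx hy.
    by apply: AU; exact: phB.
  - move=> q hq; have [A hA [AU [Aq _]]] := key _ _ hq hq.
    exact: ph_fun hA _ Aq.
have [A [hA Amax]] := Zorn_bigcup PU.
have {}Amax b : exists q, (A `|` G) (b, q).
  have [G' hG' [AG' [q hq]]] := ph_extend b hA.
  exists q; apply: contrapT => nAq.
  apply: (Amax G').
    split; first by move=> x Ax; apply: AG'; left.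
    by move=> G'A; apply: nAq; left; exact: G'A.
  rewrite /P /= (_ : G' `|` G = G') //.
  by apply/setUidPl => x Gx; apply: AG'; right.
have [g hg] := choice Amax.
have gadd : zmod_morphism g.
  move=> x y; apply: (ph_inj hA (hg (x - y))).
  exact: (phB hA (hg x) (hg y)).
pose gM := GRing.isZmodMorphism.Build _ _ g gadd.
pose gA : {additive B -> QZ} := HB.pack g gM.
exists gA => b q Gq; apply: (ph_inj hA (hg b)); by right.
Qed.

End Extension.

Lemma QZ_injective (A B : zmodType) (i : {additive A -> B}) (f : {additive A -> QZ}) :
  injective i -> exists g : {additive B -> QZ}, forall a, g (i a) = f a.
Proof.
move=> i_inj.
have [|g hg] := @QZ_extension B [set x | exists a, x = (i a, f a)].
  split.
  - by exists 0; rewrite !raddf0.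
  - by move=> _ _ [a ->] [b ->]; exists (a - b); rewrite !raddfB.
  - move=> q [a [ia ->]]; rewrite (_ : a = 0) ?raddf0 //.
    by apply: i_inj; rewrite raddf0.
by exists g => a; apply: hg; exists a.
Qed.

Lemma QZ_cogenerator (A : zmodType) (a : A) :
  (forall f : {additive A -> QZ}, f a = 0) -> a = 0.
Proof.
move=> h; apply: contrapT => a0.
suff [q q0 hq] : exists2 q : QZ, q <> 0 & forall k : int, a *~ k = 0 -> q *~ k = 0.
  have [|f hf] := @QZ_extension A [set x | exists k : int, x = (a *~ k, q *~ k)].
    split.
    - by exists 0; rewrite !mulr0z.
    - by move=> _ _ [k ->] [l ->]; exists (k - l); rewrite !mulrzBr.
    - by move=> q' [k [/esym hk ->]]; exact: hq.
  apply: q0; rewrite -(h f); symmetry; apply: hf.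
  by exists 1; rewrite !mulr1z.
pose I (n : nat) := a *+ n.+1 == 0.
have [exI|noI] := pselect (exists n, I n); last first.
  have [q q0 _] := QZ_torsion (ltnSn 1).
  exists q => // [[[|k]|k]]; first by rewrite !mulr0z.
    by rewrite -pmulrn => /eqP ak; case: noI; exists k.
  rewrite NegzE mulrNz -pmulrn => /eqP; rewrite oppr_eq0 => ak.
  by case: noI; exists k.
case: (ex_minnP exI) => n /eqP an nmin.
have n1 : (1 < n.+1)%N by case: n an {nmin} => //; rewrite mulr1n => /a0.
have [q q0 qn] := QZ_torsion n1.
exists q => // k ak.
have km := divz_eq k n.+1%:Z.
set d := (k %/ n.+1)%Z in km; set r := (k %% n.+1)%Z in km.
have r0 : 0 <= r by exact: modz_ge0.
have rn : r < n.+1 by exact: ltz_pmod.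
have ar : a *~ r = 0.
  by move: ak; rewrite km mulrzDr mulrC mulrzA -pmulrn an mul0rz add0r.
case: r r0 rn ar km => // [[|r]] _ rn ar km.
  by rewrite km addr0 mulrC mulrzA -pmulrn qn mul0rz.
have /nmin : I r by rewrite /I pmulrn ar.
by rewrite leqNgt -ltnS; move: rn; rewrite ltz_nat => ->.
Qed.

Definition mk_additive (U V : zmodType) (f : U -> V) (fB : zmod_morphism f) :
  {additive U -> V} := HB.pack f (GRing.isZmodMorphism.Build U V f fB).

Fact quot_lift_subproof (V W : zmodType) (A : add_subgroup V)
    (f : {additive V -> W}) (fA : forall a, A a -> f a = 0) x :
  f (repr (quot_proj A x)) = f x.
Proof.
apply/subr0_eq; rewrite -raddfB; apply: fA; apply/quot_proj_eq0.
by rewrite raddfB /= reprK subrr.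
Qed.

Fact quot_lift_additive (V W : zmodType) (A : add_subgroup V)
    (f : {additive V -> W}) (fA : forall a, A a -> f a = 0) :
  zmod_morphism (fun y : quot_zmod A => f (repr y)).
Proof.
move=> y z; have [[a <-] [b <-]] := (quot_proj_surj y, quot_proj_surj z).
by rewrite -raddfB !quot_lift_subproof // raddfB.
Qed.

Definition quot_lift (V W : zmodType) (A : add_subgroup V)
    (f : {additive V -> W}) (fA : forall a, A a -> f a = 0) :
  {additive quot_zmod A -> W} := mk_additive (quot_lift_additive fA).

Lemma quot_liftE (V W : zmodType) (A : add_subgroup V) (f : {additive V -> W})
    (fA : forall a, A a -> f a = 0) x : quot_lift fA (quot_proj A x) = f x.
Proof. exact: quot_lift_subproof. Qed.

Fact image_setB (U V : zmodType) (f : {additive U -> V}) x y :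
  (exists a, f a = x) -> (exists a, f a = y) -> exists a, f a = x - y.
Proof. by move=> [a <-] [b <-]; exists (a - b); rewrite raddfB. Qed.

Definition image_sub (U V : zmodType) (f : {additive U -> V}) : add_subgroup V :=
  AddSubgroup (ex_intro (fun a => f a = 0) 0 (raddf0 f)) (@image_setB U V f).

Record category (Ob : Type) := Category {
  mor : Ob -> Ob -> Type;
  idmor : forall x, mor x x;
  compm : forall x y z, mor y z -> mor x y -> mor x z;
  compmA : forall x y z t (h : mor z t) (g : mor y z) (f : mor x y),
    compm h (compm g f) = compm (compm h g) f;
  comp1m : forall x y (f : mor x y), compm (idmor y) f = f;
  compm1 : forall x y (f : mor x y), compm f (idmor x) = f }.

Notation "g '\oc' f" := (compm g f) (at level 40, left associativity).

Definition isomorphic Ob (C : category Ob) (x y : Ob) : Prop :=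
  exists (f : mor C x y) (g : mor C y x), g \oc f = idmor C x /\ f \oc g = idmor C y.

(* Functors that are the identity on objects. *)
Record functor Ob (C D : category Ob) := Functor {
  fmap : forall x y, mor C x y -> mor D x y;
  fmap_id : forall x, fmap (idmor C x) = idmor D x;
  fmap_comp : forall x y z (g : mor C y z) (f : mor C x y),
    fmap (g \oc f) = fmap g \oc fmap f }.

Definition full_subcategory Ob (C : category Ob) (H : set Ob) :
    category {x | H x} :=
  @Category {x | H x} (fun x y => mor C (sval x) (sval y))
    (fun x => idmor C (sval x)) (fun x y z g f => g \oc f)
    (fun x y z t => @compmA _ C (sval x) (sval y) (sval z) (sval t))
    (fun x y => @comp1m _ C (sval x) (sval y))
    (fun x y => @compm1 _ C (sval x) (sval y)).

Record presheaf Ob (C : category Ob) := Presheaf {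
  psh_ob :> Ob -> zmodType;
  psh_map : forall x y, mor C x y -> {additive psh_ob y -> psh_ob x};
  psh_id : forall x a, psh_map (idmor C x) a = a;
  psh_comp : forall x y z (g : mor C y z) (f : mor C x y) a,
    psh_map (g \oc f) a = psh_map f (psh_map g a) }.

Record psh_hom Ob (C : category Ob) (Phi Psi : presheaf C) := PshHom {
  ph_map :> forall x, {additive Phi x -> Psi x};
  ph_nat : forall x y (f : mor C x y) a,
    ph_map x (psh_map Phi f a) = psh_map Psi f (ph_map y a) }.

Definition psh_hom_comp Ob (C : category Ob) (Phi Psi Xi : presheaf C)
    (b : psh_hom Psi Xi) (a : psh_hom Phi Psi) : psh_hom Phi Xi :=
  @PshHom _ C Phi Xi (fun x => b x \o a x) (fun x y f u =>
    etrans (congr1 (b x) (ph_nat a f u)) (ph_nat b f (a y u))).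

Definition psh_mono Ob (C : category Ob) (Phi Psi : presheaf C)
    (i : psh_hom Phi Psi) : Prop := forall x, injective (i x).

Definition psh_injective Ob (C : category Ob) (I : presheaf C) : Prop :=
  forall (Phi Psi : presheaf C) (i : psh_hom Phi Psi) (f : psh_hom Phi I),
    psh_mono i ->
    exists g : psh_hom Psi I, forall x a, g x (i x a) = f x a.

Definition sections Ob (C : category Ob) (Phi : presheaf C) : Type :=
  forall x, Phi x.

Section Sections.
Variables (Ob : Type) (C : category Ob) (Phi : presheaf C).
HB.instance Definition _ := Choice.copy (sections Phi) (forall x, Phi x).

Let add (s t : sections Phi) : sections Phi := fun x => s x + t x.
Let opp (s : sections Phi) : sections Phi := fun x => - s x.
Let zero : sections Phi := fun x => 0.
Fact sections_addA : associative add.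
Proof. by move=> s t u; apply: functional_extensionality_dep => x; exact: addrA. Qed.
Fact sections_addC : commutative add.
Proof. by move=> s t; apply: functional_extensionality_dep => x; exact: addrC. Qed.
Fact sections_add0 : left_id zero add.
Proof. by move=> s; apply: functional_extensionality_dep => x; exact: add0r. Qed.
Fact sections_addN : left_inverse zero opp add.
Proof. by move=> s; apply: functional_extensionality_dep => x; exact: addNr. Qed.
HB.instance Definition _ := GRing.isZmodule.Build (sections Phi)
  sections_addA sections_addC sections_add0 sections_addN.

Definition compatible (s : sections Phi) : Prop :=
  forall x y (f : mor C x y), psh_map Phi f (s y) = s x.

Fact compatible0 : compatible 0.
Proof. by move=> x y f; exact: raddf0. Qed.
Fact compatibleB s t : compatible s -> compatible t -> compatible (s - t).
Proof. by move=> hs ht x y f; rewrite raddfB hs ht. Qed.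

Definition psh_lim : zmodType := sub_zmod (AddSubgroup compatible0 compatibleB).
End Sections.

Section LimMap.
Variables (Ob : Type) (C : category Ob) (Phi Psi : presheaf C).
Variable a : psh_hom Phi Psi.

Definition lim_map_sections (s : psh_lim Phi) : sections Psi :=
  fun x => a x (val s x).
Fact lim_map_compatible s : compatible (lim_map_sections s).
Proof.
by move=> x y f; rewrite -ph_nat; congr (a x _); exact: (sub_zmodP s).
Qed.
Definition lim_map_fun (s : psh_lim Phi) : psh_lim Psi :=
  sub_mk (A := AddSubgroup _ _) (lim_map_compatible s).
Fact lim_map_additive : zmod_morphism lim_map_fun.
Proof.
move=> s t; apply/val_inj; apply: functional_extensionality_dep => x.
exact: raddfB.
Qed.
Definition lim_map : {additive psh_lim Phi -> psh_lim Psi} :=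
  mk_additive lim_map_additive.
End LimMap.

Record cochain_complex := CochainComplex {
  cc_ob :> nat -> zmodType;
  cc_d : forall n, {additive cc_ob n -> cc_ob n.+1};
  cc_dd : forall n a, cc_d n.+1 (cc_d n a) = 0 }.

Section Cohomology.
Variable K : cochain_complex.

Definition is_cocycle n (a : K n) : Prop := cc_d K n a = 0.
Fact is_cocycle0 n : is_cocycle (0 : K n).
Proof. exact: raddf0. Qed.
Fact is_cocycleB n (a b : K n) : is_cocycle a -> is_cocycle b -> is_cocycle (a - b).
Proof. by rewrite /is_cocycle raddfB => -> ->; rewrite subrr. Qed.
Definition cocycles n : zmodType :=
  sub_zmod (AddSubgroup (@is_cocycle0 n) (@is_cocycleB n)).

Definition is_coboundary n : K n -> Prop :=
  match n with
  | 0 => fun a => a = 0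
  | m.+1 => fun a => exists b, cc_d K m b = a
  end.
Fact is_coboundary0 n : is_coboundary (0 : K n).
Proof. by case: n => //= n; exists 0; exact: raddf0. Qed.
Fact is_coboundaryB n (a b : K n) :
  is_coboundary a -> is_coboundary b -> is_coboundary (a - b).
Proof.
case: n a b => [|n] a b /=; first by move=> -> ->; rewrite subrr.
exact: image_setB.
Qed.
Definition coboundaries n : add_subgroup (cocycles n) :=
  @AddSubgroup (cocycles n) (fun z => is_coboundary (val z))
    (is_coboundary0 n) (fun y z => @is_coboundaryB n (val y) (val z)).

Definition cohomology n : zmodType := quot_zmod (coboundaries n).
End Cohomology.

Record injective_resolution Ob (C : category Ob) (Phi : presheaf C) :=
  InjectiveResolution {
  ir_ob :> nat -> presheaf C;
  ir_d : forall n, psh_hom (ir_ob n) (ir_ob n.+1);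
  ir_aug : psh_hom Phi (ir_ob 0);
  ir_injective : forall n, psh_injective (ir_ob n);
  ir_aug_mono : psh_mono ir_aug;
  ir_exact0 : forall x a, ir_d 0 x a = 0 <-> exists b, ir_aug x b = a;
  ir_exact : forall n x a, ir_d n.+1 x a = 0 <-> exists b, ir_d n x b = a }.

Arguments ir_d {Ob C Phi} _ n.
Arguments ir_aug {Ob C Phi} _.

Fact lim_dd Ob (C : category Ob) (Phi : presheaf C)
    (R : injective_resolution Phi) n (a : psh_lim (R n)) :
  lim_map (ir_d R n.+1) (lim_map (ir_d R n) a) = 0.
Proof.
apply/val_inj; apply: functional_extensionality_dep => x.
by apply/ir_exact; exists (val a x).
Qed.

Definition lim_complex Ob (C : category Ob) (Phi : presheaf C)
    (R : injective_resolution Phi) : cochain_complex :=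
  CochainComplex (@lim_dd _ _ _ R).

Section Cofree.
Variables (Ob : Type) (C : category Ob) (Phi : presheaf C).

(* cofree Phi = prod_(c, chi) Hom_Z(Z[mor c -], Q/Z), over all objects c and all
   homomorphisms chi : Phi c -> Q/Z. *)
Definition cofree_index (x : Ob) : Type :=
  {c : Ob & (mor C c x * {additive Phi c -> QZ})%type}.
Definition cofree_index_map x y (f : mor C x y) (u : cofree_index x) :
    cofree_index y :=
  existT _ (projT1 u) (f \oc (projT2 u).1, (projT2 u).2).
Definition cofree_ob x : zmodType := cofree_index x -> QZ.
Fact cofree_map_additive x y (f : mor C x y) :
  zmod_morphism (fun (s : cofree_ob y) => (fun u => s (cofree_index_map f u)) : cofree_ob x).
Proof. by []. Qed.
Definition cofree_map x y (f : mor C x y) : {additive cofree_ob y -> cofree_ob x} :=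
  mk_additive (cofree_map_additive f).
Fact cofree_map_id x a : cofree_map (idmor C x) a = a.
Proof.
by apply/funext => -[c [h chi]] /=; rewrite /cofree_index_map /= comp1m.
Qed.
Fact cofree_map_comp x y z (g : mor C y z) (f : mor C x y) a :
  cofree_map (g \oc f) a = cofree_map f (cofree_map g a).
Proof.
by apply/funext => -[c [h chi]] /=; rewrite /cofree_index_map /= compmA.
Qed.
Definition cofree : presheaf C := Presheaf cofree_map_id cofree_map_comp.

Definition cofree_emb_fun x (a : Phi x) : cofree x :=
  fun u => (projT2 u).2 (psh_map Phi (projT2 u).1 a).
Fact cofree_emb_additive x : zmod_morphism (@cofree_emb_fun x).
Proof.
by move=> a b; apply/funext => -[c [h chi]]; rewrite /cofree_emb_fun !raddfB.
Qed.
Fact cofree_emb_nat x y (f : mor C x y) a :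
  mk_additive (@cofree_emb_additive x) (psh_map Phi f a) =
  psh_map cofree f (mk_additive (@cofree_emb_additive y) a).
Proof.
by apply/funext => -[c [h chi]] /=; rewrite /cofree_emb_fun /= psh_comp.
Qed.
Definition cofree_emb : psh_hom Phi cofree := PshHom cofree_emb_nat.

Lemma cofree_emb_mono : psh_mono cofree_emb.
Proof.
move=> x a b ab; apply/subr0_eq/QZ_cogenerator => chi.
move: ab => /(congr1 (fun s => s (existT _ x (idmor C x, chi)))).
by rewrite /= /cofree_emb_fun /= !psh_id raddfB => ->; rewrite subrr.
Qed.

Lemma cofree_injective : psh_injective cofree.
Proof.
move=> A B i f i_mono.
pose ev c (chi : {additive Phi c -> QZ}) (a : A c) : QZ :=
  f c a (existT _ c (idmor C c, chi)).
have evB c chi : zmod_morphism (@ev c chi).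
  by move=> a b; rewrite /ev raddfB.
have ext c chi : exists g : {additive B c -> QZ}, forall a, g (i c a) = ev c chi a.
  exact: (QZ_injective (mk_additive (evB c chi)) (i_mono c)).
pose g c chi := sval (cid (ext c chi)).
have gE c chi a : g c chi (i c a) = ev c chi a by exact: (svalP (cid (ext c chi)) a).
pose G x (b : B x) : cofree x :=
  fun u => g (projT1 u) (projT2 u).2 (psh_map B (projT2 u).1 b).
have GB x : zmod_morphism (G x).
  by move=> a b; apply/funext => -[c [h chi]]; rewrite /G !raddfB.
have Gnat x y (k : mor C x y) b : mk_additive (GB x) (psh_map B k b) =
    psh_map cofree k (mk_additive (GB y) b).
  by apply/funext => -[c [h chi]] /=; rewrite /G /= psh_comp.
exists (PshHom Gnat) => x a; apply/funext => -[c [h chi]] /=.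
rewrite /G /= -ph_nat gE /ev ph_nat /=; congr (f x a _).
by rewrite /cofree_index_map /= compm1.
Qed.

Fact cosyzygy_map_subproof x y (f : mor C x y) a :
  image_sub (cofree_emb y) a -> (quot_proj _ \o psh_map cofree f) a = 0 :> quot_zmod (image_sub (cofree_emb x)).
Proof.
move=> [b <-]; apply/quot_proj_eq0; exists (psh_map Phi f b).
exact: cofree_emb_nat.
Qed.
Definition cosyzygy_map x y (f : mor C x y) :
    {additive quot_zmod (image_sub (cofree_emb y)) ->
              quot_zmod (image_sub (cofree_emb x))} :=
  quot_lift (@cosyzygy_map_subproof x y f).
Fact cosyzygy_mapE x y (f : mor C x y) a :
  cosyzygy_map f (quot_proj _ a) = quot_proj _ (psh_map cofree f a).
Proof. by rewrite quot_liftE. Qed.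
Fact cosyzygy_id x a : cosyzygy_map (idmor C x) a = a.
Proof.
have [b <-] := quot_proj_surj a; rewrite cosyzygy_mapE.
by congr (quot_proj _ _); exact: cofree_map_id.
Qed.
Fact cosyzygy_comp x y z (g : mor C y z) (f : mor C x y) a :
  cosyzygy_map (g \oc f) a = cosyzygy_map f (cosyzygy_map g a).
Proof.
have [b <-] := quot_proj_surj a.
by rewrite !cosyzygy_mapE; congr (quot_proj _ _); exact: cofree_map_comp.
Qed.
Definition cosyzygy : presheaf C := Presheaf cosyzygy_id cosyzygy_comp.

Fact cosyzygy_proj_nat x y (f : mor C x y) a :
  quot_proj _ (psh_map cofree f a) = psh_map cosyzygy f (quot_proj _ a).
Proof. by rewrite [RHS]cosyzygy_mapE. Qed.
Definition cosyzygy_proj : psh_hom cofree cosyzygy :=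
  @PshHom _ C cofree cosyzygy (fun x => quot_proj (image_sub (cofree_emb x)))
    cosyzygy_proj_nat.
End Cofree.

Section StandardResolution.
Variables (Ob : Type) (C : category Ob) (Phi : presheaf C).

(* std_syz n.+1 is the cokernel of std_syz n -> cofree (std_syz n). *)
Definition std_syz n : presheaf C := iter n (@cosyzygy Ob C) Phi.
Definition std_ob n : presheaf C := cofree (std_syz n).
Definition std_d n : psh_hom (std_ob n) (std_ob n.+1) :=
  psh_hom_comp (cofree_emb (std_syz n.+1)) (cosyzygy_proj (std_syz n)).

Fact std_d_eq0 n x a :
  std_d n x a = 0 <-> exists b, cofree_emb (std_syz n) x b = a.
Proof.
split=> [h|h].
  apply/(@quot_proj_eq0 _ (image_sub (cofree_emb (std_syz n) x)) a).
  apply: (@cofree_emb_mono _ C (std_syz n.+1) x).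
  by rewrite raddf0; exact: h.
have e : cosyzygy_proj (std_syz n) x a = 0 by apply/quot_proj_eq0.
exact: (etrans (congr1 (cofree_emb (std_syz n.+1) x) e) (raddf0 _)).
Qed.
Fact std_exact n x a : std_d n.+1 x a = 0 <-> exists b, std_d n x b = a.
Proof.
rewrite std_d_eq0; split=> [[b <-]|[b <-]]; last by eexists.
by have [c <-] := quot_proj_surj b; exists c.
Qed.
Definition std_resolution : injective_resolution Phi :=
  InjectiveResolution (fun n => @cofree_injective _ C (std_syz n))
    (@cofree_emb_mono _ C Phi) (@std_d_eq0 0) std_exact.

(* The right derived functors of the limit, computed on one explicit injective
   resolution; any other choice gives isomorphic groups. *)
Definition higher_lim n : zmodType := cohomology (lim_complex std_resolution) n.
End StandardResolution.

Definition graded_iso (A B : nat -> zmodType) : Prop :=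
  exists f : forall n, {additive A n -> B n}, forall n, bijective (f n).

Record subgroup (G : groupType) := Subgroup {
  sg_set :> set G;
  sg1 : sg_set 1%g;
  sgM : forall x y, sg_set x -> sg_set y -> sg_set (x * y)%g;
  sgV : forall x, sg_set x -> sg_set x^-1%g }.

Definition sg_pred (G : groupType) (P : subgroup G) : {pred G} :=
  fun x => `[< sg_set P x >].

Fact sg_pred_closed (G : groupType) (P : subgroup G) :
  group_closed (sg_pred P).
Proof.
split; first exact/asboolP/sg1.
move=> x y /asboolP Px /asboolP Py; apply/asboolP.
by apply: sgM => //; exact: sgV.
Qed.

Definition sg_type (G : groupType) (P : subgroup G) : Type :=
  {x : G | sg_pred P x}.
HB.instance Definition _ G P := SubChoice.on (@sg_type G P).
HB.instance Definition _ G P :=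
  SubChoice_isSubGroup.Build _ _ (@sg_type G P) (sg_pred_closed P).

Definition sg_mk (G : groupType) (P : subgroup G) x (Px : sg_set P x) :
  sg_type P := exist _ x (asboolT Px).

Lemma sg_typeP (G : groupType) (P : subgroup G) (x : sg_type P) :
  sg_set P (val x).
Proof. exact/asboolP/(valP x). Qed.

Definition whole_subgroup (G : groupType) : subgroup G :=
  @Subgroup G setT I (fun _ _ _ _ => I) (fun _ _ => I).

Definition lconj (G : groupType) (g x : G) : G := (g * x * g^-1)%g.

Section LConj.
Variable G : groupType.
Implicit Types g h x y : G.
Lemma lconj1g x : lconj 1%g x = x.
Proof. by rewrite /lconj invg1 mulg1 mul1g. Qed.
Lemma lconjg1 g : lconj g 1%g = 1%g.
Proof. by rewrite /lconj mulg1 mulgV. Qed.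
Lemma lconjMl g h x : lconj (g * h)%g x = lconj g (lconj h x).
Proof. by rewrite /lconj invgM !mulgA. Qed.
Lemma lconjMr g x y : lconj g (x * y)%g = (lconj g x * lconj g y)%g.
Proof. by rewrite /lconj !mulgA mulgVK. Qed.
Lemma lconjVr g x : lconj g x^-1%g = (lconj g x)^-1%g.
Proof. by rewrite /lconj !invgM invgK mulgA. Qed.
Lemma lconjK g x : lconj g^-1%g (lconj g x) = x.
Proof. by rewrite -lconjMl mulVg lconj1g. Qed.
Lemma lconjVK g x : lconj g (lconj g^-1%g x) = x.
Proof. by rewrite -lconjMl mulgV lconj1g. Qed.
End LConj.

Definition normalizer (G : groupType) (P : subgroup G) : subgroup G.
Proof.
refine (@Subgroup G [set g | forall x, sg_set P x <-> sg_set P (lconj g x)] _ _ _).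
- by move=> x; rewrite lconj1g.
- by move=> g h hg hh x; rewrite lconjMl -hg -hh.
- by move=> g hg x; rewrite [X in _ <-> X]hg lconjVK.
Defined.

Definition centralizer (G : groupType) (P : subgroup G) : subgroup G.
Proof.
refine (@Subgroup G [set g | forall x, sg_set P x -> lconj g x = x] _ _ _).
- by move=> x _; rewrite lconj1g.
- by move=> g h hg hh x Px; rewrite lconjMl hh // hg.
- by move=> g hg x Px; rewrite -[x in LHS]hg // lconjK.
Defined.

Section Classes.
Variables (T : Type) (R : T -> T -> Prop).

Definition classes : Type := {X : set T | exists x, X = R x}.
Definition class_of (x : T) : classes := exist _ (R x : set T) (ex_intro _ x erefl).
Definition class_repr (X : classes) : T := sval (cid (svalP X)).

Lemma class_reprK X : class_of (class_repr X) = X.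
Proof.
have e : sval X = R (class_repr X) := svalP (cid (svalP X)).
by move: (class_repr X) e; case: X => X hX r /= e; exact/eq_exist/esym.
Qed.

Hypotheses (R_refl : forall x, R x x) (R_sym : forall x y, R x y -> R y x)
  (R_trans : forall x y z, R x y -> R y z -> R x z).

Lemma class_eq x y : class_of x = class_of y <-> R x y.
Proof.
split=> [[e]|xy]; first by rewrite e.
apply: eq_exist; apply/seteqP; split=> z /= h.
  exact: R_trans (R_sym xy) h.
exact: R_trans xy h.
Qed.

Lemma class_reprP x : R x (class_repr (class_of x)).
Proof. by apply/class_eq; rewrite class_reprK. Qed.
End Classes.

Record normal_subgroup (G : groupType) := NormalSubgroup {
  nsg :> subgroup G;
  nsg_normal : forall g x, sg_set nsg x -> sg_set nsg (lconj g x) }.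

Section QuotientGroup.
Variables (G : groupType) (N : normal_subgroup G).

Definition same_coset (x y : G) : Prop := sg_set N (x^-1 * y)%g.
Definition quotient_group : Type := classes same_coset.

Fact same_coset_refl x : same_coset x x.
Proof. by rewrite /same_coset mulVg; exact: sg1. Qed.
Fact same_coset_sym x y : same_coset x y -> same_coset y x.
Proof. by move=> /sgV; rewrite invgM invgK. Qed.
Fact same_coset_trans x y z :
  same_coset x y -> same_coset y z -> same_coset x z.
Proof.
by move=> xy yz; have := sgM xy yz; rewrite /same_coset mulgA mulgK.
Qed.
Fact same_cosetM x y x' y' : same_coset x x' -> same_coset y y' ->
  same_coset (x * y)%g (x' * y')%g.
Proof.
move=> hx hy; have := sgM (nsg_normal y^-1%g hx) hy.
by rewrite /same_coset /lconj invgM invgK !mulgA mulgK.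
Qed.

HB.instance Definition _ := gen_eqMixin quotient_group.
HB.instance Definition _ := gen_choiceMixin quotient_group.

Definition coset (x : G) : quotient_group := class_of same_coset x.
Lemma coset_eq x y : coset x = coset y <-> same_coset x y.
Proof. exact: (class_eq same_coset_refl same_coset_sym same_coset_trans). Qed.

Definition quotient_mul (X Y : quotient_group) : quotient_group :=
  coset (class_repr X * class_repr Y)%g.
Definition quotient_inv (X : quotient_group) : quotient_group :=
  coset (class_repr X)^-1%g.

Fact quotient_mulE x y : quotient_mul (coset x) (coset y) = coset (x * y)%g.
Proof.
by apply/coset_eq/same_cosetM; apply: same_coset_sym;
  exact: (class_reprP same_coset_refl same_coset_sym same_coset_trans).
Qed.
Fact coset_surj X : exists x, X = coset x.
Proof. by exists (class_repr X); rewrite /coset class_reprK. Qed.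
Fact quotient_mulA : associative quotient_mul.
Proof.
move=> X Y Z; have [[x ->] [y ->]] := (coset_surj X, coset_surj Y).
by have [z ->] := coset_surj Z; rewrite !quotient_mulE mulgA.
Qed.
Fact quotient_mul1 : left_id (coset 1%g) quotient_mul.
Proof. by move=> X; have [x ->] := coset_surj X; rewrite quotient_mulE mul1g. Qed.
Fact quotient_1mul : right_id (coset 1%g) quotient_mul.
Proof. by move=> X; have [x ->] := coset_surj X; rewrite quotient_mulE mulg1. Qed.
Fact quotient_mulV : left_inverse (coset 1%g) quotient_inv quotient_mul.
Proof.
by move=> X; rewrite -{2}[X]class_reprK quotient_mulE mulVg.
Qed.
Fact quotient_Vmul : right_inverse (coset 1%g) quotient_inv quotient_mul.
Proof.
by move=> X; rewrite -{1}[X]class_reprK quotient_mulE mulgV.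
Qed.
HB.instance Definition _ := isGroup.Build quotient_group
  quotient_mulA quotient_mul1 quotient_1mul quotient_mulV quotient_Vmul.

Lemma cosetM x y : coset (x * y)%g = (coset x * coset y)%g.
Proof. by rewrite -quotient_mulE. Qed.

Definition image_coset (H : subgroup G) : subgroup quotient_group.
Proof.
refine (@Subgroup quotient_group [set coset h | h in H] _ _ _).
- by exists 1%g => //; exact: sg1.
- by move=> _ _ [x Hx <-] [y Hy <-]; exists (x * y)%g; rewrite ?cosetM //; exact: sgM.
- move=> _ [x Hx <-]; exists x^-1%g; first exact: sgV.
  apply: (mulgI (coset x)); rewrite -cosetM !mulgV; exact: erefl.
Defined.
End QuotientGroup.

Definition has_card (T : Type) (n : nat) : Prop := [set: T] #= `I_n.

Definition finite_p_group (p : nat) (G : groupType) : Prop :=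
  exists k, has_card G (p ^ k).

Definition sylow (p : nat) (G : groupType) (H : subgroup G) : Prop :=
  exists k m, [/\ has_card (sg_type H) (p ^ k), has_card G (p ^ k * m)
                & coprime p m].

Definition has_index (G : groupType) (A : set G) (n : nat) : Prop :=
  [set [set (x * a)%g | a in A] | x in [set: G]] #= `I_n.

Fact primary_part_subproof p (x y : QZ) :
  (exists k, x *+ (p ^ k) = 0) -> (exists k, y *+ (p ^ k) = 0) ->
  exists k, (x - y) *+ (p ^ k) = 0.
Proof.
move=> [k hk] [l hl]; exists (k + l)%N.
by rewrite mulrnBl expnD mulrnA hk mul0rn mulnC mulrnA hl mul0rn subrr.
Qed.

(* Z/p^oo, as the p-primary part of Q/Z. *)
Definition prufer (p : nat) : zmodType :=
  sub_zmod (@AddSubgroup QZ (fun x => exists k, x *+ (p ^ k) = 0)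
    (ex_intro _ 0%N (mul0rn _ _)) (@primary_part_subproof p)).

Definition is_torus (p r : nat) (G : groupType) : Prop :=
  exists f : G -> {ffun 'I_r -> prufer p},
    bijective f /\ {morph f : x y / (x * y)%g >-> x + y}.

Definition has_toral_order (p : nat) (G : groupType) (r m : nat) : Prop :=
  exists T : normal_subgroup G,
    [/\ is_torus p r (sg_type T), finite_p_group p (quotient_group T)
      & has_card (quotient_group T) m].

Definition discrete_p_toral (p : nat) (G : groupType) : Prop :=
  exists (T : normal_subgroup G) (r : nat),
    is_torus p r (sg_type T) /\ finite_p_group p (quotient_group T).

(* (r, |G/G_0|), unique when G is discrete p-toral; (0, 0) otherwise. *)
Definition toral_order (p : nat) (G : groupType) : nat * nat :=
  xget (0, 0)%N [set o | has_toral_order p G o.1 o.2].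

Definition order_le (p : nat) (G H : groupType) : Prop :=
  ((toral_order p G : nat *l nat) <= (toral_order p H : nat *l nat))%O.

Record aut Ob (C : category Ob) (x : Ob) := Aut {
  aut_fwd : mor C x x;
  aut_bwd : mor C x x;
  aut_fb : aut_fwd \oc aut_bwd = idmor C x;
  aut_bf : aut_bwd \oc aut_fwd = idmor C x }.

Section AutGroup.
Variables (Ob : Type) (C : category Ob) (x : Ob).
Implicit Types a b : aut C x.

Lemma aut_eq a b : aut_fwd a = aut_fwd b -> a = b.
Proof.
case: a b => f g fg gf [f' g' fg' gf'] /= e; subst f'.
have e : g = g'.
  by rewrite -[g]compm1 -fg' compmA gf comp1m.
by subst g'; congr Aut; exact: Prop_irrelevance.
Qed.

HB.instance Definition _ := gen_eqMixin (aut C x).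
HB.instance Definition _ := gen_choiceMixin (aut C x).

Definition aut_one : aut C x := Aut (comp1m (idmor C x)) (comp1m (idmor C x)).
Definition aut_inv a : aut C x := Aut (aut_bf a) (aut_fb a).

Fact aut_mul_fb a b :
  (aut_fwd a \oc aut_fwd b) \oc (aut_bwd b \oc aut_bwd a) = idmor C x.
Proof.
by rewrite compmA -(compmA (aut_fwd a)) aut_fb compm1 aut_fb.
Qed.
Fact aut_mul_bf a b :
  (aut_bwd b \oc aut_bwd a) \oc (aut_fwd a \oc aut_fwd b) = idmor C x.
Proof.
by rewrite compmA -(compmA (aut_bwd b)) aut_bf compm1 aut_bf.
Qed.
Definition aut_mul a b : aut C x := Aut (aut_mul_fb a b) (aut_mul_bf a b).

Fact aut_mulA : associative aut_mul.
Proof. by move=> a b c; apply: aut_eq; exact: compmA. Qed.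
Fact aut_mul1 : left_id aut_one aut_mul.
Proof. by move=> a; apply: aut_eq; exact: comp1m. Qed.
Fact aut_1mul : right_id aut_one aut_mul.
Proof. by move=> a; apply: aut_eq; exact: compm1. Qed.
Fact aut_mulV : left_inverse aut_one aut_inv aut_mul.
Proof. by move=> a; apply: aut_eq; exact: aut_bf. Qed.
Fact aut_Vmul : right_inverse aut_one aut_inv aut_mul.
Proof. by move=> a; apply: aut_eq; exact: aut_fb. Qed.
HB.instance Definition _ := isGroup.Build (aut C x)
  aut_mulA aut_mul1 aut_1mul aut_mulV aut_Vmul.
End AutGroup.

Definition functor_kernel Ob (C D : category Ob) (r : functor C D) (x : Ob) :
  set (aut C x) := [set a | fmap r (aut_fwd a) = idmor D x].

Definition is_conj (G : groupType) (P Q : subgroup G) (g : G)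
    (f : sg_type P -> sg_type Q) : Prop :=
  forall x, val (f x) = lconj g (val x).

(* Objects are all subgroups of S; identities are in F by fs_conj at g = 1. *)
Record fusion_system (S : groupType) := FusionSystem {
  fs_hom : forall P Q : subgroup S, set (sg_type P -> sg_type Q);
  fs_mul : forall P Q (f : sg_type P -> sg_type Q), fs_hom f -> {morph f : x y / (x * y)%g};
  fs_inj : forall P Q (f : sg_type P -> sg_type Q), fs_hom f -> injective f;
  fs_comp : forall P Q R (g : sg_type Q -> sg_type R)
    (f : sg_type P -> sg_type Q), fs_hom g -> fs_hom f -> fs_hom (g \o f);
  fs_conj : forall (P Q : subgroup S) g (f : sg_type P -> sg_type Q),
    is_conj g f -> fs_hom f;
  fs_factor : forall P Q (f : sg_type P -> sg_type Q), fs_hom f ->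
    exists (R : subgroup S) (a : sg_type P -> sg_type R)
      (b : sg_type R -> sg_type P) (i : sg_type R -> sg_type Q),
      [/\ fs_hom a, fs_hom b, cancel a b /\ cancel b a,
          (forall x, val (i x) = val x) & f = i \o a] }.

Section FusionCategory.
Variables (S : groupType) (F : fusion_system S).

Fact fs_id P : fs_hom F (P := P) (Q := P) id.
Proof. by apply: (@fs_conj _ F _ _ 1%g) => x; rewrite lconj1g. Qed.

Definition fusion_mor (P Q : subgroup S) : Type := {f | fs_hom F (P := P) (Q := Q) f}.
Definition fusion_comp P Q R (g : fusion_mor Q R) (f : fusion_mor P Q) :
    fusion_mor P R :=
  exist _ (sval g \o sval f) (fs_comp (svalP g) (svalP f)).
Definition fusion_id P : fusion_mor P P := exist _ id (@fs_id P).

Lemma fusion_mor_eq P Q (f g : fusion_mor P Q) : sval f =1 sval g -> f = g.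
Proof. by case: f g => f hf [g hg] /= /funext e; exact: eq_exist. Qed.

Fact fusion_compA P Q R T (h : fusion_mor R T) (g : fusion_mor Q R)
    (f : fusion_mor P Q) :
  fusion_comp h (fusion_comp g f) = fusion_comp (fusion_comp h g) f.
Proof. exact: fusion_mor_eq. Qed.
Fact fusion_comp1m P Q (f : fusion_mor P Q) : fusion_comp (fusion_id Q) f = f.
Proof. exact: fusion_mor_eq. Qed.
Fact fusion_compm1 P Q (f : fusion_mor P Q) : fusion_comp f (fusion_id P) = f.
Proof. exact: fusion_mor_eq. Qed.

Definition fusion_cat : category (subgroup S) :=
  Category fusion_compA fusion_comp1m fusion_compm1.

Definition F_conjugate (P Q : subgroup S) : Prop := isomorphic fusion_cat P Q.

(* The invertible endomorphisms. Over a discrete p-toral group S this is all of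
   Hom_F(P, P): injective endomorphisms of P <= S are then bijective. *)
Definition AutF (P : subgroup S) : groupType := aut fusion_cat P.

Definition aut_fun P (a : AutF P) : sg_type P -> sg_type P := sval (aut_fwd a).

Lemma aut_fun_fb P (a : AutF P) x : aut_fun a (sval (aut_bwd a) x) = x.
Proof. exact: (congr1 (fun h => sval h x) (aut_fb a)). Qed.

Definition AutK (K P : subgroup S) : subgroup (AutF P).
Proof.
refine (@Subgroup (AutF P)
  [set a | exists2 g, sg_set K g & is_conj g (aut_fun a)] _ _ _).
- by exists 1%g; [exact: sg1 | move=> x; rewrite lconj1g].
- move=> a b [g Kg ga] [h Kh hb]; exists (g * h)%g; first exact: sgM.
  by move=> x; rewrite lconjMl -hb -ga.
- move=> a [g Kg ga]; exists g^-1%g; first exact: sgV.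
  by move=> x; rewrite -[x in RHS](aut_fun_fb a) ga lconjK.
Defined.

Fact Inn_normal P (a b : AutF P) :
  sg_set (AutK P P) b -> sg_set (AutK P P) (lconj a b).
Proof.
move=> [g Pg gb]; exists (val (aut_fun a (sg_mk Pg))); first exact: sg_typeP.
move=> x; set y := sval (aut_bwd a) x.
have bE : aut_fun b y = (sg_mk Pg * y * (sg_mk Pg)^-1)%g by apply/val_inj/gb.
have aM : {morph aut_fun a : u v / (u * v)%g} := fs_mul (svalP (aut_fwd a)).
have aV u : aut_fun a u^-1%g = (aut_fun a u)^-1%g.
  apply: (mulgI (aut_fun a u)); rewrite -aM !mulgV.
  by apply: (mulgI (aut_fun a 1%g)); rewrite -aM !mulg1.
rewrite [LHS](_ : _ = val (aut_fun a (aut_fun b y))) // bE !aM aV.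
by rewrite /y aut_fun_fb.
Qed.
Definition Inn (P : subgroup S) : normal_subgroup (AutF P) :=
  NormalSubgroup (@Inn_normal P).

Definition AutS (P : subgroup S) : subgroup (AutF P) := AutK (normalizer P) P.

Definition OutF (P : subgroup S) : groupType := quotient_group (Inn P).
Definition OutS (P : subgroup S) : subgroup (OutF P) :=
  image_coset (Inn P) (AutS P).

Variable p : nat.

Definition fully_centralized (P : subgroup S) : Prop :=
  forall Q, F_conjugate P Q ->
    order_le p (sg_type (centralizer Q)) (sg_type (centralizer P)).

Definition fully_normalized (P : subgroup S) : Prop :=
  forall Q, F_conjugate P Q ->
    order_le p (sg_type (normalizer Q)) (sg_type (normalizer P)).

Definition mor_image P (Q : subgroup S) (f : fusion_mor P Q) : subgroup S.
Proof.
refine (@Subgroup S [set val (sval f x) | x in [set: sg_type P]] _ _ _).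
- exists 1%g => //; have fM := fs_mul (svalP f).
  suff -> : sval f 1%g = 1%g by [].
  by apply: (mulgI (sval f 1%g)); rewrite -fM !mulg1.
- move=> _ _ [x _ <-] [y _ <-]; exists (x * y)%g => //.
  by rewrite (fs_mul (svalP f)).
- move=> _ [x _ <-]; exists x^-1%g => //.
  have fM := fs_mul (svalP f).
  have f1 : sval f 1%g = 1%g by apply: (mulgI (sval f 1%g)); rewrite -fM !mulg1.
  suff -> : sval f x^-1%g = (sval f x)^-1%g by [].
  by apply: (mulgI (sval f x)); rewrite -fM !mulgV.
Defined.

(* g lies in N_phi when phi o c_g o phi^-1 agrees on phi(P) with c_h for some
   h in N_S(phi(P)), i.e. phi (c_g x) = c_h (phi x) for x in P. *)
Definition extender_set P (f : fusion_mor P (whole_subgroup S)) : set S :=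
  [set g | sg_set (normalizer P) g /\
    exists2 h, sg_set (normalizer (mor_image f)) h &
      forall x y : sg_type P, val y = lconj g (val x) ->
        val (sval f y) = lconj h (val (sval f x))].

Definition extender P (f : fusion_mor P (whole_subgroup S)) : subgroup S.
Proof.
refine (@Subgroup S (extender_set f) _ _ _).
- split; first exact: sg1.
  exists 1%g; first exact: sg1.
  by move=> x y; rewrite !lconj1g => /val_inj ->.
- move=> g g' [Ng [h Nh hE]] [Ng' [h' Nh' hE']]; split; first exact: sgM.
  exists (h * h')%g; first exact: sgM.
  move=> x y yE.
  have Pz : sg_set P (lconj g' (val x)) by apply/(Ng' (val x)); exact: sg_typeP.
  rewrite (hE (sg_mk Pz) y) ?(hE' x (sg_mk Pz)) ?lconjMl //.
  by rewrite yE lconjMl.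
- move=> g [Ng [h Nh hE]]; split; first exact: sgV.
  exists h^-1%g; first exact: sgV.
  move=> x y yE; rewrite (hE y x) ?lconjK //.
  by rewrite yE lconjVK.
Defined.

Definition restricts_to (P Q R : subgroup S) (f : sg_type Q -> sg_type R)
    (g : sg_type P -> sg_type R) : Prop :=
  forall (x : sg_type P) (y : sg_type Q), val y = val x -> val (f y) = val (g x).

Record saturated : Prop := Saturated {
  sat_sylow : forall P, fully_normalized P ->
    [/\ fully_centralized P, exists n, has_card (OutF P) n & sylow p (OutS P)];
  sat_extend : forall P (f : fusion_mor P (whole_subgroup S)),
    fully_centralized (mor_image f) ->
    exists g : fusion_mor (extender f) (whole_subgroup S),
      restricts_to (sval g) (sval f);
  sat_union : forall (P : nat -> subgroup S) (U : subgroup S)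
      (f : sg_type U -> sg_type (whole_subgroup S)),
    (forall n, P n `<=` P n.+1) -> sg_set U = \bigcup_n P n ->
    {morph f : x y / (x * y)%g} ->
    (forall n, exists g : fusion_mor (P n) (whole_subgroup S),
      restricts_to f (sval g)) ->
    fs_hom F f }.
End FusionCategory.

Section TransporterCategory.
Variables (S : groupType) (H : set (subgroup S)).

Definition transporter_set (P Q : subgroup S) : set S :=
  [set g | forall x, sg_set P x -> sg_set Q (lconj g x)].

Definition transporter_mor (P Q : {P | H P}) : Type :=
  {g | transporter_set (sval P) (sval Q) g}.

Fact transporter_set1 (P Q : subgroup S) : P `<=` Q -> transporter_set P Q 1%g.
Proof. by move=> PQ x Px; rewrite lconj1g; exact: PQ. Qed.
Fact transporter_setM (P Q R : subgroup S) g f : transporter_set Q R g ->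
  transporter_set P Q f -> transporter_set P R (g * f)%g.
Proof. by move=> hg hf x Px; rewrite lconjMl; exact/hg/hf. Qed.
Fact transporter_set_self (P : subgroup S) g : sg_set P g -> transporter_set P P g.
Proof. by move=> Pg x Px; apply: sgM; [exact: sgM | exact: sgV]. Qed.
Fact transporter_set_norm (P : subgroup S) g : sg_set (normalizer P) g ->
  transporter_set P P g.
Proof. by move=> Ng x Px; apply/(Ng x). Qed.

Definition tr_incl (P Q : {P | H P}) (PQ : sval P `<=` sval Q) :
  transporter_mor P Q := exist _ 1%g (transporter_set1 PQ).
Definition tr_elt (P : {P | H P}) (g : sg_type (sval P)) : transporter_mor P P :=
  exist _ (val g) (transporter_set_self (sg_typeP g)).
Definition tr_norm (P : {P | H P}) (g : sg_type (normalizer (sval P))) :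
  transporter_mor P P := exist _ (val g) (transporter_set_norm (sg_typeP g)).
Definition tr_comp P Q R (g : transporter_mor Q R) (f : transporter_mor P Q) :
    transporter_mor P R :=
  exist _ (sval g * sval f)%g (transporter_setM (svalP g) (svalP f)).

Lemma tr_eq P Q (g f : transporter_mor P Q) : sval g = sval f -> g = f.
Proof. by case: g f => g hg [f hf] /= e; exact: eq_exist. Qed.

Definition tr_id (P : {P | H P}) : transporter_mor P P :=
  tr_incl (@subset_refl _ (sval P : set S)).

Fact tr_compA P Q R T (h : transporter_mor R T) (g : transporter_mor Q R)
    (f : transporter_mor P Q) : tr_comp h (tr_comp g f) = tr_comp (tr_comp h g) f.
Proof. by apply: tr_eq; exact: mulgA. Qed.
Fact tr_comp1m P Q (f : transporter_mor P Q) : tr_comp (tr_id Q) f = f.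
Proof. by apply: tr_eq; exact: mul1g. Qed.
Fact tr_compm1 P Q (f : transporter_mor P Q) : tr_comp f (tr_id P) = f.
Proof. by apply: tr_eq; exact: mulg1. Qed.

Definition transporter_cat : category {P | H P} :=
  Category tr_compA tr_comp1m tr_compm1.
End TransporterCategory.

(* eps and rho are functors over fixed objects, so that eps is the identity and
   rho the inclusion on objects. *)
Record transporter_system (p : nat) (S : groupType) (F : fusion_system S) :=
  TransporterSystem {
  ts_ob : set (subgroup S);
  ts_nonempty : ts_ob !=set0;
  ts_conj : forall P Q, ts_ob P -> F_conjugate F P Q -> ts_ob Q;
  ts_over : forall P Q : subgroup S, ts_ob P -> P `<=` Q -> ts_ob Q;
  ts_cat : category {P | ts_ob P};
  ts_eps : functor (transporter_cat ts_ob) ts_cat;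
  ts_rho : functor ts_cat (full_subcategory (fusion_cat F) ts_ob);
  ts_rho_surj : forall P Q (f : mor (fusion_cat F) (sval P) (sval Q)),
    exists a : mor ts_cat P Q, fmap ts_rho a = f;
  ts_rho_orbit : forall P Q (a b : mor ts_cat P Q),
    fmap ts_rho a = fmap ts_rho b <->
    exists2 e : aut ts_cat P, functor_kernel ts_rho e & b = a \oc aut_fwd e;
  ts_free_right : forall P Q (a : mor ts_cat P Q) (e : aut ts_cat P),
    functor_kernel ts_rho e ->
    a \oc aut_fwd e = a -> e = 1%g;
  ts_free_left : forall P Q (a : mor ts_cat P Q) (e : aut ts_cat Q),
    functor_kernel ts_rho e ->
    aut_fwd e \oc a = a -> e = 1%g;
  ts_eps_inj : forall P Q,
    injective (@fmap _ _ _ ts_eps P Q);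
  ts_rho_eps : forall P Q (g : mor (transporter_cat ts_ob) P Q),
    is_conj (sval g) (sval (fmap ts_rho (fmap ts_eps g)));
  ts_push : forall P Q (a : mor ts_cat P Q) (g : sg_type (sval P)),
    a \oc fmap ts_eps (tr_elt g) =
    fmap ts_eps (tr_elt (sval (fmap ts_rho a) g)) \oc a;
  ts_sylow : forall P : {P | ts_ob P}, exists2 Q : {P | ts_ob P},
    F_conjugate F (sval P) (sval Q) &
    exists2 n, coprime n p &
      has_index [set a : aut ts_cat Q | exists g : sg_type (normalizer (sval Q)),
        aut_fwd a = fmap ts_eps (tr_norm (P := Q) g)] n;
  ts_extend : forall (P Q P' Q' : {P | ts_ob P}) (a : mor ts_cat P Q)
      (b : mor ts_cat Q P) (PP' : sval P `<=` sval P') (QQ' : sval Q `<=` sval Q'),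
    b \oc a = idmor ts_cat P -> a \oc b = idmor ts_cat Q ->
    sval P' `<=` normalizer (sval P) -> sval Q' `<=` normalizer (sval Q) ->
    (forall g : sg_type (normalizer (sval P)), sg_set (sval P') (val g) ->
      exists2 h : sg_type (normalizer (sval Q)), sg_set (sval Q') (val h) &
        a \oc fmap ts_eps (tr_norm (P := P) g) \oc b =
          fmap ts_eps (tr_norm (P := Q) h)) ->
    exists a' : mor ts_cat P' Q',
      a' \oc fmap ts_eps (tr_incl PP') = fmap ts_eps (tr_incl QQ') \oc a;
  ts_union : forall (P : nat -> {P | ts_ob P}) (U : {P | ts_ob P})
      (hS : ts_ob (whole_subgroup S)) (a : forall i, mor ts_cat (P i) (exist _ _ hS))
      (PP : forall i, sval (P i) `<=` sval (P i.+1))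
      (PU : forall i, sval (P i) `<=` sval U),
    sg_set (sval U) = \bigcup_i sval (P i) ->
    (forall i, a i = a i.+1 \oc fmap ts_eps (tr_incl (PP i))) ->
    exists b : mor ts_cat U (exist _ _ hS),
      forall i, b \oc fmap ts_eps (tr_incl (PU i)) = a i }.

(* Sets of endomorphisms od_set y, acting by left composition on mor x y, such
   that composition passes to the orbits od_set y \ mor x y. *)
Record orbit_datum Ob (C : category Ob) := OrbitDatum {
  od_set : forall x, set (mor C x x);
  od_id : forall x, od_set (idmor C x);
  od_comp : forall x (d e : mor C x x), od_set d -> od_set e -> od_set (d \oc e);
  od_inv : forall x (d : mor C x x), od_set d -> exists2 e, od_set e & e \oc d = idmor C x;
  od_push : forall x y (f : mor C x y) (d : mor C x x), od_set d ->
    exists2 e, od_set e & f \oc d = e \oc f }.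

Section OrbitCategory.
Variables (Ob : Type) (C : category Ob) (D : orbit_datum C).

Definition orbit_rel x y (f g : mor C x y) : Prop :=
  exists2 d, od_set D d & g = d \oc f.
Fact orbit_rel_refl x y (f : mor C x y) : orbit_rel f f.
Proof. by exists (idmor C y); [exact: od_id | rewrite comp1m]. Qed.
Fact orbit_rel_sym x y (f g : mor C x y) : orbit_rel f g -> orbit_rel g f.
Proof.
move=> [d Dd ->]; have [e De ed] := od_inv Dd.
by exists e => //; rewrite compmA ed comp1m.
Qed.
Fact orbit_rel_trans x y (f g h : mor C x y) :
  orbit_rel f g -> orbit_rel g h -> orbit_rel f h.
Proof.
move=> [d Dd ->] [e De ->]; exists (e \oc d); first exact: od_comp.
by rewrite compmA.
Qed.
Fact orbit_relM x y z (g g' : mor C y z) (f f' : mor C x y) :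
  orbit_rel g g' -> orbit_rel f f' -> orbit_rel (g \oc f) (g' \oc f').
Proof.
move=> [d Dd ->] [e De ->]; have [e' De' ge] := od_push g De.
exists (d \oc e'); first exact: od_comp.
by rewrite -(compmA d g) (compmA g e) ge !compmA.
Qed.

Definition orbit_mor x y : Type := classes (@orbit_rel x y).
Definition orbit_of x y (f : mor C x y) : orbit_mor x y :=
  class_of (@orbit_rel x y) f.
Lemma orbit_of_eq x y (f g : mor C x y) :
  orbit_of f = orbit_of g <-> orbit_rel f g.
Proof.
exact: (class_eq (@orbit_rel_refl x y) (@orbit_rel_sym x y)
  (@orbit_rel_trans x y)).
Qed.
Lemma orbit_of_surj x y (X : orbit_mor x y) : exists f, X = orbit_of f.
Proof. by exists (class_repr X); rewrite /orbit_of class_reprK. Qed.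

Definition orbit_comp x y z (Y : orbit_mor y z) (X : orbit_mor x y) :
  orbit_mor x z := orbit_of (class_repr Y \oc class_repr X).
Lemma orbit_compE x y z (g : mor C y z) (f : mor C x y) :
  orbit_comp (orbit_of g) (orbit_of f) = orbit_of (g \oc f).
Proof.
apply/orbit_of_eq/orbit_relM; apply/orbit_of_eq; exact: class_reprK.
Qed.
Fact orbit_compA x y z t (Z : orbit_mor z t) (Y : orbit_mor y z)
    (X : orbit_mor x y) :
  orbit_comp Z (orbit_comp Y X) = orbit_comp (orbit_comp Z Y) X.
Proof.
have [[h ->] [g ->]] := (orbit_of_surj Z, orbit_of_surj Y).
by have [f ->] := orbit_of_surj X; rewrite !orbit_compE compmA.
Qed.
Fact orbit_comp1m x y (X : orbit_mor x y) :
  orbit_comp (orbit_of (idmor C y)) X = X.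
Proof. by have [f ->] := orbit_of_surj X; rewrite orbit_compE comp1m. Qed.
Fact orbit_compm1 x y (X : orbit_mor x y) :
  orbit_comp X (orbit_of (idmor C x)) = X.
Proof. by have [f ->] := orbit_of_surj X; rewrite orbit_compE compm1. Qed.

Definition orbit_category : category Ob :=
  Category orbit_compA orbit_comp1m orbit_compm1.
End OrbitCategory.

Section TransporterOrbit.
Variables (p : nat) (S : groupType) (F : fusion_system S).
Variable T : transporter_system p F.

Definition ts_object : Type := {P | ts_ob T P}.

Definition ts_orbit_datum : orbit_datum (ts_cat T).
Proof.
refine (@OrbitDatum _ (ts_cat T)
  (fun Q => [set fmap (ts_eps T) (tr_elt g) | g in [set: sg_type (sval Q)]])
  _ _ _ _).
- move=> Q; exists 1%g => //; rewrite -(fmap_id (ts_eps T)); congr fmap.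
  exact: tr_eq.
- move=> Q _ _ [g _ <-] [h _ <-]; exists (g * h)%g => //.
  by rewrite -(fmap_comp (ts_eps T)); congr fmap; exact: tr_eq.
- move=> Q _ [g _ <-]; exists (fmap (ts_eps T) (tr_elt g^-1%g)).
    by exists g^-1%g.
  rewrite -(fmap_comp (ts_eps T)) -(fmap_id (ts_eps T)); congr fmap.
  by apply: tr_eq; exact: mulVg.
- move=> P Q a _ [g _ <-]; rewrite ts_push.
  by eexists; last reflexivity; eexists.
Defined.

Definition orbit_cat : category ts_object := orbit_category ts_orbit_datum.
End TransporterOrbit.

Section PSubgroups.
Variables (p : nat) (G : groupType).

(* G may be infinite: every element has p-power order. *)
Definition p_subgroup (P : subgroup G) : Prop :=
  forall x, sg_set P x -> exists k, (x ^+ (p ^ k))%g = 1%g.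

Definition Op_datum : orbit_datum (transporter_cat p_subgroup).
Proof.
refine (@OrbitDatum _ (transporter_cat p_subgroup)
  (fun Q => [set tr_elt g | g in [set: sg_type (sval Q)]]) _ _ _ _).
- by move=> Q; exists 1%g => //; exact: tr_eq.
- by move=> Q _ _ [g _ <-] [h _ <-]; exists (g * h)%g => //; exact: tr_eq.
- move=> Q _ [g _ <-]; exists (tr_elt g^-1%g); first by exists g^-1%g.
  by apply: tr_eq; exact: mulVg.
- move=> P Q f _ [g _ <-].
  have Qh : sg_set (sval Q) (lconj (sval f) (val g)).
    exact: (svalP f _ (sg_typeP g)).
  exists (tr_elt (sg_mk Qh)); first by exists (sg_mk Qh).
  by apply: tr_eq => /=; rewrite /lconj mulgVK.
Defined.

Definition Op_cat : category {P | p_subgroup P} := orbit_category Op_datum.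
End PSubgroups.

(* Modules are right modules: G acts contravariantly, matching functors on
   O_p(G)^op. *)
Record group_module (G : groupType) := GroupModule {
  gm_ob :> zmodType;
  gm_act : G -> {additive gm_ob -> gm_ob};
  gm_act1 : forall m, gm_act 1%g m = m;
  gm_actM : forall g h m, gm_act (g * h)%g m = gm_act h (gm_act g m) }.

Section Lambda.
Variables (p : nat) (G : groupType) (M : group_module G).

Definition sg_trivial (P : subgroup G) : Prop :=
  forall x, sg_set P x -> x = 1%g.

(* F_M(P), realized inside M: everything if P = 1, and 0 otherwise. *)
Definition FM_sub (P : subgroup G) : add_subgroup M.
Proof.
refine (@AddSubgroup M (fun m => ~ sg_trivial P -> m = 0) _ _) => //.
by move=> m n hm hn hP; rewrite hm // hn // subrr.
Defined.

Definition FM_ob (P : {P | p_subgroup p P}) : zmodType := sub_zmod (FM_sub (sval P)).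

Fact FM_act_sub (P Q : {P | p_subgroup p P})
    (f : mor (transporter_cat (p_subgroup (G := G) p)) P Q) (m : FM_ob Q) :
  FM_sub (sval P) (gm_act M (sval f) (val m)).
Proof.
move=> hP; rewrite (sub_zmodP m) ?raddf0 // => hQ; apply: hP => x Px.
by rewrite -[x](lconjK (sval f)) (hQ _ (svalP f _ Px)) lconjg1.
Qed.
Definition FM_act P Q (f : mor (transporter_cat (p_subgroup (G := G) p)) P Q)
  (m : FM_ob Q) : FM_ob P := sub_mk (FM_act_sub f m).
Fact FM_act_additive P Q f : zmod_morphism (@FM_act P Q f).
Proof. by move=> m n; apply/val_inj; exact: raddfB. Qed.

Definition FM_map P Q (X : mor (Op_cat p G) P Q) : {additive FM_ob Q -> FM_ob P} :=
  mk_additive (@FM_act_additive P Q (class_repr X)).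

Lemma FM_mapE P Q (f : mor (transporter_cat (p_subgroup (G := G) p)) P Q) m :
  FM_map (orbit_of (Op_datum p G) f) m = FM_act f m.
Proof.
apply/val_inj => /=.
have : orbit_rel (Op_datum p G) f (class_repr (orbit_of (Op_datum p G) f)).
  by apply/orbit_of_eq; rewrite /orbit_of class_reprK.
move=> [_ [q _ <-] ->] /=; rewrite gm_actM; congr (gm_act M _ _).
have [hQ|hQ] := pselect (sg_trivial (sval Q)).
  by rewrite (hQ _ (sg_typeP q)) gm_act1.
by rewrite (sub_zmodP m) // raddf0.
Qed.
Fact FM_id P m : FM_map (idmor (Op_cat p G) P) m = m.
Proof. by rewrite FM_mapE; apply/val_inj; exact: gm_act1. Qed.
Fact FM_comp P Q R (Y : mor (Op_cat p G) Q R) (X : mor (Op_cat p G) P Q) m :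
  FM_map (Y \oc X) m = FM_map X (FM_map Y m).
Proof.
have [[g ->] [f ->]] := (orbit_of_surj Y, orbit_of_surj X).
rewrite [_ \oc _]orbit_compE !FM_mapE; apply/val_inj; exact: gm_actM.
Qed.
Definition FM : presheaf (Op_cat p G) := Presheaf FM_id FM_comp.

Definition Lambda : nat -> zmodType := higher_lim FM.
End Lambda.

Definition value_module Ob (C : category Ob) (Phi : presheaf C) (x : Ob) :
    group_module (aut C x) :=
  @GroupModule (aut C x) (Phi x) (fun a => psh_map Phi (aut_fwd a))
    (fun m => psh_id m) (fun g h m => psh_comp (aut_fwd g) (aut_fwd h) m).

(* Main.v *)
From mathcomp Require Import fingroup perm action cyclic pgroup sylow.
From HB Require Import structures.
From mathcomp Require Import all_boot all_order all_algebra.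
From mathcomp Require Import all_classical.
Require Import Defs.

(** Write C for the orbit category of the transporter system, G for the group of
    automorphisms of P in C, D for the category of p-subgroups of G modulo left
    multiplication, and M for the G-module Phi(P).  The two sides are the higher
    limits of Phi over C and of F_M over D.

    They agree because P has a categorical quotient phi_K : P -> Q_K in C by every
    p-subgroup K of G: the K-invariant morphisms out of P factor uniquely through
    phi_K ([quotient_exists]).  So K |-> Q_K is a functor alpha : D -> C, and a
    morphism alpha K -> Q amounts to a K-invariant psi : P -> Q.  The stabilizer of
    such a psi is itself a p-subgroup ([stabilizer_torsion]), hence psi factors
    through the quotient by its whole stabilizer.  In other words the comma category
    of alpha over Q has a terminal object in each connected component, one for each
    G-orbit of morphisms psi : P -> Q.

    The right Kan extension along alpha is a limit over these comma categories, that
    is, a product of values at terminal objects, so it is exact ([push_exact]).  Its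
    left adjoint, precomposition with alpha, preserves monomorphisms, so it preserves
    injectives ([push_injective]); and a limit over C of a Kan extension is the limit
    over D ([push_lim_to], [push_lim_of]).  It therefore carries an injective
    resolution of F_M to an injective resolution with the same limits, and since
    higher limits do not depend on the resolution ([resolution_independence]) it
    preserves them ([higher_lim_push]).

    Finally the Kan extension of F_M is Phi ([higher_lim_Lambda]).  At Q it is a
    product of copies of M over the G-orbits of morphisms P -> Q with trivial
    stabilizer.  Such a morphism is an isomorphism ([free_orbit_iso]), so the product
    vanishes unless Q is isomorphic to P; and then there is just one orbit, because
    endomorphisms of P are invertible ([endo_orbit_iso]).

    What is used about S and the transporter system is this.  A proper subgroup of a
    discrete p-toral group is proper in its normalizer ([normalizer_grows]); this
    provides nontrivial stabilizers.  Discrete p-toral groups satisfy the descending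
    chain condition ([toral_dcc]); this makes endomorphisms invertible.  The quotient
    of P by K is an overgroup of P in S: after a change of P in its conjugacy class, a
    Sylow argument conjugates K into the image of N_S(P) ([sylow_conjugate]), and the
    preimage L of K has P as a normal subgroup.  Invariant morphisms extend from P to
    L by the extension axiom ([ts_extend_normal]), uniquely since the inclusion of a
    normal subgroup is an epimorphism ([ts_epi_normal]). *)

Set Implicit Arguments.
Unset Strict Implicit.
Unset Printing Implicit Defensive.

Import Order.TTheory GRing.Theory Num.Theory.
Local Open Scope classical_set_scope.
Local Open Scope card_scope.
Local Open Scope ring_scope.

(** * Cohomology and independence of the injective resolution *)

Section CohomologyMaps.
Variables (K L : cochain_complex) (f : forall n, {additive K n -> L n}).
Hypothesis fd : forall n a, f n.+1 (cc_d K n a) = cc_d L n (f n a).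

Fact cocycle_map_subproof n (z : cocycles K n) : is_cocycle (f n (val z)).
Proof. by rewrite /is_cocycle -fd (sub_zmodP z) raddf0. Qed.
Definition cocycle_map_fun n (z : cocycles K n) : cocycles L n :=
  sub_mk (A := AddSubgroup _ _) (cocycle_map_subproof z).
Fact cocycle_map_additive n : zmod_morphism (@cocycle_map_fun n).
Proof. by move=> y z; apply/val_inj; exact: raddfB. Qed.
Definition cocycle_map n : {additive cocycles K n -> cocycles L n} :=
  mk_additive (@cocycle_map_additive n).

Lemma coboundary_map n (a : K n) : is_coboundary a -> is_coboundary (f n a).
Proof.
case: n a => [|n] a /=; first by move=> ->; rewrite raddf0.
by move=> [b <-]; exists (f n b); rewrite fd.
Qed.

Fact cohomology_map_subproof n (z : cocycles K n) : coboundaries K n z ->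
  (quot_proj (coboundaries L n) \o cocycle_map n) z = 0.
Proof. by move=> zB; apply/quot_proj_eq0; exact: coboundary_map. Qed.
Definition cohomology_map n : {additive cohomology K n -> cohomology L n} :=
  quot_lift (@cohomology_map_subproof n).
Lemma cohomology_mapE n (z : cocycles K n) :
  cohomology_map n (quot_proj _ z) = quot_proj _ (cocycle_map n z).
Proof. by rewrite /cohomology_map quot_liftE. Qed.
End CohomologyMaps.

(** The composites are compared on cocycles only, up to coboundaries, so that the lemma
    covers homotopy equivalences as well as isomorphisms of complexes. *)
Lemma cohomology_iso (K L : cochain_complex)
    (f : forall n, {additive K n -> L n}) (g : forall n, {additive L n -> K n}) :
  (forall n a, f n.+1 (cc_d K n a) = cc_d L n (f n a)) ->
  (forall n a, g n.+1 (cc_d L n a) = cc_d K n (g n a)) ->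
  (forall n a, is_cocycle a -> is_coboundary (g n (f n a) - a)) ->
  (forall n a, is_cocycle a -> is_coboundary (f n (g n a) - a)) ->
  graded_iso (cohomology K) (cohomology L).
Proof.
move=> fd gd gf fg; exists (cohomology_map fd) => n.
exists (cohomology_map gd n) => y; have [z <-] := quot_proj_surj y;
  rewrite !cohomology_mapE; apply/subr0_eq; rewrite -raddfB;
  apply/quot_proj_eq0 => /=; [apply: gf | apply: fg]; exact: sub_zmodP z.
Qed.

Lemma graded_iso_trans (A B E : nat -> zmodType) :
  graded_iso A B -> graded_iso B E -> graded_iso A E.
Proof.
move=> [f fbij] [g gbij]; exists (fun n => g n \o f n) => n.
exact: bij_comp.
Qed.

Section ImagePresheaf.
Variables (Ob : Type) (C : category Ob).

Definition psh_hom_sub (Phi Psi : presheaf C) (a b : psh_hom Phi Psi) :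
  psh_hom Phi Psi.
Proof.
refine (@PshHom _ C Phi Psi (fun x => a x \- b x) _).
by move=> x y f u /=; rewrite !ph_nat raddfB.
Defined.

Variables (A B : presheaf C) (d : psh_hom A B).

Definition img_ob x : zmodType := sub_zmod (image_sub (d x)).
Fact img_map_subproof x y (f : mor C x y) (b : img_ob y) :
  image_sub (d x) (psh_map B f (val b)).
Proof.
by have [a <-] := sub_zmodP b; exists (psh_map A f a); rewrite ph_nat.
Qed.
Definition img_map_fun x y (f : mor C x y) (b : img_ob y) : img_ob x :=
  sub_mk (img_map_subproof f b).
Fact img_map_additive x y (f : mor C x y) : zmod_morphism (img_map_fun f).
Proof. by move=> a b; apply/val_inj; exact: raddfB. Qed.
Definition img : presheaf C.
Proof.
refine (@Presheaf _ C img_ob (fun x y f => mk_additive (img_map_additive f)) _ _).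
- by move=> x a; apply/val_inj; exact: psh_id.
- by move=> x y z g f a; apply/val_inj; exact: psh_comp.
Defined.

Fact img_incl_additive x : zmod_morphism (fun b : img_ob x => val b).
Proof. exact: (raddfB (val : {additive sub_zmod (image_sub (d x)) -> B x})). Qed.
Definition img_incl : psh_hom img B :=
  @PshHom _ C img B (fun x => mk_additive (@img_incl_additive x))
    (fun x y f b => erefl).

(** The form in which injectivity is used on resolutions: a morphism that kills the
    kernel of d factors through the image of d, and injectivity of J extends it from
    there.  Both the comparison maps and the homotopies arise from it. *)
Lemma psh_extend (J : presheaf C) (u : psh_hom A J) : psh_injective J ->
  (forall x a, d x a = 0 -> u x a = 0) ->
  exists v : psh_hom B J, forall x a, v x (d x a) = u x a.
Proof.
move=> Jinj ud.
have du x a a' : d x a = d x a' -> u x a = u x a'.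
  by move=> e; apply/subr0_eq; rewrite -raddfB ud // raddfB e subrr.
pose w x (b : img_ob x) : J x := u x (sval (cid (sub_zmodP b))).
have dw x (b : img_ob x) : d x (sval (cid (sub_zmodP b))) = val b.
  exact: svalP (cid (sub_zmodP b)).
have wE x a (b : img_ob x) : val b = d x a -> w x b = u x a.
  by move=> e; apply: du; rewrite dw.
have wB x : zmod_morphism (w x).
  move=> b c; rewrite /(w x b) /(w x c) -raddfB; apply: wE.
  by rewrite !raddfB /= !dw.
have wnat x y (f : mor C x y) b : mk_additive (wB x) (psh_map img f b) =
    psh_map J f (mk_additive (wB y) b).
  by rewrite /= /(w y b) -ph_nat; apply: wE; rewrite ph_nat dw.
have incl_mono : psh_mono img_incl by move=> x; exact: val_inj.
have [v vE] := Jinj _ _ img_incl (PshHom wnat) incl_mono.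
exists v => x a.
have im : image_sub (d x) (d x a) by exists a.
have := vE x (sub_mk im : img_ob x); rewrite /= => ->.
exact: wE.
Qed.
End ImagePresheaf.

Section Comparison.
Variables (Ob : Type) (C : category Ob) (Phi : presheaf C).

(** The recursion carries only the condition good, which says that the next square
    can be completed; it passes to the next stage by exactness of R, so no reference to
    earlier stages is needed. *)
Lemma comparison_map (R R' : injective_resolution Phi) :
  exists f : forall n, psh_hom (R n) (R' n),
    (forall x a, f 0%N x (ir_aug R x a) = ir_aug R' x a) /\
    (forall n x a, f n.+1 x (ir_d R n x a) = ir_d R' n x (f n x a)).
Proof.
pose good n (f : psh_hom (R n) (R' n)) :=
  forall x a, ir_d R n x a = 0 -> ir_d R' n x (f x a) = 0.
have [f0 f0E] := psh_extend (d := ir_aug R) (u := ir_aug R') (@ir_injective _ _ _ R' 0%N)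
  (fun x a e => etrans (congr1 (ir_aug R' x)
    (ir_aug_mono (etrans e (esym (raddf0 (ir_aug R x)))))) (raddf0 _)).
have f0good : good 0%N f0.
  move=> x a /ir_exact0 [b <-]; apply/ir_exact0; exists b.
  by rewrite f0E.
have step n (f : {f | good n f}) : {g : {g | good n.+1 g} |
    forall x a, sval g x (ir_d R n x a) = ir_d R' n x (sval f x a)}.
  apply: cid; have [g gE] := psh_extend (d := ir_d R n)
    (u := psh_hom_comp (ir_d R' n) (sval f)) (@ir_injective _ _ _ R' n.+1) (svalP f).
  have ggood : good n.+1 g.
    move=> x a /ir_exact [b <-]; rewrite gE.
    by apply/ir_exact; exists (sval f x b).
  by exists (exist _ g ggood) => x a; exact: gE.
pose F := fix F n : {f | good n f} :=
  match n with 0 => exist _ f0 f0good | m.+1 => sval (step m (F m)) end.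
exists (fun n => sval (F n)); split; first exact: f0E.
by move=> n x a; exact: (svalP (step n (F n))).
Qed.

(** The same recursion as for comparison maps: rest n s is what the next component of
    the homotopy has to produce on the image of the differential, and good says that
    it vanishes on the kernel. *)
Lemma comparison_homotopy (R R' : injective_resolution Phi)
    (f g : forall n, psh_hom (R n) (R' n)) :
  (forall x a, f 0%N x (ir_aug R x a) = g 0%N x (ir_aug R x a)) ->
  (forall n x a, f n.+1 x (ir_d R n x a) = ir_d R' n x (f n x a)) ->
  (forall n x a, g n.+1 x (ir_d R n x a) = ir_d R' n x (g n x a)) ->
  exists s : forall n, psh_hom (R n.+1) (R' n),
    (forall x a, f 0%N x a - g 0%N x a = s 0%N x (ir_d R 0%N x a)) /\
    (forall n x a, f n.+1 x a - g n.+1 x a =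
       ir_d R' n x (s n x a) + s n.+1 x (ir_d R n.+1 x a)).
Proof.
move=> fg0 fd gd.
pose h n := psh_hom_sub (f n) (g n).
have hd n x a : h n.+1 x (ir_d R n x a) = ir_d R' n x (h n x a).
  by rewrite /= fd gd raddfB.
pose rest n (s : psh_hom (R n.+1) (R' n)) :=
  psh_hom_sub (h n.+1) (psh_hom_comp (ir_d R' n) s).
pose good n s := forall x a, ir_d R n.+1 x a = 0 -> rest n s x a = 0.
have [|s0 s0E] := psh_extend (d := ir_d R 0%N) (u := h 0%N) (@ir_injective _ _ _ R' 0%N).
  by move=> x a /ir_exact0 [b <-]; rewrite /= fg0 subrr.
have s0good : good 0%N s0.
  move=> x a /ir_exact [b <-].
  have -> : rest 0%N s0 x (ir_d R 0%N x b) =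
    h 1%N x (ir_d R 0%N x b) - ir_d R' 0%N x (s0 x (ir_d R 0%N x b)) by [].
  by rewrite hd s0E subrr.
have step n (s : {s | good n s}) : {t : {t | good n.+1 t} |
    forall x a, sval t x (ir_d R n.+1 x a) = rest n (sval s) x a}.
  apply: cid; have [t tE] := psh_extend (d := ir_d R n.+1) (u := rest n (sval s))
    (@ir_injective _ _ _ R' n.+1) (svalP s).
  have tgood : good n.+1 t.
    move=> x a /ir_exact [b <-].
    have -> : rest n.+1 t x (ir_d R n.+1 x b) =
      h n.+2 x (ir_d R n.+1 x b) - ir_d R' n.+1 x (t x (ir_d R n.+1 x b)) by [].
    rewrite hd tE -raddfB.
    have -> : h n.+1 x b - rest n (sval s) x b = ir_d R' n x (sval s x b).
      by rewrite /= opprB addrC subrK.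
    by apply/ir_exact; eexists.
  by exists (exist _ t tgood).
pose F := fix F n : {s | good n s} :=
  match n with 0 => exist _ s0 s0good | m.+1 => sval (step m (F m)) end.
exists (fun n => sval (F n)); split; first by move=> x a; rewrite s0E.
move=> n x a; have -> := svalP (step n (F n)) x a.
by rewrite /= [RHS]addrC subrK.
Qed.

Theorem resolution_independence (R R' : injective_resolution Phi) :
  graded_iso (cohomology (lim_complex R)) (cohomology (lim_complex R')).
Proof.
have key (Q Q' : injective_resolution Phi) (f : forall n, psh_hom (Q n) (Q' n))
    (g : forall n, psh_hom (Q' n) (Q n)) :
    (forall x a, f 0%N x (ir_aug Q x a) = ir_aug Q' x a) ->
    (forall n x a, f n.+1 x (ir_d Q n x a) = ir_d Q' n x (f n x a)) ->
    (forall x a, g 0%N x (ir_aug Q' x a) = ir_aug Q x a) ->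
    (forall n x a, g n.+1 x (ir_d Q' n x a) = ir_d Q n x (g n x a)) ->
    forall n (a : lim_complex Q n), is_cocycle a ->
      @is_coboundary (lim_complex Q) n (lim_map (g n) (lim_map (f n) a) - a).
  move=> f0 fd g0 gd.
  pose id n : psh_hom (Q n) (Q n) := PshHom (ph_map := fun x => idfun) (fun x y h a => erefl).
  have [s [s0 sS]] := @comparison_homotopy Q Q
    (fun n => psh_hom_comp (g n) (f n)) id
    (fun x a => etrans (congr1 (g 0%N x) (f0 x a)) (g0 x a))
    (fun n x a => etrans (congr1 (g n.+1 x) (fd n x a)) (gd n x _))
    (fun n x a => erefl).
  case=> [|n] a ac.
    apply/val_inj/functional_extensionality_dep => x /=.
    rewrite [LHS](s0 x (val a x)).
    have -> : ir_d Q 0%N x (val a x) = 0 by exact: (congr1 (fun z => val z x) ac).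
    exact: raddf0.
  exists (lim_map (s n) a).
  apply/val_inj/functional_extensionality_dep => x /=.
  symmetry; rewrite [LHS](sS n x (val a x)).
  have -> : ir_d Q n.+1 x (val a x) = 0 by exact: (congr1 (fun z => val z x) ac).
  by rewrite raddf0 addr0.
have [f [f0 fd]] := comparison_map R R'.
have [g [g0 gd]] := comparison_map R' R.
apply: (@cohomology_iso (lim_complex R) (lim_complex R')
  (fun n => lim_map (f n)) (fun n => lim_map (g n))).
- by move=> n a; apply/val_inj/functional_extensionality_dep => x; exact: fd.
- by move=> n a; apply/val_inj/functional_extensionality_dep => x; exact: gd.
- exact: key.
- exact: key.
Qed.
End Comparison.

(** * Right Kan extension of presheaves *)

(** In this section F and Fm are the object and morphism parts of a functor D -> C. *)
Section RightKan.
Variables (ObD ObC : Type) (D : category ObD) (C : category ObC).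
Variables (F : ObD -> ObC) (Fm : forall K L, mor D K L -> mor C (F K) (F L)).
Hypothesis F_id : forall K, Fm (idmor D K) = idmor C (F K).
Hypothesis F_comp : forall K L M (h : mor D L M) (g : mor D K L),
  Fm (h \oc g) = Fm h \oc Fm g.

Definition pull (Xi : presheaf C) : presheaf D.
Proof.
refine (@Presheaf _ D (fun K => Xi (F K)) (fun K L g => psh_map Xi (Fm g)) _ _).
- by move=> K a; rewrite F_id psh_id.
- by move=> K L M h g a; rewrite F_comp psh_comp.
Defined.

Definition comma (Q : ObC) : Type := {K : ObD & mor C (F K) Q}.
Definition comma_at Q K (f : mor C (F K) Q) : comma Q := existT _ K f.

Section Push.
Variable Psi : presheaf D.

(** The right Kan extension at Q is the limit of Psi over the comma category of
    morphisms F K -> Q, taken in the product of all the values. *)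
Definition push_sections (Q : ObC) : Type :=
  forall c : comma Q, Psi (projT1 c).
HB.instance Definition _ Q :=
  Choice.copy (push_sections Q) (forall c : comma Q, Psi (projT1 c)).
Let add Q (s t : push_sections Q) : push_sections Q := fun c => s c + t c.
Let opp Q (s : push_sections Q) : push_sections Q := fun c => - s c.
Let zero Q : push_sections Q := fun c => 0.
Fact push_addA Q : associative (@add Q).
Proof. by move=> s t u; apply: functional_extensionality_dep => x; exact: addrA. Qed.
Fact push_addC Q : commutative (@add Q).
Proof. by move=> s t; apply: functional_extensionality_dep => x; exact: addrC. Qed.
Fact push_add0 Q : left_id (@zero Q) (@add Q).
Proof. by move=> s; apply: functional_extensionality_dep => x; exact: add0r. Qed.
Fact push_addN Q : left_inverse (@zero Q) (@opp Q) (@add Q).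
Proof. by move=> s; apply: functional_extensionality_dep => x; exact: addNr. Qed.
HB.instance Definition _ Q := GRing.isZmodule.Build (push_sections Q)
  (@push_addA Q) (@push_addC Q) (@push_add0 Q) (@push_addN Q).

Definition push_compatible Q (s : push_sections Q) : Prop :=
  forall K L (g : mor D K L) (f : mor C (F L) Q),
    s (comma_at (f \oc Fm g)) = psh_map Psi g (s (comma_at f)).
Fact push_compatible0 Q : push_compatible (0 : push_sections Q).
Proof. by move=> K L g f; rewrite raddf0. Qed.
Fact push_compatibleB Q (s t : push_sections Q) :
  push_compatible s -> push_compatible t -> push_compatible (s - t).
Proof.
move=> hs ht K L g f.
by rewrite [LHS](_ : _ = s (comma_at (f \oc Fm g)) - t (comma_at (f \oc Fm g))) //
  hs ht raddfB.
Qed.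
Definition push_ob Q : zmodType :=
  sub_zmod (AddSubgroup (@push_compatible0 Q) (@push_compatibleB Q)).

Lemma push_obP Q (s : push_ob Q) : push_compatible (val s).
Proof. exact: (sub_zmodP s). Qed.

Lemma push_ob_eq Q (s t : push_ob Q) :
  (forall K (f : mor C (F K) Q), val s (comma_at f) = val t (comma_at f)) -> s = t.
Proof.
by move=> st; apply/val_inj/functional_extensionality_dep => -[K f]; exact: st.
Qed.

Definition push_map_sections Q R (h : mor C Q R) (s : push_ob R) :
  push_sections Q := fun c => val s (comma_at (h \oc projT2 c)).
Fact push_map_subproof Q R (h : mor C Q R) (s : push_ob R) :
  push_compatible (push_map_sections h s).
Proof.
by move=> K L g f; rewrite /push_map_sections /= compmA push_obP.
Qed.
Definition push_map_fun Q R (h : mor C Q R) (s : push_ob R) : push_ob Q :=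
  sub_mk (A := AddSubgroup _ _) (push_map_subproof h s).
Fact push_map_additive Q R (h : mor C Q R) : zmod_morphism (push_map_fun h).
Proof. by move=> s t; apply: push_ob_eq. Qed.

Definition push : presheaf C.
Proof.
refine (@Presheaf _ C push_ob (fun Q R h => mk_additive (push_map_additive h)) _ _).
- by move=> Q s; apply: push_ob_eq => K f; rewrite /= /push_map_sections /= comp1m.
- move=> Q R T h g s; apply: push_ob_eq => K f.
  by rewrite /= /push_map_sections /= /push_map_sections /= compmA.
Defined.
End Push.

Section PushHom.
Variables (Psi Xi : presheaf D) (a : psh_hom Psi Xi).
Definition push_hom_sections Q (s : push Psi Q) : push_sections Xi Q :=
  fun c => a (projT1 c) (val s c).
Fact push_hom_subproof Q (s : push Psi Q) : push_compatible (push_hom_sections s).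
Proof.
by move=> K L g f; rewrite /push_hom_sections push_obP ph_nat.
Qed.
Definition push_hom_fun Q (s : push Psi Q) : push Xi Q :=
  sub_mk (A := AddSubgroup _ _) (push_hom_subproof s).
Fact push_hom_additive Q : zmod_morphism (@push_hom_fun Q).
Proof. by move=> s t; apply: push_ob_eq => K f; exact: raddfB. Qed.
Fact push_hom_nat Q R (h : mor C Q R) s :
  mk_additive (@push_hom_additive Q) (psh_map (push Psi) h s) =
  psh_map (push Xi) h (mk_additive (@push_hom_additive R) s).
Proof. exact: push_ob_eq. Qed.
Definition push_hom : psh_hom (push Psi) (push Xi) := PshHom push_hom_nat.
End PushHom.

(** The adjunction between precomposition and Kan extension turns an extension
    problem A -> push Psi along A -> B into one for pull A -> Psi along pull A -> pull
    B.  One transpose evaluates a family at the identity of F K; the other sends b to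
    the family of the g (B(k) b). *)
Lemma push_injective (Psi : presheaf D) : psh_injective Psi -> psh_injective (push Psi).
Proof.
move=> Pinj A B i f i_mono.
pose ev K (a : A (F K)) : Psi K := val (f (F K) a) (comma_at (idmor C (F K))).
have evB K : zmod_morphism (@ev K) by move=> a b; rewrite /ev raddfB.
have ev_nat K L (g : mor D K L) (a : pull A L) : mk_additive (@evB K) (psh_map (pull A) g a) =
    psh_map Psi g (mk_additive (@evB L) a).
  by rewrite /= /ev /= ph_nat /= /push_map_sections /= -push_obP compm1 comp1m.
have pi_nat K L (g : mor D K L) (a : pull A L) :
  i (F K) (psh_map (pull A) g a) = psh_map (pull B) g (i (F L) a) by exact: ph_nat.
have [g gE] := Pinj (pull A) (pull B)
  (@PshHom _ D (pull A) (pull B) (fun K => i (F K)) pi_nat)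
  (PshHom ev_nat) (fun K => @i_mono (F K)).
pose G Q (b : B Q) : push_sections Psi Q := fun c => g (projT1 c) (psh_map B (projT2 c) b).
have Gc Q (b : B Q) : push_compatible (G Q b).
  move=> K L h k; rewrite {1}/G /= psh_comp.
  exact: (ph_nat g h (psh_map B k b : pull B L)).
have GB Q : zmod_morphism (fun b => sub_mk (A := AddSubgroup _ _) (Gc Q b) : push Psi Q).
  by move=> b c; apply: push_ob_eq => K k; rewrite /= /G !raddfB.
have Gnat Q R (h : mor C Q R) b : mk_additive (GB Q) (psh_map B h b) =
    psh_map (push Psi) h (mk_additive (GB R) b).
  by apply: push_ob_eq => K k; rewrite /= /G /= /push_map_sections /= psh_comp.
exists (PshHom Gnat) => Q a; apply: push_ob_eq => K k /=.
rewrite /G /= -ph_nat; have /= -> := gE K (psh_map A k a).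
by rewrite /ev ph_nat /= /push_map_sections /= compm1.
Qed.

(* The elements of T are terminal objects of the components of the comma category, one
   for each.  Uniqueness is stated for pairs, since two objects of the comma category
   reach the same terminal object only up to an equation in T. *)
Hypothesis comma_terminal : forall Q, exists T : set (comma Q),
  (forall K (f : mor C (F K) Q), exists c (m : mor D K (projT1 c)),
      T c /\ f = projT2 c \oc Fm m) /\
  (forall K c c' (m : mor D K (projT1 c)) (m' : mor D K (projT1 c')), T c -> T c' ->
     projT2 c \oc Fm m = projT2 c' \oc Fm m' ->
     existT (fun c : comma Q => mor D K (projT1 c)) c m = existT _ c' m').

(** A compatible family is freely determined by its values at the terminal objects of
    the components, and there a preimage under d can be chosen without constraint. *)
Lemma push_exact (A B E : presheaf D) (d : psh_hom A B) (d' : psh_hom B E) :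
  (forall K b, d' K b = 0 <-> exists a, d K a = b) ->
  forall Q t, push_hom d' Q t = 0 <-> exists s, push_hom d Q s = t.
Proof.
move=> ex Q t; split=> [t0|[s <-]]; last first.
  by apply: push_ob_eq => K f; apply/ex; eexists.
have lift (c : comma Q) : {a | d (projT1 c) a = val t c}.
  by apply: cid; apply/ex; have := congr1 (fun u => val u c) t0.
have [T [Tex Tuniq]] := comma_terminal Q.
(* ret c is the terminal object of the component of c with the morphism from c to it. *)
have ret (c : comma Q) : {u : {c' : comma Q & mor D (projT1 c) (projT1 c')} |
    T (projT1 u) /\ projT2 c = projT2 (projT1 u) \oc Fm (projT2 u)}.
  apply: cid; have [c' [m [Tc' e]]] := Tex _ (projT2 c).
  by exists (existT _ c' m).
pose val_at K (u : {c : comma Q & mor D K (projT1 c)}) : A K :=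
  psh_map A (projT2 u) (sval (lift (projT1 u))).
pose s (c : comma Q) : A (projT1 c) := @val_at (projT1 c) (sval (ret c)).
have sc : push_compatible (s : push_sections A Q).
  move=> K L g f; rewrite /s.
  case: (ret (comma_at (f \oc Fm g))) => -[c m] /= [Tc e].
  case: (ret (comma_at f)) => -[c' m'] /= [Tc' e'].
  rewrite (_ : existT _ c m = existT _ c' (m' \oc g)).
    by rewrite /val_at /= psh_comp.
  by apply: Tuniq => //; rewrite -e e' F_comp compmA.
exists (sub_mk (A := AddSubgroup _ _) sc); apply: push_ob_eq => K f.
rewrite /= /push_hom_sections /= /s.
case: (ret (comma_at f)) => -[[K' f'] m] /= [Tc e].
rewrite /val_at /= ph_nat; have -> := svalP (lift (existT _ K' f')).
by rewrite e push_obP.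
Qed.

Section PushLimit.
Variable Psi : presheaf D.

(** A compatible family over C of compatible families over the comma categories is
    determined by its values at the identities of the F K, by naturality in Q; these
    values form a compatible family over D, and any such family occurs. *)
Definition push_lim_to_fun (s : psh_lim (push Psi)) : sections Psi :=
  fun K => val (val s (F K)) (comma_at (idmor C (F K))).
Fact push_lim_to_subproof s : compatible (push_lim_to_fun s).
Proof.
move=> K L g; rewrite /push_lim_to_fun -push_obP comp1m.
have := sub_zmodP s (F K) (F L) (Fm g) => <- /=.
by rewrite /push_map_sections /= compm1.
Qed.
Definition push_lim_to_map s : psh_lim Psi :=
  sub_mk (A := AddSubgroup _ _) (push_lim_to_subproof s).
Fact push_lim_to_additive : zmod_morphism push_lim_to_map.
Proof. by move=> s t; apply/val_inj/functional_extensionality_dep => K. Qed.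
Definition push_lim_to : {additive psh_lim (push Psi) -> psh_lim Psi} :=
  mk_additive push_lim_to_additive.

Definition push_lim_of_sections (t : psh_lim Psi) Q : push_sections Psi Q :=
  fun c => val t (projT1 c).
Fact push_lim_of_subproof t Q : push_compatible (@push_lim_of_sections t Q).
Proof. by move=> K L g f; rewrite /push_lim_of_sections /= (sub_zmodP t). Qed.
Definition push_lim_of_fun (t : psh_lim Psi) : sections (push Psi) :=
  fun Q => sub_mk (A := AddSubgroup _ _) (@push_lim_of_subproof t Q).
Fact push_lim_of_compatible t : compatible (push_lim_of_fun t).
Proof. by move=> Q R h; apply: push_ob_eq. Qed.
Definition push_lim_of_map t : psh_lim (push Psi) :=
  sub_mk (A := AddSubgroup _ _) (@push_lim_of_compatible t).
Fact push_lim_of_additive : zmod_morphism push_lim_of_map.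
Proof.
move=> s t; apply/val_inj/functional_extensionality_dep => Q.
exact: push_ob_eq.
Qed.
Definition push_lim_of : {additive psh_lim Psi -> psh_lim (push Psi)} :=
  mk_additive push_lim_of_additive.

Lemma push_lim_ofK t : push_lim_to (push_lim_of t) = t.
Proof. by apply/val_inj/functional_extensionality_dep. Qed.
Lemma push_lim_toK s : push_lim_of (push_lim_to s) = s.
Proof.
apply/val_inj/functional_extensionality_dep => Q; apply: push_ob_eq => K f /=.
rewrite /push_lim_of_sections /= /push_lim_to_fun.
have := sub_zmodP s (F K) Q f => <- /=.
by rewrite /push_map_sections /= compm1.
Qed.
End PushLimit.

(** Applied to an injective resolution of Psi, Kan extension gives an injective
    resolution of push Psi with the same limits; eta makes it one of Phi. *)
Theorem higher_lim_push (Phi : presheaf C) (Psi : presheaf D)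
    (eta : psh_hom Phi (push Psi)) : (forall Q, bijective (eta Q)) ->
  graded_iso (higher_lim Phi) (higher_lim Psi).
Proof.
move=> eta_bij; pose R := std_resolution Psi.
have mono (A B : presheaf D) (d : psh_hom A B) : psh_mono d -> psh_mono (push_hom d).
  move=> dm Q s t e; apply: push_ob_eq => K f; apply: dm.
  exact: (congr1 (fun u => val u (comma_at f)) e).
have @R' : injective_resolution Phi.
  refine (@InjectiveResolution _ C Phi (fun n => push (R n))
    (fun n => push_hom (ir_d R n)) (psh_hom_comp (push_hom (ir_aug R)) eta) _ _ _ _).
  - by move=> n; apply/push_injective/ir_injective.
  - move=> Q a b /(mono _ _ _ (@ir_aug_mono _ _ _ R)); exact: bij_inj.
  - move=> Q a; rewrite (push_exact (d := ir_aug R)); last exact: ir_exact0.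
    split=> [[s <-]|[b <-]]; last by eexists.
    by have [g _ gK] := eta_bij Q; exists (g s); rewrite /= gK.
  - by move=> n Q a; apply: push_exact; exact: ir_exact.
apply: graded_iso_trans (resolution_independence (std_resolution Phi) R') _.
apply: (@cohomology_iso (lim_complex R') (lim_complex R)
  (fun n => push_lim_to (R n)) (fun n => push_lim_of (R n))).
- by move=> n a; apply/val_inj/functional_extensionality_dep.
- move=> n a; apply/val_inj/functional_extensionality_dep => Q; exact: push_ob_eq.
- by move=> n a _; rewrite push_lim_toK subrr; exact: is_coboundary0.
- by move=> n a _; rewrite push_lim_ofK subrr; exact: is_coboundary0.
Qed.
End RightKan.

(** * Quotient objects by groups of automorphisms *)

Definition is_iso Ob (C : category Ob) (x y : Ob) (f : mor C x y) : Prop :=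
  exists g, g \oc f = idmor C x /\ f \oc g = idmor C y.

Section Quotients.
Variables (Ob : Type) (C : category Ob) (P : Ob).

Definition fixes (K : subgroup (aut C P)) Q (psi : mor C P Q) : Prop :=
  forall k, sg_set K k -> psi \oc aut_fwd k = psi.

Record is_quotient (K : subgroup (aut C P)) Q (phi : mor C P Q) : Prop :=
  IsQuotient {
  quotient_fixes : fixes K phi;
  quotient_factor : forall R (psi : mor C P R), fixes K psi ->
    exists h, h \oc phi = psi;
  quotient_epi : forall R (h h' : mor C Q R), h \oc phi = h' \oc phi -> h = h' }.

Definition stabilizer Q (psi : mor C P Q) : subgroup (aut C P).
Proof.
refine (@Subgroup (aut C P) [set a | psi \oc aut_fwd a = psi] _ _ _).
- exact: compm1.
- by move=> a b ha hb; rewrite /= compmA ha hb.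
- by move=> a ha; rewrite /= -[in LHS]ha -compmA aut_fb compm1.
Defined.
End Quotients.

(** Thanks to this, quotients need only be constructed for one object in each
    isomorphism class. *)
Lemma is_quotient_iso Ob (C : category Ob) P P' Q (u : mor C P P') (v : mor C P' P)
    (vu : v \oc u = idmor C P) (uv : u \oc v = idmor C P')
    (K : subgroup (aut C P)) (K' : subgroup (aut C P')) (phi : mor C P' Q) :
  (forall a : aut C P, sg_set K a ->
     exists2 a', sg_set K' a' & u \oc aut_fwd a = aut_fwd a' \oc u) ->
  (forall a', sg_set K' a' ->
     exists2 a, sg_set K a & u \oc aut_fwd a = aut_fwd a' \oc u) ->
  is_quotient K' phi -> is_quotient K (phi \oc u).
Proof.
move=> KK' K'K [fix_phi fac epi]; split.
- move=> a /KK' [a' Ka' e]; rewrite -compmA e compmA; congr (_ \oc _).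
  exact: fix_phi.
- move=> R psi fix_psi; have [|h hE] := fac R (psi \oc v).
    move=> a' /K'K [a Ka e].
    have : u \oc aut_fwd a \oc v = aut_fwd a' by rewrite e -compmA uv compm1.
    move=> <-; rewrite -!compmA (compmA v u) vu comp1m compmA.
    by congr (_ \oc _); exact: fix_psi.
  by exists h; rewrite compmA hE -compmA vu compm1.
- move=> R h h' e; apply: epi.
  by rewrite -[h \oc phi]compm1 -[h' \oc phi]compm1 -uv !compmA -(compmA h) e compmA.
Qed.

(** * Comparison with the category of p-subgroups *)

Definition triv_subgroup (G : groupType) : subgroup G.
Proof.
refine (@Subgroup G [set 1%g] _ _ _) => //.
- by move=> _ _ -> ->; exact: mulg1.
- by move=> _ ->; exact: invg1.
Defined.

Section OrbitReduction.
Variables (p : nat) (Ob : Type) (C : category Ob) (P : Ob).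
Let G := aut C P.
Hypothesis quot_exists : forall K : subgroup G, p_subgroup p K ->
  exists Q (phi : mor C P Q), is_quotient K phi.
Hypothesis stab_p : forall Q (psi : mor C P Q), p_subgroup p (stabilizer psi).
Hypothesis stab_iso : forall Q (psi : mor C P Q),
  sg_trivial (stabilizer psi) -> is_iso psi.
Hypothesis endo_iso : forall psi : mor C P P, is_iso psi.

Let D := Op_cat p G.
Let Dob := {K : subgroup G | p_subgroup p K}.
Let tr := transporter_cat (p_subgroup (G := G) p).

Let q_data (K : Dob) := cid (quot_exists (svalP K)).
Let q_ob (K : Dob) : Ob := sval (q_data K).
Let q_map (K : Dob) : mor C P (q_ob K) := sval (cid (svalP (q_data K))).
Let q_mapP (K : Dob) : is_quotient (sval K) (q_map K) :=
  svalP (cid (svalP (q_data K))).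

(* For g with gKg^-1 <= L, the morphism phi_L g is K-invariant. *)
Let alpha_ex (K L : Dob) (f : mor tr K L) :
  exists h, h \oc q_map K = q_map L \oc aut_fwd (sval f).
Proof.
apply: (quotient_factor (q_mapP K)) => k Kk; rewrite -compmA.
have -> : aut_fwd (sval f) \oc aut_fwd k =
    aut_fwd (lconj (sval f) k) \oc aut_fwd (sval f).
  have e : (sval f * k = lconj (sval f) k * sval f)%g by rewrite /lconj mulgVK.
  exact: (congr1 (@aut_fwd _ _ _) e).
rewrite compmA; congr (_ \oc _); apply: (quotient_fixes (q_mapP L)).
exact: (svalP f).
Qed.

Let alpha (K L : Dob) (X : mor D K L) : mor C (q_ob K) (q_ob L) :=
  sval (cid (alpha_ex (class_repr X))).

Let alphaE (K L : Dob) (f : mor tr K L) :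
  alpha (orbit_of (Op_datum p G) f : mor D K L) \oc q_map K = q_map L \oc aut_fwd (sval f).
Proof.
rewrite /alpha; set r := class_repr _.
have -> := svalP (cid (alpha_ex r)).
have : orbit_rel (Op_datum p G) f r.
  by apply/orbit_of_eq; rewrite /orbit_of class_reprK.
move=> [_ [x _ <-] ->]; rewrite /= compmA; congr (_ \oc _).
apply: (quotient_fixes (q_mapP L)); exact: (sg_typeP x).
Qed.

Let alpha_id K : alpha (idmor D K) = idmor C (q_ob K).
Proof.
by apply: (quotient_epi (q_mapP K)); rewrite [LHS]alphaE comp1m compm1.
Qed.

Let alpha_comp K L M (h : mor D L M) (g : mor D K L) :
  alpha (h \oc g) = alpha h \oc alpha g.
Proof.
have [[y ->] [x ->]] := (orbit_of_surj h, orbit_of_surj g).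
apply: (quotient_epi (q_mapP K)).
have -> : compm (c := D) (orbit_of (Op_datum p G) y) (orbit_of (Op_datum p G) x) =
  orbit_of (Op_datum p G) (y \oc x) by exact: orbit_compE.
by rewrite alphaE -compmA alphaE compmA alphaE -compmA.
Qed.

(* The terminal object of the component of psi in the comma category over Q: the
   morphism that psi induces on the quotient of P by its own stabilizer. *)
Let stab_ob Q (psi : mor C P Q) : Dob := exist _ (stabilizer psi) (@stab_p Q psi).

Let stab_ex Q (psi : mor C P Q) : exists h, h \oc q_map (stab_ob psi) = psi.
Proof. by apply: (quotient_factor (q_mapP _)) => k. Qed.

Let term Q (psi : mor C P Q) : comma C q_ob Q :=
  comma_at (sval (cid (stab_ex psi))).
Let termE Q (psi : mor C P Q) : projT2 (term psi) \oc q_map (stab_ob psi) = psi.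
Proof. exact: (svalP (cid (stab_ex psi))). Qed.

Let termM Q (psi : mor C P Q) K (x : mor tr K (stab_ob psi)) :
  projT2 (term psi) \oc alpha (orbit_of (Op_datum p G) x : mor D K (projT1 (term psi)))
    \oc q_map K = psi \oc aut_fwd (sval x).
Proof. by rewrite -compmA alphaE compmA termE. Qed.

Let same_orbit Q (psi psi' : mor C P Q) : Prop :=
  exists a : G, psi' = psi \oc aut_fwd a.
Let same_orbit_refl Q (psi : mor C P Q) : same_orbit psi psi.
Proof. by exists 1%g; rewrite compm1. Qed.
Let same_orbit_sym Q (psi psi' : mor C P Q) : same_orbit psi psi' -> same_orbit psi' psi.
Proof. by move=> [a ->]; exists a^-1%g; rewrite -compmA aut_fb compm1. Qed.
Let same_orbit_trans Q (x y z : mor C P Q) :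
  same_orbit x y -> same_orbit y z -> same_orbit x z.
Proof. by move=> [a ->] [b ->]; exists (a * b)%g; rewrite -compmA. Qed.

Let fixed_by (K : Dob) Q (f : mor C (q_ob K) Q) : fixes (sval K) (f \oc q_map K).
Proof.
by move=> k Kk; rewrite -compmA; congr (_ \oc _); exact: (quotient_fixes (q_mapP K)).
Qed.

(* Objects (K, f) of the comma category correspond to K-invariant morphisms psi, and a
   morphism between two of them is a g in G with psi = psi' g, up to left multiplication
   by the target group.  So components are orbits, and psi maps to the representative r
   of its orbit by any a with psi = r a, unique modulo the stabilizer of r. *)
Let alpha_terminal Q : exists T : set (comma C q_ob Q),
  (forall K (f : mor C (q_ob K) Q), exists c (m : mor D K (projT1 c)),
      T c /\ f = projT2 c \oc alpha m) /\
  (forall K c c' (m : mor D K (projT1 c)) (m' : mor D K (projT1 c')), T c -> T c' ->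
     projT2 c \oc alpha m = projT2 c' \oc alpha m' ->
     existT (fun c : comma C q_ob Q => mor D K (projT1 c)) c m = existT _ c' m').
Proof.
exists [set term (class_repr X) | X in [set: classes (@same_orbit Q)]]; split.
- move=> K f; pose psi := f \oc q_map K.
  pose r := class_repr (class_of (@same_orbit Q) psi).
  have [a ra] : same_orbit r psi.
    apply: same_orbit_sym.
    exact: (class_reprP (@same_orbit_refl Q) (@same_orbit_sym Q) (@same_orbit_trans Q)).
  have tr_a : transporter_set (sval K) (stabilizer r) a.
    move=> k Kk /=; rewrite !compmA -ra (fixed_by f Kk) -/psi ra.
    by rewrite -compmA aut_fb compm1.
  exists (term r).
  exists (orbit_of (Op_datum p G) (exist _ a tr_a : mor tr K (stab_ob r))).
  split; first by eexists.
  by apply: (quotient_epi (q_mapP K)); rewrite -compmA alphaE compmA termE -ra.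
- move=> K c c' m m' [X _ eX] [X' _ eX']; subst c c'.
  have [[x ->] [x' ->]] := (orbit_of_surj m, orbit_of_surj m') => e.
  have {}e : class_repr X \oc aut_fwd (sval x) = class_repr X' \oc aut_fwd (sval x').
    by rewrite -!termM e.
  have XX' : X = X'.
    rewrite -(class_reprK X) -(class_reprK X').
    apply/(class_eq (@same_orbit_refl Q) (@same_orbit_sym Q) (@same_orbit_trans Q)).
    exists (sval x * (sval x')^-1)%g.
    by rewrite /= compmA e -compmA aut_fb compm1.
  subst X'; congr existT; apply/orbit_of_eq.
  have St : sg_set (stabilizer (class_repr X)) (sval x' * (sval x)^-1)%g.
    by rewrite /= compmA -e -compmA aut_fb compm1.
  exists (tr_elt (P := stab_ob (class_repr X)) (sg_mk St)); first by eexists.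
  by apply: tr_eq; rewrite /= mulgVK.
Qed.

Variable Phi : presheaf C.
Hypothesis Phi0 : forall Q, ~ isomorphic C P Q -> forall x : Phi Q, x = 0.
Let M := value_module Phi P.

(* An isomorphism v from Q_K back to P would make v phi_K an invertible K-invariant
   endomorphism of P. *)
Let quotient_not_iso K : ~ sg_trivial (sval K) -> ~ isomorphic C P (q_ob K).
Proof.
move=> ntK [u [v [vu uv]]]; apply: ntK => k Kk.
have [w [wv _]] := endo_iso (v \oc q_map K).
apply: aut_eq; rewrite -[LHS]comp1m -wv -!compmA.
by rewrite (quotient_fixes (q_mapP K) Kk).
Qed.

Let unit_sub Q (x : Phi Q) K (f : mor C (q_ob K) Q) :
  FM_sub M (sval K) (psh_map Phi (f \oc q_map K) x).
Proof.
move=> ntK; rewrite psh_comp.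
by rewrite (Phi0 (quotient_not_iso ntK) (psh_map Phi f x)) raddf0.
Qed.

(* The comparison Phi -> push F_M sends x in Phi(Q) to the family of its restrictions
   along the invariant morphisms f phi_K : P -> Q. *)
Let unit_sections Q (x : Phi Q) : push_sections C q_ob (FM p M) Q :=
  fun c => sub_mk (unit_sub x (projT2 c)).

Let unit_compatible Q (x : Phi Q) : push_compatible alpha (unit_sections x).
Proof.
move=> K L g f; have [y ->] := orbit_of_surj g.
rewrite [RHS]FM_mapE; apply/val_inj => /=.
by rewrite -compmA alphaE compmA psh_comp.
Qed.

Let unit_fun Q (x : Phi Q) : push alpha (FM p M) Q :=
  sub_mk (A := AddSubgroup _ _) (unit_compatible x).
Let unit_additive Q : zmod_morphism (@unit_fun Q).
Proof. by move=> x y; apply: push_ob_eq => K f; apply/val_inj; exact: raddfB. Qed.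
Let unit_nat Q R (h : mor C Q R) x :
  mk_additive (@unit_additive Q) (psh_map Phi h x) =
  psh_map (push alpha (FM p M)) h (mk_additive (@unit_additive R) x).
Proof.
by apply: push_ob_eq => K f; apply/val_inj; rewrite /= -psh_comp compmA.
Qed.
Let unit_hom : psh_hom Phi (push alpha (FM p M)) := PshHom unit_nat.

Let p1 : p_subgroup p (triv_subgroup G).
Proof. by move=> x ->; exists 0%N; rewrite expg1n. Qed.
Let one : Dob := exist _ _ p1.

(* F_M takes its values in subgroups of M; families are compared in M itself. *)
Let at_map Q (t : push alpha (FM p M) Q) K (f : mor C (q_ob K) Q) : Phi P :=
  let m : FM_ob M K := (val t : push_sections C q_ob (FM p M) Q) (comma_at f) in val m.

Let at_mapM Q (t : push alpha (FM p M) Q) K L (y : mor tr K L) (f : mor C (q_ob L) Q) :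
  at_map t (f \oc alpha (orbit_of (Op_datum p G) y : mor D K L)) =
  psh_map Phi (aut_fwd (sval y)) (at_map t f).
Proof. by rewrite /at_map push_obP [psh_map (FM p M) _ _]FM_mapE. Qed.

Let at_map0 Q (t : push alpha (FM p M) Q) K (f : mor C (q_ob K) Q) :
  ~ sg_trivial (sval K) -> at_map t f = 0.
Proof. exact: (sub_zmodP (_ : FM_ob M K)). Qed.

Let at_map_eq Q (s t : push alpha (FM p M) Q) :
  (forall K (f : mor C (q_ob K) Q), at_map s f = at_map t f) -> s = t.
Proof. by move=> st; apply: push_ob_eq => K f; apply/val_inj/st. Qed.

Let at_unit Q (x : Phi Q) K (f : mor C (q_ob K) Q) :
  at_map (unit_hom Q x) f = psh_map Phi (f \oc q_map K) x.
Proof. by []. Qed.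

(* The inverse reads a family at the trivial subgroup and the chosen isomorphism u,
   transported back to Q along v.  The family has no other degree of freedom: f1 plays
   the role of u, and every other morphism P -> Q is u times an automorphism of P. *)
Let unit_iso Q : isomorphic C P Q -> bijective (unit_hom Q).
Proof.
move=> [u [v [vu uv]]].
have [f1 f1E] : exists f, f \oc q_map one = u.
  by apply: (quotient_factor (q_mapP one)) => k ->; exact: compm1.
exists (fun t => psh_map Phi v (at_map t f1)) => [x|t].
  by rewrite at_unit f1E -psh_comp uv psh_id.
apply: at_map_eq => K f; rewrite at_unit.
have [tK|ntK] := pselect (sg_trivial (sval K)); last first.
  by rewrite [RHS]at_map0 //; exact: (unit_sub _ f ntK).
have [w [wv vw]] := endo_iso (v \oc (f \oc q_map K)).
pose a : G := Aut vw wv.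
have a_tr : transporter_set (sval K) (triv_subgroup G) a.
  by move=> k /tK ->; exact: lconjg1.
have fE : f = f1 \oc alpha (orbit_of (Op_datum p G) (exist _ a a_tr : mor tr K one)).
  apply: (quotient_epi (q_mapP K)).
  by rewrite -compmA alphaE compmA f1E /= compmA uv comp1m.
by rewrite [in RHS]fE at_mapM [RHS]psh_comp.
Qed.

(* Every index (K, f) maps to one whose group is the stabilizer of f phi_K, which is
   nontrivial, so every family takes its values in the zero group. *)
Let unit_zero Q : ~ isomorphic C P Q -> bijective (unit_hom Q).
Proof.
move=> nQ; exists (fun _ => 0) => [x|t]; first by rewrite [RHS]Phi0.
apply: at_map_eq => K f; rewrite at_unit raddf0.
pose psi := f \oc q_map K.
have [h hE] := stab_ex psi.
have ntH : ~ sg_trivial (sval (stab_ob psi)).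
  by move=> /stab_iso [v [vu uv]]; apply: nQ; exists psi, v.
have K_tr : transporter_set (sval K) (stabilizer psi) 1%g.
  by move=> k Kk; rewrite lconj1g; exact: fixed_by.
have -> : f = h \oc alpha (orbit_of (Op_datum p G)
    (exist _ 1%g K_tr : mor tr K (stab_ob psi))).
  by apply: (quotient_epi (q_mapP K)); rewrite -compmA alphaE compmA hE compm1.
by rewrite at_mapM at_map0 // raddf0.
Qed.

Theorem higher_lim_Lambda : graded_iso (higher_lim Phi) (Lambda p M).
Proof.
apply: (@higher_lim_push _ _ D C q_ob alpha alpha_id alpha_comp alpha_terminal
  Phi (FM p M) unit_hom) => Q.
have [/unit_iso//|/unit_zero//] := pselect (isomorphic C P Q).
Qed.
End OrbitReduction.

Local Close Scope ring_scope.

(** * Fixed points of torsion groups acting on finite sets *)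

Lemma card_enum (T : Type) (X : set T) n : X #= `I_n ->
  exists2 e : 'I_n -> T, injective e & forall x, X x <-> exists i, e i = x.
Proof.
move=> /card_set_bijP[f [fX f_inj f_surj]].
have inv (i : 'I_n) : {x | X x /\ f x = i}.
  by apply: cid; have [x Xx fx] := f_surj i (ltn_ord i); exists x.
exists (fun i => sval (inv i)).
  move=> i j eij; apply/val_inj.
  by rewrite /= -(proj2 (svalP (inv i))) -(proj2 (svalP (inv j))) eij.
move=> x; split=> [Xx|[i <-]]; last exact: (proj1 (svalP (inv i))).
have fx : (f x < n)%N by exact: fX.
exists (Ordinal fx); have [Xy fy] := svalP (inv (Ordinal fx)).
by apply: f_inj; rewrite ?inE.
Qed.

Definition torsion (p : nat) (G : groupType) : Prop :=
  forall x : G, exists k, (x ^+ (p ^ k) = 1)%g.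

(** An action on a set enumerated by e is turned into a group of permutations of
    the indices, to which the counting results on finite groups apply. *)
Section Action.
Variables (G : groupType) (T : Type) (act : G -> T -> T).
Hypotheses (act1 : forall x, act 1%g x = x)
  (actM : forall g h x, act (g * h)%g x = act g (act h x)).
Variables (n : nat) (e : 'I_n -> T).
Hypotheses (e_inj : injective e)
  (act_stable : forall g i, exists j, e j = act g (e i)).

Definition act_fun (g : G) (i : 'I_n) : 'I_n := sval (cid (act_stable g i)).
Lemma act_funE g i : e (act_fun g i) = act g (e i).
Proof. exact: (svalP (cid (act_stable g i))). Qed.
Lemma act_fun_inj g : injective (act_fun g).
Proof.
move=> i j /(congr1 e); rewrite !act_funE => /(congr1 (act g^-1%g)).
by rewrite -!actM mulVg !act1 => /e_inj.
Qed.
Definition act_perm g : {perm 'I_n} := perm (@act_fun_inj g).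
Lemma act_permE g i : e (act_perm g i) = act g (e i).
Proof. by rewrite permE act_funE. Qed.
(** The order is reversed because permutations compose from left to right. *)
Lemma act_permM g h : act_perm (g * h)%g = (act_perm h * act_perm g)%g.
Proof. by apply/perm.permP => i; apply: e_inj; rewrite permM !act_permE actM. Qed.
Lemma act_perm1 : act_perm 1%g = 1%g.
Proof. by apply/perm.permP => i; apply: e_inj; rewrite act_permE perm1 act1. Qed.
Lemma act_permX g k : act_perm (g ^+ k)%g = (act_perm g ^+ k)%g.
Proof.
elim: k => [|k IH]; first exact: act_perm1.
by rewrite expgSr expgS act_permM IH.
Qed.

Definition act_image : {set {perm 'I_n}} := [set s | `[< exists g, act_perm g = s >]]%SET.
Lemma act_image_group : group_set act_image.
Proof.
apply/group_setP; split.
  by rewrite !inE; exists 1%g; exact: act_perm1.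
move=> s t; rewrite !inE => -[g <-] [h <-].
by exists (h * g)%g; rewrite act_permM.
Qed.
Canonical act_group := fingroup.Group act_image_group.

(** By Cauchy's theorem, a finite group whose elements have p-power order is a
    p-group. *)
Lemma act_group_torsion p : prime p -> torsion p G -> (p.-group act_group)%g.
Proof.
move=> p_pr Gp; apply/pgroupP => q q_pr /(Cauchy q_pr) [s].
rewrite !inE => -[g <-] ord_s; have [k gk] := Gp g.
have : q %| p ^ k by rewrite -ord_s order_dvdn -act_permX gk act_perm1.
by rewrite Euclid_dvdX // dvdn_prime2 // => /andP[/eqP -> _]; exact: eqxx.
Qed.

Lemma fixed_points_mod p : prime p -> torsion p G ->
  #|[set i | `[< forall g, act g (e i) = e i >]]%SET| = n %[mod p].
Proof.
move=> p_pr Gp; have pG := act_group_torsion p_pr Gp.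
have acts : [acts act_group, on [set: 'I_n]%SET | 'P]%g.
  by apply/actsP => s _ i; rewrite !inE.
have := pgroup_fix_mod pG acts; rewrite cardsT card_ord => ->.
congr (#|pred_of_set _| %% p); apply/setP => i; rewrite !inE /=.
apply/asboolP/fintype.subsetP => [fix_i s|fix_i g].
  rewrite !inE => -[g <-]; apply/eqP/e_inj.
  by rewrite /= /aperm act_permE.
have : act_perm g \in act_image by rewrite !inE; exists g.
by move=> /fix_i; rewrite inE => /eqP/(congr1 e); rewrite /= /aperm act_permE.
Qed.
End Action.

Section FixedPoints.
Variables (p : nat) (G : groupType) (T : Type) (act : G -> T -> T).
Hypotheses (p_prime : prime p) (G_torsion : torsion p G)
  (act1 : forall x, act 1%g x = x)
  (actM : forall g h x, act (g * h)%g x = act g (act h x)).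
Variables (X : set T) (n : nat).
Hypotheses (Xn : X #= `I_n) (act_stable : forall g x, X x -> X (act g x)).

Let fixed x := forall g, act g x = x.

Let enum : exists e : 'I_n -> T, [/\ injective e,
  forall x, X x <-> exists i, e i = x &
  #|[set i | `[< fixed (e i) >]]%SET| = n %[mod p] ].
Proof.
have [e e_inj eX] := card_enum Xn; exists e; split => //.
apply: (fixed_points_mod act1 actM) => // g i.
by apply/eX/act_stable/eX; exists i.
Qed.

Lemma coprime_fixed_point : coprime n p -> exists2 x, X x & fixed x.
Proof.
move=> np; have [e [e_inj eX em]] := enum.
have /card_gt0P [i] : (0 < #|[set i | `[< fixed (e i) >]]%SET|)%N.
  rewrite lt0n; apply/eqP => E0; move: em; rewrite E0 mod0n => /esym/eqP p_n.
  by move: np; rewrite coprime_sym prime_coprime // /dvdn p_n.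
by rewrite !inE => fix_i; exists (e i) => //; apply/eX; exists i.
Qed.

Lemma dvdn_no_fixed_point : (forall x, X x -> ~ fixed x) -> p %| n.
Proof.
move=> nofix; have [e [e_inj eX em]] := enum.
rewrite /dvdn -em (_ : [set i | _]%SET = finset.set0) ?cards0 ?mod0n //.
apply/setP => i; rewrite !inE; apply/asboolP/nofix.
by apply/eX; exists i.
Qed.

Lemma second_fixed_point x : X x -> fixed x -> p %| n ->
  exists y, [/\ X y, fixed y & y <> x].
Proof.
move=> Xx fix_x; have [e [e_inj eX em]] := enum.
have [i ei] := (eX x).1 Xx; rewrite /dvdn -em => p_dvd.
have iF : i \in [set i | `[< fixed (e i) >]]%SET by rewrite !inE ei.
have /card_gt1P [j [k [jF kF jk]]] : (1 < #|[set i | `[< fixed (e i) >]]%SET|)%N.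
  apply: leq_trans (prime_gt1 p_prime) (dvdn_leq _ p_dvd).
  by apply/card_gt0P; exists i.
have [l lF li] : exists2 l, l \in [set i | `[< fixed (e i) >]]%SET & l != i.
  by have [ji|ji] := eqVneq j i; [exists k => //; rewrite -ji eq_sym | exists j].
move: lF; rewrite !inE => fix_l; exists (e l); split => //.
  by apply/eX; exists l.
by rewrite -ei => /e_inj/eqP; rewrite (negPf li).
Qed.
End FixedPoints.

(** Lagrange's theorem, read off the faithful action of G on itself. *)
Lemma finite_group_expn (G : groupType) n (x : G) : has_card G n -> (x ^+ n = 1)%g.
Proof.
move=> Gn; have [e e_inj eX] := card_enum Gn.
pose act (g h : G) := (g * h)%g.
have act1 y : act 1%g y = y by exact: mul1g.
have actM g h y : act (g * h)%g y = act g (act h y) by rewrite /act mulgA.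
have stable g i : exists j, e j = act g (e i) by apply/eX.
pose phi := act_perm act1 actM e_inj stable.
have phi_inj : injective phi.
  move=> g h gh; have [i _] : exists i, e i = 1%g by apply/eX.
  have := congr1 (fun s : {perm 'I_n} => e (s i)) gh.
  by rewrite !act_permE => /mulIg.
have cardH : #|act_group act1 actM e_inj stable| = n.
  rewrite -[RHS]card_ord -(card_imset _ (inj_comp phi_inj e_inj)).
  apply: eq_card => s; rewrite inE; apply/asboolP/imsetP => [[g <-]|[i _ ->]].
    by have /eX [i <-] : [set: G] g by []; exists i.
  by exists (e i).
have phi_x : phi x \in act_group act1 actM e_inj stable by rewrite !inE; exists x.
by apply: phi_inj; have := expg_cardG phi_x; rewrite cardH /phi act_permX act_perm1.
Qed.

(** * Discrete p-toral groups *)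

(** Of the structure of the identity component N, only commutativity and the finiteness
    of its subgroups of bounded exponent are kept: they suffice to count fixed points
    and for the descending chain condition. *)
Record toral_structure (p : nat) (S : groupType) (N : normal_subgroup S) : Prop :=
  ToralStructure {
  toral_torsion : torsion p S;
  toral_comm : forall x y, sg_set N x -> sg_set N y -> (x * y = y * x)%g;
  toral_omega : forall n, finite_set [set x | sg_set N x /\ (x ^+ (p ^ n) = 1)%g];
  toral_quotient : finite_set [set: quotient_group N] }.

Lemma QZ_torsion_finite n : (0 < n)%N -> finite_set [set q : QZ | (q *+ n = 0)%R].
Proof.
move=> n0.
apply: (@sub_finite_set _ _
  [set (quot_proj integers (m%:R / n%:R))%R | m in `I_n]); last first.
  exact/finite_image/finite_II.
move=> q /=; have [a <-] := quot_proj_surj q.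
rewrite -raddfMn => /quot_proj_eq0 /= /intrP [m am].
have nR : (n%:R != 0 :> rat)%R by rewrite pnatr_eq0 -lt0n.
have aE : (a = m%:~R / n%:R)%R by rewrite -am -(mulr_natr a) mulfK.
have r0 : (0 <= (m %% n%:Z)%Z)%R by rewrite modz_ge0 // -lt0n.
have rn : ((m %% n%:Z)%Z < n%:Z)%R by rewrite ltz_pmod.
exists `|(m %% n%:Z)%Z|%N => /=; first by rewrite -ltz_nat gez0_abs.
apply/subr0_eq; rewrite -raddfB; apply/quot_proj_eq0 => /=.
have mE : (m%:~R = (m %/ n)%Z%:~R * n%:R + (m %% n)%Z%:~R :> rat)%R.
  by rewrite {1}(divz_eq m n) intrD intrM.
rewrite aE mE natr_absz ger0_norm // mulrDl mulfK // opprD addrCA subrr addr0.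
by rewrite rpredN intr_int.
Qed.

Lemma prufer_omega_finite p r n : prime p ->
  finite_set [set u : {ffun 'I_r -> prufer p} | (u *+ (p ^ n) = 0)%R].
Proof.
move=> p_pr.
have B_fin : finite_set [set q : prufer p | (q *+ (p ^ n) = 0)%R].
  have pn0 : (0 < p ^ n)%N by rewrite expn_gt0 prime_gt0.
  have V_fin := sub_finite_set _ (QZ_torsion_finite pn0).
  rewrite -(eq_finite_set (inj_card_eq (f := val) (in2W val_inj))).
  apply: V_fin => _ [q /= q0 <-].
  by rewrite -(raddfMn (val : {additive prufer p -> QZ})) q0 raddf0.
have [m Bm] := (finite_setP _).1 B_fin; have [e _ eB] := card_enum Bm.
pose F (g : {ffun 'I_r -> 'I_m}) : {ffun 'I_r -> prufer p} := [ffun i => e (g i)].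
apply: (@sub_finite_set _ _ (F @` setT)); last exact/finite_image/finite_finset.
move=> u /= u0.
have uB i : {j | e j = u i}.
  apply/cid/eB => /=.
  by have := congr1 (fun v : {ffun 'I_r -> prufer p} => v i) u0; rewrite ffunMnE ffunE.
exists [ffun i => sval (uB i)] => //; apply/ffunP => i; rewrite /F !ffunE.
exact: svalP (uB i).
Qed.

Lemma discrete_p_toral_structure p S : prime p -> discrete_p_toral p S ->
  exists N : normal_subgroup S, toral_structure p N.
Proof.
move=> p_pr [N [r [[f [f_bij fM]] [k Qk]]]]; exists N.
have f_inj := bij_inj f_bij.
have f1 : f 1%g = 0%R.
  by apply/(addrI (f 1%g)); rewrite -fM mulg1 addr0.
have fX x n : f (x ^+ n)%g = (f x *+ n)%R.
  by elim: n => [|n IH]; rewrite ?f1 // expgS mulrS fM IH.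
split.
- have cosX (x : S) n : coset N (x ^+ n)%g = (coset N x ^+ n)%g.
    by elim: n => [|n IH] //; rewrite !expgS cosetM IH.
  move=> x; have : coset N (x ^+ (p ^ k))%g = coset N 1%g.
    by rewrite cosX; exact: finite_group_expn Qk.
  move=> /esym/coset_eq; rewrite /same_coset invg1 mul1g => Nx.
  pose u := f (sg_mk Nx).
  have tors i : exists l, (u i *+ (p ^ l) = 0)%R.
    by have [l hl] := sub_zmodP (u i); exists l; apply/val_inj;
      rewrite (raddfMn (val : {additive prufer p -> QZ})) hl.
  have [l lE] := choice tors.
  exists (k + \sum_i l i)%N; rewrite expnD expgM.
  have : (sg_mk Nx ^+ (p ^ (\sum_i l i)) = 1)%g.
    apply: f_inj; rewrite fX f1; apply/ffunP => i.
    rewrite ffunMnE [RHS]ffunE (bigD1 i) //= expnD mulrnA.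
    by rewrite lE mul0rn.
  move/(congr1 val); set m := (p ^ (\sum_i l i))%N.
  have -> : val (sg_mk Nx ^+ m)%g = ((x ^+ (p ^ k)) ^+ m)%g.
    by elim: (m) => [|j IH] //; rewrite !expgS -IH.
  by [].
- move=> x y Nx Ny; apply: (congr1 val (_ : sg_mk Nx * sg_mk Ny = sg_mk Ny * sg_mk Nx)%g).
  by apply: f_inj; rewrite !fM addrC.
- move=> n; have [g fK gK] := f_bij.
  apply: (@sub_finite_set _ _ [set val (g u) |
      u in [set u : {ffun 'I_r -> prufer p} | (u *+ (p ^ n) = 0)%R]]); last first.
    exact/finite_image/prufer_omega_finite.
  move=> x /= [Nx xn]; exists (f (sg_mk Nx)); last by rewrite fK.
  rewrite -fX -f1; congr (f _); apply/val_inj; rewrite /= -[RHS]xn.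
  by elim: (p ^ n)%N => [|j IH] //; rewrite !expgS -IH.
- by apply/finite_setP; exists (p ^ k)%N.
Qed.

Lemma torsion_subgroup p (S : groupType) (P : subgroup S) :
  torsion p S -> torsion p (sg_type P).
Proof.
move=> Sp x; have [k xk] := Sp (val x); exists k; apply/val_inj; rewrite /= -[RHS]xk.
by elim: (p ^ k)%N => [|j IH] //; rewrite !expgS -IH.
Qed.

(** The inverse of an element of finite order is one of its powers. *)
Lemma torsion_normalizer p (S : groupType) (P : subgroup S) g :
  prime p -> torsion p S -> (forall x, sg_set P x -> sg_set P (lconj g x)) ->
  sg_set (normalizer P) g.
Proof.
move=> p_pr Sp gP x; split; first exact: gP.
have gX n y : sg_set P y -> sg_set P (lconj (g ^+ n)%g y).
  elim: n => [|n IH] Py; first by rewrite expg0 lconj1g.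
  by rewrite expgS lconjMl; exact/gP/IH.
have [k gk] := Sp g; move=> /(gX (p ^ k).-1).
suff -> : (g ^+ (p ^ k).-1 = g^-1)%g by rewrite lconjK.
apply: (mulgI g); rewrite mulgV -expgS prednK // expn_gt0.
by rewrite prime_gt0.
Qed.

Section NormalizerGrowth.
Variables (p : nat) (S : groupType).
Hypotheses (p_prime : prime p) (S_torsion : torsion p S).

Definition left_coset (P : subgroup S) (r : S) : set S :=
  [set y | sg_set P (r^-1 * y)%g].

Lemma left_coset_eq P r s : left_coset P r = left_coset P s <-> sg_set P (r^-1 * s)%g.
Proof.
split=> [rs|Prs].
  have : left_coset P s s by rewrite /left_coset /= mulVg; exact: sg1.
  by rewrite -rs.
apply/seteqP; split=> y /= Py.
  by have := sgM (sgV Prs) Py; rewrite invgM invgK !mulgA mulgK.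
by have := sgM Prs Py; rewrite !mulgA mulgK.
Qed.

Definition translate (H : subgroup S) (g : sg_type H) (X : set S) : set S :=
  [set y | X ((val g)^-1 * y)%g].

Lemma translate_coset H (g : sg_type H) P r :
  translate g (left_coset P r) = left_coset P (val g * r)%g.
Proof. by apply/funext => y; rewrite /translate /left_coset /= invgM mulgA. Qed.

Lemma translate1 H X : translate (1%g : sg_type H) X = X.
Proof. by apply/funext => y; rewrite /translate /= invg1 mul1g. Qed.

Lemma translateM H (g h : sg_type H) X :
  translate (g * h)%g X = translate g (translate h X).
Proof. by apply/funext => y; rewrite /translate /= invgM mulgA. Qed.

(** P and R both act on the finite set of cosets r P with r in R.  A coset fixed by R
    would put R inside P, so p divides the number of cosets; hence P, which fixes the
    coset P, fixes another coset r P, and r^-1 normalizes P. *)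
Lemma normalizer_grows_in (P R : subgroup S) :
  (forall x r, sg_set P x -> sg_set R r -> sg_set R (lconj x r)) ->
  finite_set (left_coset P @` R) -> ~ (R `<=` P) ->
  exists g, [/\ sg_set R g, ~ sg_set P g & sg_set (normalizer P) g].
Proof.
move=> PR /finite_setP [n Xn] /existsNP [r0 /not_implyP [Rr0 nPr0]].
have p_n : p %| n.
  apply: (dvdn_no_fixed_point p_prime (torsion_subgroup (P := R) S_torsion)
    (@translate1 R) (@translateM R) Xn).
    move=> g _ [r Rr <-]; rewrite translate_coset; exists (val g * r)%g => //.
    by apply: sgM => //; exact: sg_typeP.
  move=> _ [r Rr <-] /(_ (sg_mk Rr * sg_mk Rr0 * (sg_mk Rr)^-1)%g).
  rewrite translate_coset /= mulgVK => /esym/left_coset_eq.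
  by rewrite mulgA mulVg mul1g.
have stP (g : sg_type P) X : (left_coset P @` R) X -> (left_coset P @` R) (translate g X).
  move=> [r Rr <-]; rewrite translate_coset; exists (lconj (val g) r).
    by apply: PR => //; exact: sg_typeP.
  apply/left_coset_eq; rewrite /lconj !invgM invgK !mulgA mulgVK mulgVK.
  exact: sg_typeP.
have X1 : (left_coset P @` R) (left_coset P 1%g) by exists 1%g => //; exact: sg1.
have fix1 (g : sg_type P) : translate g (left_coset P 1%g) = left_coset P 1%g.
  rewrite translate_coset mulg1; apply/left_coset_eq; rewrite mulg1.
  exact/sgV/sg_typeP.
have [_ [[r Rr <-] fix_r r1]] := second_fixed_point p_prime
  (torsion_subgroup (P := P) S_torsion) (@translate1 P) (@translateM P) Xn stP X1 fix1 p_n.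
exists (r^-1)%g; split; first exact: sgV.
  by move=> Pr; apply: r1; apply/left_coset_eq; rewrite mulg1.
apply: (torsion_normalizer p_prime S_torsion) => x Px.
have := fix_r (sg_mk Px); rewrite translate_coset => /esym/left_coset_eq.
by rewrite /lconj invgK mulgA.
Qed.

Variable N : normal_subgroup S.
Hypothesis N_toral : toral_structure p N.

Lemma toral_expgM x y n : sg_set N x -> sg_set N y ->
  ((x * y) ^+ n = x ^+ n * y ^+ n)%g.
Proof. by move=> Nx Ny; apply: expgMn; exact: (toral_comm N_toral). Qed.

Definition omega_in (Q : subgroup S) (n : nat) : subgroup S.
Proof.
refine (@Subgroup S [set x | [/\ sg_set Q x, sg_set N x & (x ^+ (p ^ n) = 1)%g]] _ _ _).
- by split; [exact: sg1 | exact: sg1 | exact: expg1n].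
- move=> x y [Qx Nx xn] [Qy Ny yn]; split; [exact: sgM | exact: sgM |].
  by rewrite toral_expgM // xn yn mulg1.
- move=> x [Qx Nx xn]; split; [exact: sgV | exact: sgV |].
  by rewrite expVgn xn invg1.
Defined.

(** The lemma above applies with R = Q if Q meets N inside P, as P then has finite
    index in Q; otherwise with R the elements of exponent p^n of the intersection of Q
    and N, for n large. *)
Theorem normalizer_grows (P Q : subgroup S) : P `<=` Q -> ~ (Q `<=` P) ->
  exists g, [/\ sg_set Q g, ~ sg_set P g & sg_set (normalizer P) g].
Proof.
move=> PQ nQP.
have [NQP|] := pselect (forall x, sg_set Q x -> sg_set N x -> sg_set P x).
  apply: (@normalizer_grows_in P Q) => // [x r /PQ Qx Qr|].
    by apply: sgM; [exact: sgM | exact: sgV].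
  pose F (c : quotient_group N) : set S :=
    [set y | exists2 r, sg_set Q r /\ coset N r = c & left_coset P r y].
  apply: (@sub_finite_set _ _ (F @` [set: quotient_group N])).
    move=> _ [r Qr <-]; exists (coset N r) => //.
    apply/seteqP; split=> [y [s [Qs /coset_eq Nsr]]|y Py]; last by exists r.
    suff -> : left_coset P s = left_coset P r by [].
    by apply/left_coset_eq/NQP => //; apply: sgM => //; exact: sgV.
  exact/finite_image/(toral_quotient N_toral).
move=> /existsNP [y /not_implyP [Qy /not_implyP [Ny nPy]]].
have [n yn] := S_torsion y.
have [g [[Qg _ _] nPg Ng]] : exists g,
    [/\ sg_set (omega_in Q n) g, ~ sg_set P g & sg_set (normalizer P) g].
  apply: normalizer_grows_in => [x r /PQ Qx [Qr Nr rn]||].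
  - split; [by apply: sgM; [exact: sgM | exact: sgV] | exact: nsg_normal |].
    have lconjX m : (lconj x r ^+ m = lconj x (r ^+ m))%g.
      by elim: m => [|m IH]; rewrite ?lconjg1 // !expgS lconjMr IH.
    by rewrite lconjX rn lconjg1.
  - apply/finite_image/(sub_finite_set _ (toral_omega N_toral n)).
    by move=> x [_ Nx xn].
  - by move=> /(_ y) /= yP; apply: nPy; exact: yP.
by exists g.
Qed.

Lemma chain_le (T : Type) (X : nat -> set T) : (forall i, X i.+1 `<=` X i) ->
  forall i j, (i <= j)%N -> X j `<=` X i.
Proof.
move=> Xdec i j /subnKC <-; elim: (j - i)%N => [|k IH]; first by rewrite addn0.
by rewrite addnS => x /Xdec; exact: IH.
Qed.

(** It suffices to take X i of least cardinality. *)
Lemma finite_chain_stable (T : Type) (X : nat -> set T) : finite_set (X 0%N) ->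
  (forall i, X i.+1 `<=` X i) -> exists i, forall j, (i <= j)%N -> X i `<=` X j.
Proof.
move=> /finite_setP [n /card_enum [e e_inj eX]] Xdec.
have Xle := chain_le Xdec.
pose m i := [set k | `[< X i (e k) >]]%SET.
have mX i k : (k \in m i) = `[< X i (e k) >] by rewrite !inE.
have [i0 /asboolP i0E i0min] : exists2 i0, `[< exists i, #|m i| = i0 >]
    & forall j, `[< exists i, #|m i| = j >] -> (i0 <= j)%N.
  have ex : exists j, `[< exists i, #|m i| = j >].
    by exists #|m 0%N|; apply/asboolP; exists 0%N.
  by case: (ex_minnP ex) => j hj jmin; exists j.
have [i iE] := i0E; exists i => j ij x Xx.
have [k ek] := (eX x).1 (Xle 0%N i (leq0n _) x Xx).
have mij : m j \subset m i.
  by apply/fintype.subsetP => l; rewrite !mX => /asboolP h; apply/asboolP; exact: Xle h.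
have /eqP mE : m j == m i.
  by rewrite eqEcard mij iE i0min //; apply/asboolP; exists j.
have : k \in m i by rewrite mX; apply/asboolP; rewrite ek.
by rewrite -mE mX ek => /asboolP.
Qed.

(** The elements of order dividing p in p^k B, in additive notation, where B is the
    intersection of A and N. *)
Definition layer (A : subgroup S) (k : nat) : set S :=
  [set x | (x ^+ p = 1)%g /\ exists2 a, sg_set A a /\ sg_set N a & (a ^+ (p ^ k) = x)%g].

(** The layers and the image in the quotient by N determine a subgroup among its
    overgroups: for b in B and N of exponent p^(n+1), the layer of index n provides an a
    in A with the same p^n-th power, so that b and a differ by an element of exponent
    p^n. *)
Lemma toral_layers (A B : subgroup S) : A `<=` B ->
  (forall k, layer B k `<=` layer A k) -> coset N @` B `<=` coset N @` A -> B `<=` A.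
Proof.
move=> AB layers cosets.
have BN n b : sg_set B b -> sg_set N b -> (b ^+ (p ^ n) = 1)%g -> sg_set A b.
  elim: n b => [|n IH] b Bb Nb bn.
    by move: bn; rewrite expn0 expg1 => ->; exact: sg1.
  have [_ [a [Aa Na] ab]] : layer A n (b ^+ (p ^ n))%g.
    by apply: layers; split; [rewrite -expgM -expnSr | exists b].
  have -> : b = (a * (a^-1 * b))%g by rewrite mulgA mulgV mul1g.
  apply: sgM => //; apply: IH.
  - by apply: sgM => //; apply: sgV; exact: AB.
  - by apply: sgM => //; apply: sgV.
  - by rewrite toral_expgM ?expVgn ?ab ?mulVg //; exact: sgV.
move=> b Bb; have [a Aa /coset_eq Nab] : (coset N @` A) (coset N b).
  by apply: cosets; exists b.
have -> : b = (a * (a^-1 * b))%g by rewrite mulgA mulgV mul1g.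
apply: sgM => //; have [n hn] := S_torsion (a^-1 * b)%g.
by apply: (BN n) => //; apply: sgM => //; apply: sgV; exact: AB.
Qed.

(** The layers decrease both in the index i of the chain and in k, inside a finite set.
    Once the diagonal is stationary at i0, the layers with i, k >= i0 are all equal,
    being between two diagonal ones; the layers with k < i0 are finitely many decreasing
    sequences of finite sets. *)
Theorem toral_dcc (A : nat -> subgroup S) : (forall i, A i.+1 `<=` A i) ->
  exists i, A i `<=` A i.+1.
Proof.
move=> Adec.
have layer_fin B k : finite_set (layer B k).
  apply: sub_finite_set (toral_omega N_toral 1) => x /= [xp [a [Aa Na] ax]].
  split; last by rewrite expn1.
  rewrite -ax {ax}.
  by elim: (p ^ k)%N => [|n IH]; [exact: sg1 | rewrite expgS; exact: sgM].
have layerS B k : layer B k.+1 `<=` layer B k.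
  move=> x [xp [a [Ba Na] ax]]; split => //; exists (a ^+ p)%g.
    have pw (H : subgroup S) n : sg_set H a -> sg_set H (a ^+ n)%g.
      by move=> Ha; elim: n => [|n IH]; [exact: sg1 | rewrite expgS; exact: sgM].
    by split; exact: pw.
  by rewrite -expgM -expnS.
have layerA (B B' : subgroup S) k : B `<=` B' -> layer B k `<=` layer B' k.
  by move=> BB' x [xp [a [Ba Na] ax]]; split => //; exists a => //; split => //; exact: BB'.
have Ale := chain_le Adec.
have layer_le B := chain_le (layerS B).
have [i0 diag] := finite_chain_stable (X := fun i => layer (A i) i) (layer_fin _ _)
  (fun i x h => layerA _ _ _ (Adec i) _ (layerS _ _ _ h)).
have [i1 cosets] : exists i, forall j, (i <= j)%N -> coset N @` A i `<=` coset N @` A j.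
  apply: finite_chain_stable => [|i]; last exact/image_subset.
  exact: sub_finite_set (toral_quotient N_toral).
have [i2 low] : exists i, forall k j, (k < i0)%N -> (i <= j)%N ->
    layer (A i) k `<=` layer (A j) k.
  elim: (i0) => [|m [i hi]]; first by exists 0%N.
  have [i' hi'] := finite_chain_stable (X := fun i => layer (A i) m) (layer_fin _ _)
    (fun i => layerA _ _ _ (Adec i)).
  exists (maxn i i') => k j; rewrite ltnS leq_eqVlt geq_max => /orP[/eqP -> | km] /andP[ij i'j].
    by move=> x /(layerA _ _ _ (Ale _ _ (leq_maxr i i'))); exact: hi'.
  by move=> x /(layerA _ _ _ (Ale _ _ (leq_maxl i i'))); exact: hi.
pose i := maxn i0 (maxn i1 i2).
have i0i : (i0 <= i)%N by exact: leq_maxl.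
have i1i : (i1 <= i)%N by rewrite /i !leq_max leqnn orbT.
have i2i : (i2 <= i)%N by rewrite /i !leq_max leqnn !orbT.
exists i; apply: toral_layers => //.
- move=> k; have [k_lt|k_ge] := ltnP k i0.
    move=> x /(layerA _ _ _ (Ale _ _ i2i)); apply: low => //.
    exact: leq_trans i2i (leqnSn i).
  move=> x /(layerA _ _ _ (Ale _ _ i0i)) /(layer_le _ _ _ k_ge).
  have j_ge : (i0 <= maxn i.+1 k)%N by rewrite leq_max k_ge orbT.
  move=> /(diag _ j_ge) /(layer_le _ _ _ (leq_maxr i.+1 k)).
  exact: (layerA _ _ _ (Ale _ _ (leq_maxl i.+1 k))).
- move=> c /(@image_subset _ _ (coset N) _ _ (Ale _ _ i1i)).
  exact: (cosets _ (leq_trans i1i (leqnSn i))).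
Qed.

(** The images of the iterates of f form a descending chain. *)
Theorem injective_endo_surjective (P : subgroup S) (f : sg_type P -> sg_type P) :
  {morph f : x y / (x * y)%g} -> injective f -> forall y, exists x, f x = y.
Proof.
move=> fM f_inj.
have f1 : f 1%g = 1%g by apply: (mulgI (f 1%g)); rewrite -fM !mulg1.
have fV x : f x^-1%g = (f x)^-1%g by apply: (mulgI (f x)); rewrite -fM !mulgV.
have A i : {B : subgroup S | forall y, sg_set B y <-> exists x, val (iter i f x) = y}.
  have it1 : iter i f 1%g = 1%g by elim: (i) => //= j ->.
  have itM x y : iter i f (x * y)%g = (iter i f x * iter i f y)%g.
    by elim: (i) => //= j ->; exact: fM.
  have itV x : iter i f x^-1%g = (iter i f x)^-1%g by elim: (i) => //= j ->.
  have s1 : exists x, val (iter i f x) = 1%g by exists 1%g; rewrite it1.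
  have sM y z : (exists x, val (iter i f x) = y) -> (exists x, val (iter i f x) = z) ->
      exists x, val (iter i f x) = (y * z)%g.
    by move=> [u <-] [v <-]; exists (u * v)%g; rewrite itM.
  have sV y : (exists x, val (iter i f x) = y) -> exists x, val (iter i f x) = y^-1%g.
    by move=> [u <-]; exists u^-1%g; rewrite itV.
  by exists (@Subgroup S [set y | exists x, val (iter i f x) = y] s1 sM sV).
have [i hi] := toral_dcc (A := fun i => sval (A i)) (fun i y h =>
  (svalP (A i) y).2 (let: ex_intro x e := (svalP (A i.+1) y).1 h in
    ex_intro _ (f x) (etrans (congr1 val (esym (iterSr i f x))) e))).
move=> y; have : sg_set (sval (A i)) (val (iter i f y)) by apply/(svalP (A i)); exists y.
move=> /hi /(svalP (A i.+1)) [x /val_inj]; rewrite iterSr => e; exists x.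
have it_inj : injective (iter i f) by elim: (i) => [|j IH] a b //= /f_inj/IH.
exact: it_inj.
Qed.
End NormalizerGrowth.

(** * Morphisms of a transporter system *)

Lemma is_iso_of_sides Ob (C : category Ob) x y (f : mor C x y) (g h : mor C y x) :
  g \oc f = idmor C x -> f \oc h = idmor C y -> is_iso f.
Proof.
move=> gf fh; exists g; split => //.
have -> : g = h by rewrite -[g]compm1 -fh compmA gf comp1m.
exact: fh.
Qed.

Section Transporter.
Variables (p : nat) (S : groupType) (F : fusion_system S) (T : transporter_system p F).
Hypotheses (p_prime : prime p) (S_torsion : torsion p S).

Notation C := (ts_cat T).
Notation O := (orbit_cat T).
Notation ob := (ts_object T).
Notation "'eps' f" := (fmap (ts_eps T) f) (at level 10, f at level 9).

Definition rho (P Q : ob) (a : mor C P Q) : sg_type (sval P) -> sg_type (sval Q) :=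
  sval (fmap (ts_rho T) a).

Lemma rho_comp (P Q R : ob) (b : mor C Q R) (a : mor C P Q) x :
  rho (b \oc a) x = rho b (rho a x).
Proof. by rewrite /rho fmap_comp. Qed.

Lemma rho_id (P : ob) x : rho (idmor C P) x = x.
Proof. by rewrite /rho fmap_id. Qed.

Lemma rho_inj (P Q : ob) (a : mor C P Q) : injective (rho a).
Proof. exact: (fs_inj (svalP (fmap (ts_rho T) a))). Qed.

Lemma rho_mul (P Q : ob) (a : mor C P Q) : {morph rho a : x y / (x * y)%g}.
Proof. exact: (fs_mul (svalP (fmap (ts_rho T) a))). Qed.

Lemma rho_eps (P Q : ob) (g : mor (transporter_cat (ts_ob T)) P Q) x :
  val (rho (eps g) x) = lconj (sval g) (val x).
Proof. exact: ts_rho_eps. Qed.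

Lemma rho_lift (P Q : ob) (f : sg_type (sval P) -> sg_type (sval Q)) :
  fs_hom F f -> exists a : mor C P Q, rho a =1 f.
Proof.
move=> hf; have [a aE] := @ts_rho_surj _ _ _ T P Q (exist _ f hf).
by exists a => x; rewrite /rho aE.
Qed.

Lemma rho_fiber (P Q : ob) (a b : mor C P Q) : rho a =1 rho b ->
  exists2 e : aut C P, functor_kernel (ts_rho T) e & b = a \oc aut_fwd e.
Proof. by move=> ab; apply/ts_rho_orbit; exact: fusion_mor_eq. Qed.

(** Homomorphisms in the fusion system are injective, so c and d differ by an element
    of the kernel of rho, and this kernel acts freely on morphisms. *)
Lemma ts_mono (P Q R : ob) (b : mor C Q R) (c d : mor C P Q) :
  b \oc c = b \oc d -> c = d.
Proof.
move=> e; have [x|k kk dE] := @rho_fiber P Q c d.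
  by apply: (@rho_inj _ _ b); rewrite -!rho_comp e.
move: e; rewrite dE compmA => /esym/(ts_free_right kk) ->.
by rewrite /= compm1.
Qed.

(** Both composites of a and b lift identities, so they lie in the kernels of rho, which
    consist of automorphisms. *)
Lemma is_iso_of_rho_id (P Q : ob) (a : mor C P Q) (b : mor C Q P) :
  cancel (rho a) (rho b) -> cancel (rho b) (rho a) -> is_iso a.
Proof.
move=> ab ba.
have [x|e _ eE] := @rho_fiber P P (idmor C P) (b \oc a).
  by rewrite rho_comp ab rho_id.
have [x|d _ dE] := @rho_fiber Q Q (idmor C Q) (a \oc b).
  by rewrite rho_comp ba rho_id.
apply: (@is_iso_of_sides _ C _ _ a (aut_bwd e \oc b) (b \oc aut_bwd d)).
  by rewrite -compmA eE comp1m aut_bf.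
by rewrite compmA dE comp1m aut_fb.
Qed.

(** The factorization in the fusion system through the image lifts to the transporter
    system, where the kernel of rho corrects the choice of the lift. *)
Lemma ts_factor (P Q : ob) (a : mor C P Q) :
  exists (R : ob) (RQ : sval R `<=` sval Q) (a' : mor C P R),
    [/\ a = eps (tr_incl RQ) \oc a', is_iso a'
      & forall y, sg_set (sval R) y <-> exists x, val (rho a x) = y].
Proof.
have [R0 [f [g [i [hf hg [fg gf] iE fE]]]]] := fs_factor (svalP (fmap (ts_rho T) a)).
have R0T : ts_ob T R0.
  apply: (ts_conj (svalP P)); exists (exist _ f hf), (exist _ g hg).
  by split; apply: fusion_mor_eq => x; [exact: fg | exact: gf].
pose R : ob := exist _ R0 R0T.
have RQ : sval R `<=` sval Q.
  by move=> y Ry; have := sg_typeP (i (sg_mk Ry)); rewrite iE.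
have [a0 a0E] := @rho_lift P R f hf; have [b0 b0E] := @rho_lift R P g hg.
have [x|e _ eE] := @rho_fiber P Q (eps (tr_incl RQ) \oc a0) a.
  by apply/val_inj; rewrite rho_comp rho_eps lconj1g a0E /rho fE /= iE.
exists R, RQ, (a0 \oc aut_fwd e); split.
- by rewrite compmA.
- have [b [ba ab]] : is_iso a0.
    by apply: (@is_iso_of_rho_id _ _ _ b0) => x; rewrite a0E b0E ?fg ?gf.
  exists (aut_bwd e \oc b); split.
    by rewrite -compmA (compmA b) ba comp1m aut_bf.
  by rewrite -compmA (compmA (aut_fwd e)) aut_fb comp1m.
- move=> y; split=> [Ry|[x <-]]; last first.
    by rewrite /rho fE /= iE; exact: sg_typeP.
  exists (g (sg_mk Ry)).
  by have -> : rho a = i \o f := fE; rewrite /= gf iE.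
Qed.

Lemma is_iso_of_rho_surj (P Q : ob) (a : mor C P Q) :
  (forall y, exists x, rho a x = y) -> is_iso a.
Proof.
move=> a_surj; have [R [RQ [a' [aE [b [ba ab]] RE]]]] := ts_factor a.
have QR : sval Q `<=` sval R.
  by move=> y Qy; have [x e] := a_surj (sg_mk Qy); apply/RE; exists x; rewrite e.
apply: (@is_iso_of_sides _ C _ _ a (b \oc eps (tr_incl QR)) (b \oc eps (tr_incl QR))).
  rewrite aE -compmA (compmA (eps _)) -fmap_comp.
  rewrite (_ : _ \oc _ = idmor (transporter_cat (ts_ob T)) R) ?fmap_id ?comp1m //.
  by apply: tr_eq; rewrite /= mulg1.
rewrite aE -compmA (compmA a') ab comp1m -fmap_comp.
rewrite (_ : _ \oc _ = idmor (transporter_cat (ts_ob T)) Q) ?fmap_id //.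
by apply: tr_eq; rewrite /= mulg1.
Qed.

Lemma eps_norm_incl (P L : ob) (PL : sval P `<=` sval L)
    (g : sg_type (normalizer (sval P))) (h : sg_type (sval L)) : val h = val g ->
  eps (tr_incl PL) \oc eps (tr_norm (P := P) g) = eps (tr_elt h) \oc eps (tr_incl PL).
Proof.
by move=> hg; rewrite -!fmap_comp; congr fmap; apply: tr_eq; rewrite /= mul1g mulg1 hg.
Qed.

Lemma eps_eltM (P : ob) (g h : sg_type (sval P)) :
  eps (tr_elt (P := P) (g * h)%g) = eps (tr_elt g) \oc eps (tr_elt h).
Proof. by rewrite -fmap_comp; congr fmap; exact: tr_eq. Qed.

Lemma eps_elt1 (P : ob) : eps (tr_elt (P := P) 1%g) = idmor C P.
Proof. by rewrite -(fmap_id (ts_eps T)); congr fmap; exact: tr_eq. Qed.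

(** An element z that fixes a centralizes the image R' of a, so it restricts to an
    automorphism of R', which is trivial because a is an isomorphism onto R'. *)
Lemma eps_free (P R : ob) (a : mor C P R) (z : sg_type (sval R)) :
  eps (tr_elt z) \oc a = a -> z = 1%g.
Proof.
move=> za; have [R' [R'R [a' [aE [b [_ ab]] R'E]]]] := ts_factor a.
have z_cent y : sg_set (sval R') y -> lconj (val z) y = y.
  move=> /R'E [x <-].
  by have := congr1 (fun c => val (rho c x)) za; rewrite rho_comp rho_eps.
have z_tr : transporter_set (sval R') (sval R') (val z).
  by move=> y R'y; rewrite z_cent.
pose z' : mor (transporter_cat (ts_ob T)) R' R' := exist _ (val z) z_tr.
have z'a : eps z' \oc a' = a'.
  apply: (@ts_mono _ _ _ (eps (tr_incl R'R))); rewrite compmA -aE -[RHS]za aE compmA.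
  by rewrite -!fmap_comp; congr (fmap _ _ \oc _); apply: tr_eq; rewrite /= mul1g mulg1.
have : eps z' = eps (idmor (transporter_cat (ts_ob T)) R').
  by rewrite fmap_id -[LHS]compm1 -ab compmA z'a.
by move=> /ts_eps_inj /(congr1 sval) /= z1; apply/val_inj.
Qed.

(** For g in L, moving g past the inclusion and past c or d shows that the elements
    rho c g and rho d g act in the same way on the common restriction to P; so they are
    equal.  Then c and d differ by an element of the kernel of rho that fixes the
    inclusion of P in L, and left freeness applies to it. *)
Lemma ts_epi_normal (P L R : ob) (PL : sval P `<=` sval L) (c d : mor C L R) :
  sval L `<=` normalizer (sval P) ->
  c \oc eps (tr_incl PL) = d \oc eps (tr_incl PL) -> c = d.
Proof.
move=> LN cd.
have push (a : mor C L R) (g : sg_type (sval L)) (Ng : sg_set (normalizer (sval P)) (val g)) :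
    (a \oc eps (tr_incl PL)) \oc eps (tr_norm (P := P) (sg_mk Ng)) =
    eps (tr_elt (rho a g)) \oc (a \oc eps (tr_incl PL)).
  by rewrite -compmA (@eps_norm_incl _ _ _ _ g) // compmA ts_push -compmA.
have [g|e ke dE] := @rho_fiber L R c d.
  have Ng := LN _ (sg_typeP g).
  have : eps (tr_elt ((rho d g)^-1 * rho c g)%g) \oc (c \oc eps (tr_incl PL)) =
      c \oc eps (tr_incl PL).
    rewrite eps_eltM -compmA -(push c g Ng) cd (push d g Ng) compmA -eps_eltM.
    by rewrite mulVg eps_elt1 comp1m.
  by move=> /eps_free /(congr1 (fun z => (rho d g * z)%g)); rewrite mulgA mulgV mul1g mulg1.
suff -> : d = c \oc aut_fwd (1%g : aut C L) by rewrite /= compm1.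
rewrite dE; congr (_ \oc aut_fwd _); apply: (ts_free_left ke (a := eps (tr_incl PL))).
by apply: (@ts_mono _ _ _ c); rewrite compmA -dE.
Qed.

(** The extension axiom applies to the isomorphism of P with the image R' of s, and to
    the normalizer of R' in R: the element r attached to g normalizes R', since s
    intertwines it with g. *)
Lemma ts_extend_normal (P L R : ob) (PL : sval P `<=` sval L) (s : mor C P R) :
  sval L `<=` normalizer (sval P) ->
  (forall g : sg_type (normalizer (sval P)), sg_set (sval L) (val g) ->
     exists r : sg_type (sval R), s \oc eps (tr_norm (P := P) g) = eps (tr_elt r) \oc s) ->
  exists s' : mor C L R, s' \oc eps (tr_incl PL) = s.
Proof.
move=> LN sL; have [R' [R'R [a [sE [b [ba ab]] R'E]]]] := ts_factor s.
pose Q0 : subgroup S := @Subgroup S (sval R `&` normalizer (sval R'))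
  (conj (sg1 _) (sg1 _))
  (fun x y hx hy => conj (sgM hx.1 hy.1) (sgM hx.2 hy.2))
  (fun x hx => conj (sgV hx.1) (sgV hx.2)).
have R'Q0 : sval R' `<=` Q0.
  move=> y R'y; split; first exact: (R'R y).
  by apply: (torsion_normalizer p_prime S_torsion); exact: transporter_set_self.
pose Q : ob := exist _ Q0 (ts_over (svalP R') R'Q0).
have QR : sval Q `<=` sval R by move=> y [].
have [|s' s'E] := @ts_extend _ _ _ T P R' L Q a b PL R'Q0 ba ab LN (fun y h => h.2).
  move=> g Lg; have [r rE] := sL g Lg.
  have Nr : sg_set (normalizer (sval R')) (val r).
    apply: (torsion_normalizer p_prime S_torsion) => _ /R'E [x <-]; apply/R'E.
    exists (rho (eps (tr_norm (P := P) g)) x).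
    by rewrite -rho_comp rE rho_comp rho_eps.
  exists (sg_mk Nr); first by split; [exact: sg_typeP | exact: Nr].
  have ag : a \oc eps (tr_norm (P := P) g) = eps (tr_norm (P := R') (sg_mk Nr)) \oc a.
    apply: (@ts_mono _ _ _ (eps (tr_incl R'R))).
    by rewrite compmA -sE rE compmA (@eps_norm_incl _ _ R'R _ r) // -compmA -sE.
  by rewrite ag -compmA ab compm1.
exists (eps (tr_incl QR) \oc s'); rewrite -compmA s'E sE compmA -fmap_comp.
by congr (fmap _ _ \oc _); apply: tr_eq; rewrite /= mulg1.
Qed.
End Transporter.

(** * The orbit category of a transporter system *)

Section TransporterOrbits.
Variables (p : nat) (S : groupType) (F : fusion_system S) (T : transporter_system p F).
Hypotheses (p_prime : prime p) (S_torsion : torsion p S).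

Notation C := (ts_cat T).
Notation O := (orbit_cat T).
Notation ob := (ts_object T).
Notation "'eps' f" := (fmap (ts_eps T) f) (at level 10, f at level 9).

Definition to_orbit (P Q : ob) (a : mor C P Q) : mor O P Q :=
  orbit_of (ts_orbit_datum T) a.

Lemma to_orbit_eq (P Q : ob) (a b : mor C P Q) :
  to_orbit a = to_orbit b <-> exists q : sg_type (sval Q), b = eps (tr_elt q) \oc a.
Proof.
rewrite /to_orbit orbit_of_eq; split=> [[_ [q _ <-] ->]|[q ->]]; first by exists q.
by exists (eps (tr_elt q)) => //; exists q.
Qed.

Lemma to_orbit_surj (P Q : ob) (f : mor O P Q) : exists a, f = to_orbit a.
Proof. exact: orbit_of_surj. Qed.

Lemma to_orbit_comp (P Q R : ob) (b : mor C Q R) (a : mor C P Q) :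
  to_orbit b \oc to_orbit a = to_orbit (b \oc a).
Proof. exact: orbit_compE. Qed.

Lemma to_orbit_iso (P Q : ob) (a : mor C P Q) : is_iso a -> is_iso (to_orbit a).
Proof.
move=> [b [ba ab]]; exists (to_orbit b).
by rewrite !to_orbit_comp ba ab.
Qed.

Lemma orbit_conj_isomorphic (P Q : ob) :
  F_conjugate F (sval P) (sval Q) -> isomorphic C P Q.
Proof.
move=> [f [g [gf fg]]].
have [a aE] := @rho_lift _ _ _ T P Q (sval f) (svalP f).
have [b bE] := @rho_lift _ _ _ T Q P (sval g) (svalP g).
have [x|x|c [ca ac]] := @is_iso_of_rho_id _ _ _ T P Q a b; last by exists a, c.
- by rewrite aE bE; exact: (congr1 (fun h => sval h x) gf).
- by rewrite aE bE; exact: (congr1 (fun h => sval h x) fg).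
Qed.

Section AutOrbit.
Variable P : ob.

Definition aut_orbit (a : aut C P) : aut O P.
Proof.
refine (@Aut _ O P (to_orbit (aut_fwd a)) (to_orbit (aut_bwd a)) _ _).
  by rewrite to_orbit_comp aut_fb.
by rewrite to_orbit_comp aut_bf.
Defined.

Lemma aut_orbitM a b : aut_orbit (a * b)%g = (aut_orbit a * aut_orbit b)%g.
Proof. by apply: aut_eq; exact: esym (to_orbit_comp _ _). Qed.

Lemma aut_orbit1 : aut_orbit 1%g = 1%g.
Proof. exact: aut_eq. Qed.

Lemma aut_orbitX a n : aut_orbit (a ^+ n)%g = (aut_orbit a ^+ n)%g.
Proof.
by elim: n => [|n IH]; [exact: aut_orbit1 | rewrite !expgS aut_orbitM IH].
Qed.

Lemma aut_orbitV a : aut_orbit a^-1%g = (aut_orbit a)^-1%g.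
Proof. by apply: (mulgI (aut_orbit a)); rewrite -aut_orbitM !mulgV aut_orbit1. Qed.

Definition eps_norm (g : sg_type (normalizer (sval P))) : aut C P.
Proof.
refine (@Aut _ C P (eps (tr_norm (P := P) g)) (eps (tr_norm (P := P) g^-1%g)) _ _).
- by rewrite -fmap_comp -(fmap_id (ts_eps T)); congr fmap; apply: tr_eq; exact: mulgV.
- by rewrite -fmap_comp -(fmap_id (ts_eps T)); congr fmap; apply: tr_eq; exact: mulVg.
Defined.

Lemma eps_normM g h : eps_norm (g * h)%g = (eps_norm g * eps_norm h)%g.
Proof. by apply: aut_eq; rewrite /= -fmap_comp; congr fmap; exact: tr_eq. Qed.

Lemma eps_norm1 : eps_norm 1%g = 1%g.
Proof. by apply: aut_eq; rewrite /= -(fmap_id (ts_eps T)); congr fmap; exact: tr_eq. Qed.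

Lemma eps_normX g n : eps_norm (g ^+ n)%g = (eps_norm g ^+ n)%g.
Proof.
by elim: n => [|n IH]; [exact: eps_norm1 | rewrite !expgS eps_normM IH].
Qed.

Lemma eps_normV g : eps_norm g^-1%g = (eps_norm g)^-1%g.
Proof. by apply: (mulgI (eps_norm g)); rewrite -eps_normM !mulgV eps_norm1. Qed.

Lemma sub_normalizer (Q : subgroup S) : Q `<=` normalizer Q.
Proof.
by move=> x Qx; apply: (torsion_normalizer p_prime S_torsion); exact: transporter_set_self.
Qed.

Lemma aut_orbit_eq1 a : aut_orbit a = 1%g <->
  exists2 g : sg_type (normalizer (sval P)), sg_set (sval P) (val g) & a = eps_norm g.
Proof.
split=> [/(congr1 (@aut_fwd _ _ _)) /esym /to_orbit_eq [q aE]|[g Pg ->]].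
  exists (sg_mk (sub_normalizer (sg_typeP q))); first exact: sg_typeP.
  apply: aut_eq; rewrite aE compm1 /=; congr fmap; exact: tr_eq.
apply/esym/aut_eq/to_orbit_eq; exists (sg_mk Pg).
by rewrite compm1 /=; congr fmap; exact: tr_eq.
Qed.

(** A representative of an invertible class is invertible, since it has inverses on
    both sides up to elements of P. *)
Lemma aut_orbit_surj (c : aut O P) : exists a, aut_orbit a = c.
Proof.
have [f fE] := to_orbit_surj (aut_fwd c); have [g gE] := to_orbit_surj (aut_bwd c).
have := aut_fb c; rewrite fE gE to_orbit_comp => /esym/to_orbit_eq [x xE].
have := aut_bf c; rewrite fE gE to_orbit_comp => /esym/to_orbit_eq [y yE].
rewrite compm1 in xE; rewrite compm1 in yE.
have inv (z : sg_type (sval P)) : eps (tr_elt z^-1%g) \oc eps (tr_elt z) = idmor C P.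
  by rewrite -eps_eltM mulVg eps_elt1.
have invr (z : sg_type (sval P)) : eps (tr_elt z) \oc eps (tr_elt z^-1%g) = idmor C P.
  by rewrite -eps_eltM mulgV eps_elt1.
have [h [hf fh]] : is_iso f.
  apply: (@is_iso_of_sides _ C _ _ f (eps (tr_elt y^-1%g) \oc g) (g \oc eps (tr_elt x^-1%g))).
    by rewrite -compmA yE inv.
  by rewrite compmA xE invr.
by exists (Aut fh hf); apply: aut_eq; rewrite fE.
Qed.

Lemma stabilizerE Q (s : mor C P Q) (a : aut C P) :
  sg_set (stabilizer (to_orbit s)) (aut_orbit a) <->
  exists q : sg_type (sval Q), s \oc aut_fwd a = eps (tr_elt q) \oc s.
Proof.
have -> : sg_set (stabilizer (to_orbit s)) (aut_orbit a) =
    (to_orbit (s \oc aut_fwd a) = to_orbit s) by rewrite -to_orbit_comp.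
by split=> [/esym/to_orbit_eq|h] //; apply/esym/to_orbit_eq.
Qed.

(** If s a = q s then s a^n = q^n s for all n, and s is a monomorphism. *)
Lemma stabilizer_torsion Q (psi : mor O P Q) : p_subgroup p (stabilizer psi).
Proof.
move=> c; have [s ->] := to_orbit_surj psi; have [a <-] := aut_orbit_surj c.
move=> /stabilizerE [q qE].
have [k qk] := torsion_subgroup (P := sval Q) S_torsion q; exists k.
have sX n : s \oc aut_fwd (a ^+ n)%g = eps (tr_elt (q ^+ n)%g) \oc s.
  elim: n => [|n IH]; first by rewrite eps_elt1 compm1 comp1m.
  by rewrite expgS /= compmA qE -compmA IH compmA -eps_eltM -expgS.
rewrite -aut_orbitX (_ : (a ^+ (p ^ k))%g = 1%g) ?aut_orbit1 //.
apply: aut_eq; apply: (@ts_mono _ _ _ T _ _ _ s).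
by rewrite sX qk eps_elt1 comp1m compm1.
Qed.

Variable N : normal_subgroup S.
Hypothesis N_toral : toral_structure p N.

Lemma endo_orbit_iso (psi : mor O P P) : is_iso psi.
Proof.
have [s ->] := to_orbit_surj psi; apply/to_orbit_iso/is_iso_of_rho_surj.
exact: (injective_endo_surjective S_torsion N_toral (rho_mul s) (@rho_inj _ _ _ _ _ _ s)).
Qed.

(** If the image R of a representative s is proper in Q, an element g of Q outside R
    that normalizes R is carried by the isomorphism of P with R to an automorphism of P
    that stabilizes the class of s; it is not trivial in the orbit category because g
    is not in R. *)
Lemma free_orbit_iso Q (psi : mor O P Q) : sg_trivial (stabilizer psi) -> is_iso psi.
Proof.
have [s ->] := to_orbit_surj psi => st1.
have [R [RQ [a [sE [b [ba ab]] RE]]]] := ts_factor s.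
have [QR|nQR] := pselect (sval Q `<=` sval R).
  apply/to_orbit_iso/is_iso_of_rho_surj => y.
  by have /RE [x xy] := QR _ (sg_typeP y); exists x; exact: val_inj.
have [g [Qg nRg Ng]] := normalizer_grows p_prime S_torsion N_toral RQ nQR.
have abs : b \oc eps (tr_norm (P := R) (sg_mk Ng)) \oc a \oc
    (b \oc eps (tr_norm (P := R) (sg_mk Ng)^-1%g) \oc a) = idmor C P.
  rewrite -!compmA (compmA a b) ab comp1m (compmA (eps _) (eps _)) -fmap_comp.
  rewrite (_ : _ \oc _ = idmor (transporter_cat (ts_ob T)) R) ?fmap_id ?comp1m //.
  by apply: tr_eq; exact: mulgV.
have abs' : b \oc eps (tr_norm (P := R) (sg_mk Ng)^-1%g) \oc a \oc
    (b \oc eps (tr_norm (P := R) (sg_mk Ng)) \oc a) = idmor C P.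
  rewrite -!compmA (compmA a b) ab comp1m (compmA (eps _) (eps _)) -fmap_comp.
  rewrite (_ : _ \oc _ = idmor (transporter_cat (ts_ob T)) R) ?fmap_id ?comp1m //.
  by apply: tr_eq; exact: mulVg.
pose c : aut C P := Aut abs abs'.
have /st1/aut_orbit_eq1 [h Ph cE] : sg_set (stabilizer (to_orbit s)) (aut_orbit c).
  apply/stabilizerE; exists (sg_mk Qg).
  rewrite sE /= -!compmA (compmA a b) ab comp1m !compmA.
  by rewrite (@eps_norm_incl _ _ _ _ _ _ RQ _ (sg_mk Qg)).
have e : eps (tr_norm (P := R) (sg_mk Ng)) = eps (tr_elt (rho a (sg_mk Ph))).
  have := congr1 (fun f => a \oc f \oc b) (congr1 (@aut_fwd _ _ _) cE).
  rewrite /= -!compmA ab compm1 !compmA ab comp1m => ->.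
  have -> : tr_norm (P := P) h = tr_elt (sg_mk Ph) by exact: tr_eq.
  by rewrite ts_push -compmA ab compm1.
case: nRg; have /(congr1 sval) /= -> := ts_eps_inj e.
exact: sg_typeP.
Qed.
End AutOrbit.

Section Quotient.
Variable P : ob.
Variable n : nat.
Hypotheses (np : coprime n p)
  (Pn : has_index [set a : aut C P | exists g : sg_type (normalizer (sval P)),
        aut_fwd a = eps (tr_norm (P := P) g)] n).
Variable K : subgroup (aut O P).
Hypothesis K_p : p_subgroup p K.

Definition lift_group : subgroup (aut C P).
Proof.
refine (@Subgroup (aut C P) [set a | sg_set K (aut_orbit a)] _ _ _).
- by rewrite /= aut_orbit1; exact: sg1.
- by move=> a b Ka Kb; rewrite /= aut_orbitM; exact: sgM.
- by move=> a Ka; rewrite /= aut_orbitV; exact: sgV.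
Defined.

(** An extension of the torsion group K by P. *)
Lemma lift_group_torsion : torsion p (sg_type lift_group).
Proof.
have valX (x : sg_type lift_group) m : val (x ^+ m)%g = (val x ^+ m)%g.
  by elim: m => [|m IH] //; rewrite !expgS -IH.
have valX' (x : sg_type (normalizer (sval P))) m : val (x ^+ m)%g = (val x ^+ m)%g.
  by elim: m => [|m IH] //; rewrite !expgS -IH.
move=> a; have [k] := K_p (sg_typeP a).
rewrite -aut_orbitX => /aut_orbit_eq1 [g Pg aE]; have [l gl] := S_torsion (val g).
exists (k + l)%N; apply/val_inj; rewrite valX expnD expgM aE -eps_normX.
rewrite (_ : (g ^+ (p ^ l))%g = 1%g) ?eps_norm1 //.
by apply/val_inj; rewrite valX' gl.
Qed.

(** The preimage of K acts on the cosets of N_S(P), whose number is prime to p, so it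
    fixes one of them. *)
Lemma sylow_conjugate : exists x : aut C P, forall k, sg_set lift_group k ->
  exists g, (k * x)%g = (x * eps_norm g)%g.
Proof.
pose A0 : set (aut C P) := [set a | exists g : sg_type (normalizer (sval P)),
  aut_fwd a = eps (tr_norm (P := P) g)].
pose cos (x : aut C P) := [set (x * a)%g | a in A0].
have cosE (k : sg_type lift_group) x : translate k (cos x) = cos (val k * x)%g.
  apply/seteqP; split=> [y [a Aa e]|_ [a Aa <-]].
    by exists a => //; rewrite -mulgA e mulgA mulgV mul1g.
  by exists a => //; rewrite !mulgA mulVg mul1g.
have stable (k : sg_type lift_group) Y : [set cos x | x in [set: aut C P]] Y ->
    [set cos x | x in [set: aut C P]] (translate k Y).
  by move=> [x _ <-]; rewrite cosE; exists (val k * x)%g.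
have [_ [x _ <-] fix_x] := coprime_fixed_point p_prime lift_group_torsion
  (@translate1 _ lift_group) (@translateM _ lift_group) Pn stable np.
exists x => k Kk; have : cos x (k * x)%g.
  have e : cos (k * x)%g = cos x by rewrite -(cosE (sg_mk Kk)); exact: fix_x.
  rewrite -e.
  exists 1%g; last by rewrite mulg1.
  by exists 1%g; exact: (congr1 (@aut_fwd _ _ _) (esym (eps_norm1 P))).
by move=> [a [g aE] <-]; exists g; congr (_ * _)%g; exact: aut_eq.
Qed.

(** With x as in sylow_conjugate, conjugation by x^-1 carries the preimage of K onto
    the image of a group L between P and N_S(P).  The quotient is x^-1 followed by the
    inclusion of P in L. *)
Lemma quotient_exists_sylow : exists Q (phi : mor O P Q), is_quotient K phi.
Proof.
have [x xK] := sylow_conjugate.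
pose inL g := sg_set lift_group (x * eps_norm g * x^-1)%g.
have [L0 L0E] : exists L0 : subgroup S, forall g, sg_set L0 g <->
    exists2 h : sg_type (normalizer (sval P)), val h = g & inL h.
  pose A := [set g | exists2 h : sg_type (normalizer (sval P)), val h = g & inL h].
  have A1 : A 1%g by exists 1%g => //; rewrite /inL eps_norm1 mulg1 mulgV; exact: sg1.
  have AM g h : A g -> A h -> A (g * h)%g.
    move=> [g' <- Lg] [h' <- Lh]; exists (g' * h')%g => //.
    by have := sgM Lg Lh; rewrite /inL eps_normM !mulgA mulgVK.
  have AV g : A g -> A g^-1%g.
    move=> [g' <- Lg]; exists g'^-1%g => //.
    by have := sgV Lg; rewrite /inL eps_normV !invgM invgK !mulgA.
  by exists (Subgroup A1 AM AV).
have PL0 : sval P `<=` L0.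
  move=> g Pg; have Ng := sub_normalizer Pg; apply/L0E; exists (sg_mk Ng) => //.
  rewrite /inL /= !aut_orbitM aut_orbitV.
  have -> : aut_orbit (eps_norm (sg_mk Ng)) = 1%g by apply/aut_orbit_eq1; exists (sg_mk Ng).
  by rewrite mulg1 mulgV; exact: sg1.
pose L : ob := exist _ L0 (ts_over (svalP P) PL0).
have PL : sval P `<=` sval L := PL0.
have LN : sval L `<=` normalizer (sval P) by move=> _ /L0E [h <- _]; exact: sg_typeP.
have inLE (g : sg_type (normalizer (sval P))) : sg_set (sval L) (val g) <-> inL g.
  by split=> [/L0E [h /val_inj <-]|Lg] //; apply/L0E; exists g.
pose i := eps (tr_incl PL).
exists L, (to_orbit (i \oc aut_bwd x)); split.
- move=> c; have [k <-] := aut_orbit_surj c => Kk.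
  have [g kx] := xK k Kk.
  have Lg : sg_set (sval L) (val g).
    by apply/inLE; rewrite /inL -kx mulgK.
  apply/stabilizerE; exists (sg_mk Lg).
  have xk : aut_bwd x \oc aut_fwd k = eps (tr_norm (P := P) g) \oc aut_bwd x.
    have e : (x^-1 * k = eps_norm g * x^-1)%g.
      by apply: (mulgI x); apply: (mulIg x); rewrite !mulgA mulgV mul1g kx mulgVK.
    exact: (congr1 (@aut_fwd _ _ _) e).
  by rewrite -compmA xk !compmA (@eps_norm_incl _ _ _ _ _ _ PL _ (sg_mk Lg)).
- move=> R psi; have [s ->] := to_orbit_surj psi => fix_s.
  have [|s' s'E] := @ts_extend_normal _ _ _ T p_prime S_torsion P L R PL (s \oc aut_fwd x) LN.
    move=> g /inLE; rewrite /inL; set k := (x * eps_norm g * x^-1)%g => Kk.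
    have /stabilizerE [r rE] := fix_s _ Kk.
    exists r; have kx : (k * x = x * eps_norm g)%g by rewrite /k mulgVK.
    have {}kx := congr1 (@aut_fwd _ _ _) kx.
    by rewrite -compmA [RHS]compmA -rE -[RHS]compmA; congr (_ \oc _); exact: esym kx.
  exists (to_orbit s'); rewrite to_orbit_comp compmA s'E.
  by rewrite -compmA aut_fb compm1.
- move=> R h h'; have [[a ->] [b ->]] := (to_orbit_surj h, to_orbit_surj h').
  rewrite !to_orbit_comp => /to_orbit_eq [r rE]; apply/to_orbit_eq; exists r.
  apply: (@ts_epi_normal _ _ _ T P L R PL) => //.
  have := congr1 (fun f => f \oc aut_fwd x) rE.
  by rewrite -!compmA aut_bf !compm1 !compmA.
Qed.
End Quotient.

(** Every conjugacy class contains an object to which the Sylow argument applies, and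
    quotients transport along isomorphisms. *)
Lemma quotient_exists (P : ob) (K : subgroup (aut O P)) : p_subgroup p K ->
  exists Q (phi : mor O P Q), is_quotient K phi.
Proof.
move=> Kp; have [P' PP' [n np Pn]] := ts_sylow P.
have [a [b [ba ab]]] := orbit_conj_isomorphic PP'.
pose u := to_orbit a; pose v := to_orbit b.
have vu : v \oc u = idmor O P by rewrite to_orbit_comp ba.
have uv : u \oc v = idmor O P' by rewrite to_orbit_comp ab.
have trans Q Q' (f : mor O Q Q') (f' : mor O Q' Q) (c : aut O Q) :
    f' \oc f = idmor O Q -> f \oc f' = idmor O Q' ->
    exists2 d : aut O Q', aut_fwd d = f \oc aut_fwd c \oc f' &
      f \oc aut_fwd c = aut_fwd d \oc f.
  move=> f'f ff'.
  have e (x y : aut O Q) : (x * y = 1)%g ->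
      f \oc aut_fwd x \oc f' \oc (f \oc aut_fwd y \oc f') = idmor O Q'.
    move=> xy; rewrite -!compmA (compmA f' f) f'f comp1m (compmA (aut_fwd x)).
    have -> : aut_fwd x \oc aut_fwd y = idmor O Q by exact: (congr1 (@aut_fwd _ _ _) xy).
    by rewrite comp1m.
  exists (Aut (e _ _ (mulgV c)) (e _ _ (mulVg c))); first exact: erefl.
  have -> : aut_fwd (Aut (e _ _ (mulgV c)) (e _ _ (mulVg c))) = f \oc aut_fwd c \oc f' by [].
  by rewrite -!compmA f'f compm1.
have back (c : aut O P') : {d : aut O P | aut_fwd d = v \oc aut_fwd c \oc u}.
  by apply: cid; have [d dE _] := trans _ _ v u c uv vu; exists d.
pose cj c := sval (back c).
have cjE c : aut_fwd (cj c) = v \oc aut_fwd c \oc u := svalP (back c).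
have cjM c d : cj (c * d)%g = (cj c * cj d)%g.
  have fwdM Q (x y : aut O Q) : aut_fwd (x * y)%g = aut_fwd x \oc aut_fwd y by [].
  apply: aut_eq; rewrite fwdM !cjE fwdM -!compmA (compmA u v) uv comp1m.
  by rewrite !compmA.
have cj_inj : injective cj.
  move=> c d /(congr1 (@aut_fwd _ _ _)); rewrite !cjE => e; apply: aut_eq.
  have := congr1 (fun f => u \oc f \oc v) e.
  by rewrite -!compmA uv !compm1 !compmA uv !comp1m.
have cj1 : cj 1%g = 1%g by apply: (mulgI (cj 1%g)); rewrite -cjM !mulg1.
have cjV c : cj c^-1%g = (cj c)^-1%g.
  by apply: (mulgI (cj c)); rewrite -cjM !mulgV.
pose K' : subgroup (aut O P') := @Subgroup (aut O P') [set c | sg_set K (cj c)]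
  (eq_ind_r (sg_set K) (sg1 K) cj1)
  (fun c d Kc Kd => eq_ind_r (sg_set K) (sgM Kc Kd) (cjM c d))
  (fun c Kc => eq_ind_r (sg_set K) (sgV Kc) (cjV c)).
have K'p : p_subgroup p K'.
  move=> c /Kp [k ck]; exists k; apply: cj_inj; rewrite cj1 -ck.
  by elim: (p ^ k)%N => [|m IH]; rewrite ?cj1 // !expgS cjM IH.
have [Q [phi phiP]] := quotient_exists_sylow np Pn K'p.
exists Q, (phi \oc u); apply: (is_quotient_iso vu uv _ _ phiP).
- move=> c Kc; have [d dE ud] := trans _ _ u v c vu uv; exists d => //.
  rewrite /= (_ : cj d = c) //; apply: aut_eq; rewrite cjE dE.
  by rewrite -!compmA vu compm1 compmA vu comp1m.
- move=> c Kc; exists (cj c) => //.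
  by rewrite cjE !compmA uv comp1m.
Qed.
End TransporterOrbits.

Theorem proposition2p3 (p : nat) (p_prime : prime p)
    (S : groupType) (S_toral : discrete_p_toral p S)
    (F : fusion_system S) (F_sat : saturated F p)
    (T : transporter_system p F) (P : ts_object T)
    (Phi : presheaf (orbit_cat T))
    (Phi0 : forall Q : ts_object T,
      ~ F_conjugate F (sval P) (sval Q) -> forall x : Phi Q, x = 0%R) :
  graded_iso (higher_lim Phi) (Lambda p (value_module Phi P)).
Proof.
have [N N_toral] := discrete_p_toral_structure p_prime S_toral.
have S_torsion := toral_torsion N_toral.
apply: higher_lim_Lambda.
- exact: quotient_exists.
- by move=> Q psi; exact: stabilizer_torsion.
- by move=> Q psi; exact: (free_orbit_iso p_prime S_torsion N_toral).
- by move=> psi; exact: (endo_orbit_iso S_torsion N_toral).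
- move=> Q nPQ; apply: Phi0 => /orbit_conj_isomorphic [a [b [ba ab]]]; apply: nPQ.
  by exists (to_orbit a), (to_orbit b); rewrite !to_orbit_comp ba ab.
Qed.
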